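(* Let $(\mathcal H_n)_{n\ge 1}$ denote either the family $\mathcal H_n=\mathcal H_n(q,\infty)$, in which case put $Z=\mathbb Z$, or, for a fixed integer $d\ge 1$, the family $\mathcal H_n=\mathcal H_n(q,d)$, in which case put $Z=\mathbb Z_d:=\{0,1,\dots,d-1\}$. Let $z$ and $s_k$ ($k\in Z$, $k\neq 0$) be given elements of $\mathcal R$. Then there exists a unique $\mathcal R$-linear function $$tr:\ \mathcal H:=\bigcup_{n=1}^{\infty}\mathcal H_n\longrightarrow \mathcal R$$ satisfying the following rules for all $n\ge 1$: 1) $tr(ab)=tr(ba)$ for all $a,b\in\mathcal H_n$; 2) $tr(1)=1$; 3) $tr(ag_n)=z\,tr(a)$ for all $a\in\mathcal H_n$; 4) $tr(a\,{t'_n}^{k})=s_k\,tr(a)$ for all $a\in\mathcal H_n$ and all $k\in Z$, $k\ne 0$.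
   Context: For $n\ge 1$, $B_{1,n}$ (the Artin braid group of type $\mathcal B_n$) is the group with generators $t,\sigma_1,\dots,\sigma_{n-1}$ and relations $\sigma_1t\sigma_1t=t\sigma_1t\sigma_1$; $t\sigma_i=\sigma_it$ for $i>1$; $\sigma_i\sigma_j=\sigma_j\sigma_i$ for $|i-j|>1$; $\sigma_i\sigma_{i+1}\sigma_i=\sigma_{i+1}\sigma_i\sigma_{i+1}$ for $1\le i\le n-2$. Let $\mathcal R=\mathbb Z[q^{\pm1},u_1^{\pm1},\dots,u_d^{\pm1},\dots]$ with $q,u_1,u_2,\dots$ indeterminates. The generalized Iwahori-Hecke algebra $\mathcal H_n(q,\infty)$ is the quotient of the group algebra $\mathcal R B_{1,n}$ by the relations $\sigma_i^2=(q-1)\sigma_i+q$ for all $i$. The cyclotomic Iwahori-Hecke algebra $\mathcal H_n(q,d)$ is the quotient of $\mathcal R B_{1,n}$ by the relations $\sigma_i^2=(q-1)\sigma_i+q$ for all $i$ and $(t-u_1)(t-u_2)\cdots(t-u_d)=0$. The image of $\sigma_i$ is denoted $g_i$, the image of $t$ is denoted $t$. The natural inclusion $B_{1,n}\subset B_{1,n+1}$ induces an inclusion $\mathcal H_n\subset\mathcal H_{n+1}$, so the union makes sense. For $i\ge 1$, $t'_i:=g_i\cdots g_1\,t\,g_1^{-1}\cdots g_i^{-1}$, and $t'_0:=t$; thus $g_n,t'_n\in\mathcal H_{n+1}$. *)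

(* Defs.v *)
From HB Require Import structures.
From mathcomp Require Import all_boot all_algebra.
From mathcomp Require Import boolp.
From mathcomp Require Import finmap.
From mathcomp.multinomials Require Import monalg.

Set Implicit Arguments.
Unset Strict Implicit.
Unset Printing Implicit Defensive.

Import GRing.Theory.
Local Open Scope quotient_scope.


Section PresentedGroup.
Variables (X : choiceType) (rel : seq X -> seq X -> Prop).

(* (x, true) stands for x and (x, false) for its inverse. *)
Local Notation word := (seq (X * bool)).

Definition posw (w : seq X) : word := [seq (x, true) | x <- w].

(* The congruence on words whose classes are the elements of the group
   presented by the generators x : X and the relations r = s for rel r s. *)
Inductive pres_eq : word -> word -> Prop :=
| pres_refl w : pres_eq w w
| pres_sym v w : pres_eq v w -> pres_eq w v
| pres_trans v u w : pres_eq v u -> pres_eq u w -> pres_eq v w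
| pres_cat v v' w w' : pres_eq v v' -> pres_eq w w' -> pres_eq (v ++ w) (v' ++ w')
| pres_cancel x b : pres_eq [:: (x, b); (x, ~~ b)] [::]
| pres_rel r s : rel r s -> pres_eq (posw r) (posw s).

Definition pres_eqb v w := `[< pres_eq v w >].

Fact pres_eqb_refl : reflexive pres_eqb.
Proof. by move=> w; apply/asboolP/pres_refl. Qed.
Fact pres_eqb_sym : symmetric pres_eqb.
Proof. by move=> v w; apply: asbool_equiv_eq; split; apply: pres_sym. Qed.
Fact pres_eqb_trans : transitive pres_eqb.
Proof.
by move=> u v w /asboolP vu /asboolP uw; apply/asboolP/(pres_trans vu uw).
Qed.

Canonical pres_equiv := EquivRel pres_eqb pres_eqb_refl pres_eqb_sym pres_eqb_trans.

Definition presgroup := {eq_quot pres_equiv}.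
HB.instance Definition _ := Choice.on presgroup.
HB.instance Definition _ := EqQuotient.on presgroup.

Definition cls (w : word) : presgroup := \pi_presgroup w.

Lemma clsP v w : cls v = cls w <-> pres_eq v w.
Proof.
split=> [/eqP|h]; first by rewrite /cls piE => /asboolP.
by apply/eqP; rewrite /cls piE; apply/asboolP.
Qed.

Lemma clsK w : cls (repr w) = w. Proof. exact: reprK. Qed.

Lemma repr_cls w : pres_eq (repr (cls w)) w.
Proof. by apply/clsP; rewrite clsK. Qed.

Definition invw (w : word) : word := rev [seq (p.1, ~~ p.2) | p <- w].

Lemma invw_cat v w : invw (v ++ w) = invw w ++ invw v.
Proof. by rewrite /invw map_cat rev_cat. Qed.

Lemma invwK : involutive invw.
Proof.
move=> w; rewrite /invw map_rev revK -map_comp -[RHS]map_id.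
by apply: eq_map => -[x b] /=; rewrite negbK.
Qed.

Lemma catVw w : pres_eq (invw w ++ w) [::].
Proof.
elim: w => [|[x b] w IHw]; first exact: pres_refl.
rewrite -cat1s invw_cat -catA.
apply: pres_trans IHw; apply: pres_cat; first exact: pres_refl.
rewrite catA -[X in pres_eq _ X]cat0s; apply: pres_cat (pres_refl _).
by have := pres_cancel x (~~ b); rewrite negbK.
Qed.

Lemma catwV w : pres_eq (w ++ invw w) [::].
Proof. by rewrite -{1}[w]invwK; apply: catVw. Qed.

Lemma invw_eq v w : pres_eq v w -> pres_eq (invw v) (invw w).
Proof.
move=> vw; apply: pres_trans (_ : pres_eq _ (invw v ++ (w ++ invw w))) _.
  rewrite -[X in pres_eq X _]cats0; apply: pres_cat (pres_refl _) _.
  exact/pres_sym/catwV.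
rewrite catA -[X in pres_eq _ X]cat0s; apply: pres_cat (pres_refl _).
apply: pres_trans (catVw v).
by apply: pres_cat (pres_refl _) (pres_sym vw).
Qed.

Definition pg_one : presgroup := cls [::].
Definition pg_mul (v w : presgroup) : presgroup := cls (repr v ++ repr w).
Definition pg_inv (w : presgroup) : presgroup := cls (invw (repr w)).

Lemma cls_cat v w : cls (v ++ w) = pg_mul (cls v) (cls w).
Proof. by apply/clsP/pres_cat; apply/pres_sym/repr_cls. Qed.

Lemma cls_inv w : cls (invw w) = pg_inv (cls w).
Proof. by apply/clsP/invw_eq; apply/pres_sym/repr_cls. Qed.

Fact pg_mulA : associative pg_mul.
Proof.
move=> u v w; rewrite -[u]clsK -[v]clsK -[w]clsK.
by rewrite -!cls_cat catA.
Qed.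
Fact pg_mul1 : left_id pg_one pg_mul.
Proof. by move=> w; rewrite -[w]clsK -cls_cat. Qed.
Fact pg_1mul : right_id pg_one pg_mul.
Proof. by move=> w; rewrite -[w]clsK -cls_cat cats0. Qed.
Fact pg_mulV : left_inverse pg_one pg_inv pg_mul.
Proof.
by move=> w; rewrite -[w]clsK -cls_inv -cls_cat; apply/clsP/catVw.
Qed.
Fact pg_Vmul : right_inverse pg_one pg_inv pg_mul.
Proof.
by move=> w; rewrite -[w]clsK -cls_inv -cls_cat; apply/clsP/catwV.
Qed.

HB.instance Definition _ :=
  isGroup.Build presgroup pg_mulA pg_mul1 pg_1mul pg_mulV pg_Vmul.

Definition pgen (x : X) : presgroup := cls [:: (x, true)].

End PresentedGroup.

Section PresentedGroupMap.
Variables (X Y : choiceType) (relX : seq X -> seq X -> Prop).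
Variables (relY : seq Y -> seq Y -> Prop) (f : X -> Y).
Hypothesis frel : forall r s, relX r s -> relY (map f r) (map f s).

Definition mapw : seq (X * bool) -> seq (Y * bool) :=
  map (fun p => (f p.1, p.2)).

Lemma mapw_eq v w : pres_eq relX v w -> pres_eq relY (mapw v) (mapw w).
Proof.
elim=> {v w}.
- by move=> w; apply: pres_refl.
- by move=> v w _; apply: pres_sym.
- by move=> v u w _ vu _; apply: pres_trans vu.
- by move=> v v' w w' _ vv _ ww; rewrite /mapw !map_cat; apply: pres_cat.
- by move=> x b; apply: pres_cancel.
- move=> r s /frel /pres_rel; rewrite /mapw /posw -!map_comp.
  by [].
Qed.

Definition presgroup_map (g : presgroup relX) : presgroup relY :=
  cls relY (mapw (repr g)).

Lemma presgroup_map_cls w : presgroup_map (cls relX w) = cls relY (mapw w).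
Proof. by apply/clsP/mapw_eq/repr_cls. Qed.

Fact presgroup_map1 : presgroup_map 1%g = 1%g.
Proof. exact: presgroup_map_cls. Qed.

Fact presgroup_mapM : {morph presgroup_map : x y / (x * y)%g}.
Proof.
move=> x y; rewrite -[x](clsK x) -[y](clsK y).
rewrite -[(_ * _)%g]cls_cat !presgroup_map_cls /mapw map_cat.
exact: cls_cat.
Qed.

End PresentedGroupMap.

Local Open Scope ring_scope.

(* monalg's ring structure on {malg R[K]} requires a monoid K without
   non-trivial units, which excludes groups; only the underlying free R-module
   is taken from there. *)
Definition gralg (R : nzRingType) (G : groupType) : Type := {malg R[G]}.

HB.lock Definition gr_mul (R : nzRingType) (G : groupType) (x y : gralg R G) :
    gralg R G :=
  \sum_(g <- msupp x) \sum_(h <- msupp y) << x@_g * y@_h *g (g * h)%g >>.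
Arguments gr_mul {R G} x y.

HB.lock Definition gr_scale (R : nzRingType) (G : groupType) (c : R)
    (x : gralg R G) : gralg R G := c *: (x : {malg R[G]}).
Arguments gr_scale {R G} c x.

Section GroupAlgebra.
Variables (R : nzRingType) (G : groupType).

HB.instance Definition _ := GRing.Zmodule.on (gralg R G).

Local Notation A := (gralg R G).
Implicit Types x y z : A.

Lemma gr_scaleE c x g : (gr_scale c x)@_g = c * x@_g.
Proof. by rewrite gr_scale.unlock mcoeffZ. Qed.

Fact gr_scaleA c d x : gr_scale c (gr_scale d x) = gr_scale (c * d) x.
Proof. by rewrite gr_scale.unlock scalerA. Qed.
Fact gr_scale1 : left_id 1 (@gr_scale R G).
Proof. by move=> x; rewrite gr_scale.unlock scale1r. Qed.
Fact gr_scaleDr : right_distributive (@gr_scale R G) +%R.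
Proof. by move=> c x y; rewrite gr_scale.unlock scalerDr. Qed.
Fact gr_scaleDl x : {morph (@gr_scale R G)^~ x : c d / c + d}.
Proof. by move=> c d; rewrite gr_scale.unlock scalerDl. Qed.

HB.instance Definition _ := GRing.Zmodule_isLmodule.Build R (gralg R G)
  gr_scaleA gr_scale1 gr_scaleDr gr_scaleDl.

Definition gr_elt (g : G) : A := << g >>.

Lemma gr_mulEw (d1 d2 : {fset G}) x y :
  (msupp x `<=` d1)%fset -> (msupp y `<=` d2)%fset ->
  gr_mul x y = \sum_(g <- d1) \sum_(h <- d2) << x@_g * y@_h *g (g * h)%g >>.
Proof.
move=> le1 le2; rewrite gr_mul.unlock (big_fset_incl _ le1) /=.
  apply/eq_bigr=> k1 _; apply/big_fset_incl => // k _ /mcoeff_outdom ->.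
  by rewrite mulr0 monalgU0.
move=> k _ /mcoeff_outdom ->.
by rewrite big1 => // k' _; rewrite mul0r monalgU0.
Qed.

Lemma gr_mulDl : left_distributive (@gr_mul R G) +%R.
Proof.
move=> x y z.
rewrite (gr_mulEw (fsubsetUl (msupp x) (msupp y)) (fsubset_refl (msupp z))).
rewrite (gr_mulEw (fsubsetUr (msupp x) (msupp y)) (fsubset_refl (msupp z))).
rewrite (gr_mulEw (msuppD_le x y) (fsubset_refl (msupp z))).
rewrite -big_split /=; apply/eq_bigr=> k1 _.
rewrite -big_split /=; apply/eq_bigr=> k2 _.
by rewrite mcoeffD mulrDl monalgUD.
Qed.

Lemma gr_mulDr : right_distributive (@gr_mul R G) +%R.
Proof.
move=> x y z.
rewrite (gr_mulEw (fsubset_refl (msupp x)) (fsubsetUl (msupp y) (msupp z))).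
rewrite (gr_mulEw (fsubset_refl (msupp x)) (fsubsetUr (msupp y) (msupp z))).
rewrite (gr_mulEw (fsubset_refl (msupp x)) (msuppD_le y z)).
rewrite -big_split /=; apply/eq_bigr=> k1 _.
rewrite -big_split /=; apply/eq_bigr=> k2 _.
by rewrite mcoeffD mulrDr monalgUD.
Qed.

Lemma gr_mul0 : left_zero (0 : A) gr_mul.
Proof. by move=> x; rewrite gr_mul.unlock msupp0 big_seq_fset0. Qed.

Lemma gr_0mul : right_zero (0 : A) gr_mul.
Proof. by move=> x; rewrite gr_mul.unlock msupp0 big1 // => g _; rewrite big_seq_fset0. Qed.

Lemma gr_mulUU c d g h :
  gr_mul (<< c *g g >> : A) (<< d *g h >> : A) = << c * d *g (g * h)%g >>.
Proof. by rewrite (gr_mulEw msuppU_le msuppU_le) !big_seq_fset1 !mcoeffUU. Qed.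

Lemma gr_ind (P : A -> Prop) :
  P 0 -> (forall x y, P x -> P y -> P (x + y)) ->
  (forall c g, P << c *g g >>) -> forall x, P x.
Proof. by move=> P0 PD PU x; rewrite [x]monalgE; elim/big_ind: _. Qed.

Fact gr_mulA : associative (@gr_mul R G).
Proof.
move=> x y z; elim/gr_ind: x => [|x x' ex ex'|c g].
- by rewrite !gr_mul0.
- by rewrite !gr_mulDl ex ex'.
elim/gr_ind: y => [|y y' ey ey'|d h].
- by rewrite !(gr_mul0, gr_0mul).
- by rewrite !(gr_mulDl, gr_mulDr) ey ey'.
elim/gr_ind: z => [|z z' ez ez'|e k].
- by rewrite !gr_0mul.
- by rewrite !gr_mulDr ez ez'.
by rewrite !gr_mulUU mulrA mulgA.
Qed.

Fact gr_mul1x : left_id (gr_elt 1%g) (@gr_mul R G).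
Proof.
elim/gr_ind=> [|x y ex ey|c g]; first by rewrite gr_0mul.
  by rewrite gr_mulDr ex ey.
by rewrite gr_mulUU mul1r mul1g.
Qed.

Fact gr_mulx1 : right_id (gr_elt 1%g) (@gr_mul R G).
Proof.
elim/gr_ind=> [|x y ex ey|c g]; first by rewrite gr_mul0.
  by rewrite gr_mulDl ex ey.
by rewrite gr_mulUU mulr1 mulg1.
Qed.

Fact gr_oner_neq0 : gr_elt 1%g != 0.
Proof. by apply/eqP/malgP=> /(_ 1%g) /eqP; rewrite !mcoeffsE oner_eq0. Qed.

HB.instance Definition _ := GRing.Zmodule_isNzRing.Build (gralg R G)
  gr_mulA gr_mul1x gr_mulx1 gr_mulDl gr_mulDr gr_oner_neq0.

Lemma gr_MUU c d g h :
  (<< c *g g >> : A) * (<< d *g h >> : A) = << c * d *g (g * h)%g >>.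
Proof. exact: gr_mulUU. Qed.

Lemma gr_eltM g h : gr_elt (g * h)%g = gr_elt g * gr_elt h.
Proof. by rewrite /gr_elt gr_MUU mulr1. Qed.

Lemma gr_elt1 : gr_elt 1%g = 1.
Proof. by []. Qed.

Lemma gr_scaleU c d g : c *: (<< d *g g >> : A) = << c * d *g g >>.
Proof. by apply/malgP=> h; rewrite gr_scaleE !mcoeffU mulrnAr. Qed.

Fact gr_scaleAl (c : R) x y : c *: (x * y) = (c *: x) * y.
Proof.
elim/gr_ind: x => [|x x' ex ex'|d g].
- by rewrite !(mul0r, scaler0).
- by rewrite !(mulrDl, scalerDr) ex ex'.
elim/gr_ind: y => [|y y' ey ey'|e h].
- by rewrite !(mulr0, scaler0).
- by rewrite !(mulrDr, scalerDr) ey ey'.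
by rewrite gr_scaleU !gr_MUU gr_scaleU mulrA.
Qed.

HB.instance Definition _ :=
  GRing.Lmodule_isLalgebra.Build R (gralg R G) gr_scaleAl.

End GroupAlgebra.

Section GroupAlgebraCom.
Variables (R : comNzRingType) (G : groupType).

Fact gr_scaleAr (c : R) (x y : gralg R G) : c *: (x * y) = x * (c *: y).
Proof.
elim/gr_ind: x => [|x x' ex ex'|d g].
- by rewrite !(mul0r, scaler0).
- by rewrite !(mulrDl, scalerDr) ex ex'.
elim/gr_ind: y => [|y y' ey ey'|e h].
- by rewrite !(mulr0, scaler0).
- by rewrite !(mulrDr, scalerDr) ey ey'.
by rewrite gr_MUU !gr_scaleU gr_MUU mulrCA.
Qed.

Lemma gr_mulC : (forall g h : G, (g * h)%g = (h * g)%g) ->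
  commutative (@gr_mul R G).
Proof.
move=> mulGC x y; elim/gr_ind: x => [|x x' ex ex'|c g].
- by rewrite gr_mul0 gr_0mul.
- by rewrite gr_mulDl gr_mulDr ex ex'.
elim/gr_ind: y => [|y y' ey ey'|d h].
- by rewrite gr_mul0 gr_0mul.
- by rewrite gr_mulDl gr_mulDr ey ey'.
by rewrite !gr_mulUU mulrC mulGC.
Qed.

HB.instance Definition _ :=
  GRing.Lalgebra_isAlgebra.Build R (gralg R G) gr_scaleAr.

End GroupAlgebraCom.

Section GroupAlgebraMap.
Variables (R : nzRingType) (G H : groupType) (f : G -> H).

Definition gr_map (x : gralg R G) : gralg R H :=
  \sum_(g <- msupp x) << x@_g *g f g >>.

Lemma gr_mapEw (d : {fset G}) (x : gralg R G) :
  (msupp x `<=` d)%fset -> gr_map x = \sum_(g <- d) << x@_g *g f g >>.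
Proof.
move=> le; apply: big_fset_incl => // k _ /mcoeff_outdom ->.
by rewrite monalgU0.
Qed.

Lemma gr_mapU c g : gr_map << c *g g >> = << c *g f g >>.
Proof. by rewrite (gr_mapEw msuppU_le) big_seq_fset1 mcoeffUU. Qed.

Lemma gr_map0 : gr_map 0 = 0.
Proof. by rewrite /gr_map msupp0 big_seq_fset0. Qed.

Lemma gr_mapD x y : gr_map (x + y) = gr_map x + gr_map y.
Proof.
rewrite (gr_mapEw (fsubsetUl (msupp x) (msupp y))).
rewrite (gr_mapEw (fsubsetUr (msupp x) (msupp y))).
rewrite (gr_mapEw (msuppD_le x y)) -big_split /=; apply/eq_bigr=> k _.
by rewrite mcoeffD monalgUD.
Qed.

Fact gr_map_linear : linear gr_map.
Proof.
move=> c x y; rewrite gr_mapD; congr (_ + _).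
elim/gr_ind: x => [|x x' ex ex'|d g]; first by rewrite !(scaler0, gr_map0).
  by rewrite scalerDr !gr_mapD ex ex' scalerDr.
by rewrite gr_scaleU !gr_mapU gr_scaleU.
Qed.

HB.instance Definition _ :=
  GRing.isLinear.Build R (gralg R G) (gralg R H) *:%R gr_map gr_map_linear.

Hypothesis fM : {morph f : g h / (g * h)%g}.

Lemma gr_mapM : {morph gr_map : x y / x * y}.
Proof.
move=> x y; elim/gr_ind: x => [|x x' ex ex'|c g].
- by rewrite mul0r !linear0 mul0r.
- by rewrite mulrDl !linearD /= ex ex' mulrDl.
elim/gr_ind: y => [|y y' ey ey'|d h].
- by rewrite mulr0 !linear0 mulr0.
- by rewrite mulrDr !linearD /= ey ey' mulrDr.
by rewrite gr_MUU !gr_mapU gr_MUU fM.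
Qed.

End GroupAlgebraMap.

Section QuotientAlgebra.
Variables (R : nzRingType) (A : lalgType R) (S : A -> Prop).

Inductive ideal_gen : A -> Prop :=
| ideal_in x : S x -> ideal_gen x
| ideal_0 : ideal_gen 0
| ideal_add x y : ideal_gen x -> ideal_gen y -> ideal_gen (x + y)
| ideal_mull a x : ideal_gen x -> ideal_gen (a * x)
| ideal_mulr a x : ideal_gen x -> ideal_gen (x * a).

Lemma ideal_opp x : ideal_gen x -> ideal_gen (- x).
Proof. by move=> Ix; rewrite -mulN1r; apply: ideal_mull. Qed.

Lemma ideal_scale c x : ideal_gen x -> ideal_gen (c *: x).
Proof. by move=> Ix; rewrite -mulr_algl; apply: ideal_mull. Qed.

Definition ideal_eqb x y := `[< ideal_gen (x - y) >].

Fact ideal_eqb_refl : reflexive ideal_eqb.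
Proof. by move=> x; apply/asboolP; rewrite subrr; apply: ideal_0. Qed.
Fact ideal_eqb_sym : symmetric ideal_eqb.
Proof.
by move=> x y; apply: asbool_equiv_eq; split=> /ideal_opp; rewrite opprB.
Qed.
Fact ideal_eqb_trans : transitive ideal_eqb.
Proof.
move=> y x z /asboolP xy /asboolP yz; apply/asboolP.
by have := ideal_add xy yz; rewrite addrA subrK.
Qed.

Canonical ideal_equiv :=
  EquivRel ideal_eqb ideal_eqb_refl ideal_eqb_sym ideal_eqb_trans.

Definition quotalg := {eq_quot ideal_equiv}.
HB.instance Definition _ := Choice.on quotalg.
HB.instance Definition _ := EqQuotient.on quotalg.

Definition qpi (x : A) : quotalg := \pi_quotalg x.

Lemma qpiP x y : qpi x = qpi y <-> ideal_gen (x - y).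
Proof.
split=> [/eqP|h]; first by rewrite /qpi piE => /asboolP.
by apply/eqP; rewrite /qpi piE; apply/asboolP.
Qed.

Lemma qpiK x : qpi (repr x) = x. Proof. exact: reprK. Qed.

Lemma repr_qpi x : ideal_gen (repr (qpi x) - x).
Proof. by apply/qpiP; rewrite qpiK. Qed.

Definition qa_zero : quotalg := qpi 0.
Definition qa_one : quotalg := qpi 1.
Definition qa_opp (x : quotalg) : quotalg := qpi (- repr x).
Definition qa_add (x y : quotalg) : quotalg := qpi (repr x + repr y).
Definition qa_mul (x y : quotalg) : quotalg := qpi (repr x * repr y).
Definition qa_scale (c : R) (x : quotalg) : quotalg := qpi (c *: repr x).

Lemma qpi_opp x : qpi (- x) = qa_opp (qpi x).
Proof.
by apply/qpiP; rewrite -opprB opprK addrC -opprB; apply/ideal_opp/ideal_opp/repr_qpi.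
Qed.

Lemma qpi_add x y : qpi (x + y) = qa_add (qpi x) (qpi y).
Proof.
apply/esym/qpiP; rewrite opprD addrACA.
by apply: ideal_add; apply: repr_qpi.
Qed.

Lemma qpi_mul x y : qpi (x * y) = qa_mul (qpi x) (qpi y).
Proof.
apply/esym/qpiP; set x' := repr _; set y' := repr _.
have -> : x' * y' - x * y = (x' - x) * y' + x * (y' - y).
  by rewrite mulrBl mulrBr addrA subrK.
by apply: ideal_add; [apply: ideal_mulr | apply: ideal_mull]; apply: repr_qpi.
Qed.

Lemma qpi_scale c x : qpi (c *: x) = qa_scale c (qpi x).
Proof.
by apply/esym/qpiP; rewrite -scalerBr; apply/ideal_scale/repr_qpi.
Qed.

Fact qa_addA : associative qa_add.
Proof.
move=> x y z; rewrite -[x]qpiK -[y]qpiK -[z]qpiK.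
by rewrite -!qpi_add addrA.
Qed.
Fact qa_addC : commutative qa_add.
Proof. by move=> x y; rewrite /qa_add addrC. Qed.
Fact qa_add0 : left_id qa_zero qa_add.
Proof. by move=> x; rewrite -[x]qpiK -qpi_add add0r. Qed.
Fact qa_addN : left_inverse qa_zero qa_opp qa_add.
Proof. by move=> x; rewrite -[x]qpiK -qpi_opp -qpi_add addNr. Qed.

HB.instance Definition _ :=
  GRing.isZmodule.Build quotalg qa_addA qa_addC qa_add0 qa_addN.

Fact qa_mulA : associative qa_mul.
Proof.
move=> x y z; rewrite -[x]qpiK -[y]qpiK -[z]qpiK.
by rewrite -!qpi_mul mulrA.
Qed.
Fact qa_mul1 : left_id qa_one qa_mul.
Proof. by move=> x; rewrite -[x]qpiK -qpi_mul mul1r. Qed.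
Fact qa_1mul : right_id qa_one qa_mul.
Proof. by move=> x; rewrite -[x]qpiK -qpi_mul mulr1. Qed.
Fact qa_mulDl : left_distributive qa_mul +%R.
Proof.
move=> x y z; rewrite -[x]qpiK -[y]qpiK -[z]qpiK.
by rewrite -[_ + _]qpi_add -!qpi_mul mulrDl qpi_add.
Qed.
Fact qa_mulDr : right_distributive qa_mul +%R.
Proof.
move=> x y z; rewrite -[x]qpiK -[y]qpiK -[z]qpiK.
by rewrite -[_ + _]qpi_add -!qpi_mul mulrDr qpi_add.
Qed.

HB.instance Definition _ := GRing.Zmodule_isPzRing.Build quotalg
  qa_mulA qa_mul1 qa_1mul qa_mulDl qa_mulDr.

Fact qa_scaleA c d x : qa_scale c (qa_scale d x) = qa_scale (c * d) x.
Proof. by rewrite -[x]qpiK -!qpi_scale scalerA. Qed.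
Fact qa_scale1 : left_id 1 qa_scale.
Proof. by move=> x; rewrite -[x]qpiK -qpi_scale scale1r. Qed.
Fact qa_scaleDr : right_distributive qa_scale +%R.
Proof.
move=> c x y; rewrite -[x]qpiK -[y]qpiK.
by rewrite -[_ + _]qpi_add -!qpi_scale scalerDr qpi_add.
Qed.
Fact qa_scaleDl x : {morph qa_scale^~ x : c d / c + d}.
Proof.
by move=> c d; rewrite -[x]qpiK -!qpi_scale scalerDl qpi_add.
Qed.

HB.instance Definition _ := GRing.Zmodule_isLmodule.Build R quotalg
  qa_scaleA qa_scale1 qa_scaleDr qa_scaleDl.

Fact qpi_linear : linear qpi.
Proof. by move=> c x y; rewrite qpi_add qpi_scale. Qed.
HB.instance Definition _ := GRing.isLinear.Build R A quotalg *:%R qpi qpi_linear.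

Fact qpi_monoid_morphism : monoid_morphism qpi.
Proof. by split=> // x y; apply: qpi_mul. Qed.
HB.instance Definition _ :=
  GRing.isMonoidMorphism.Build A quotalg qpi qpi_monoid_morphism.

Lemma quotalg_scaleAl c (x y : quotalg) : c *: (x * y) = c *: x * y.
Proof.
rewrite -[x]qpiK -[y]qpiK -rmorphM -!linearZ -rmorphM.
by rewrite scalerAl.
Qed.

End QuotientAlgebra.

Section QuotientAlgebraMap.
Variables (R : nzRingType) (A B : lalgType R) (SA : A -> Prop) (SB : B -> Prop).
Variable f : {linear A -> B}.
Hypothesis fM : {morph f : x y / x * y}.
Hypothesis fS : forall x, SA x -> ideal_gen SB (f x).

Definition quotalg_map (x : quotalg SA) : quotalg SB := qpi SB (f (repr x)).

Lemma quotalg_map_pi x : quotalg_map (qpi SA x) = qpi SB (f x).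
Proof.
apply/qpiP; rewrite -linearB; elim: (repr_qpi SA x) => {x}.
- by move=> x /fS.
- by rewrite linear0; apply: ideal_0.
- by move=> x y _ Ix _ Iy; rewrite linearD; apply: ideal_add.
- by move=> a x _ Ix; rewrite fM; apply: ideal_mull.
- by move=> a x _ Ix; rewrite fM; apply: ideal_mulr.
Qed.

Lemma quotalg_map_linear : linear quotalg_map.
Proof.
move=> c x y; rewrite -[x]qpiK -[y]qpiK -linearP !quotalg_map_pi.
by rewrite !linearP.
Qed.

Lemma quotalg_mapM : {morph quotalg_map : x y / x * y}.
Proof.
move=> x y; rewrite -[x]qpiK -[y]qpiK -rmorphM !quotalg_map_pi. rewrite fM.
exact: rmorphM.
Qed.

End QuotientAlgebraMap.

Record dirsys (R : nzRingType) := DirSys {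
  ds_obj :> nat -> lmodType R;
  ds_map : forall m n, (m <= n)%N -> {linear ds_obj m -> ds_obj n};
  ds_map_id : forall n (h : (n <= n)%N) x, ds_map h x = x;
  ds_map_comp : forall m n p (hmn : (m <= n)%N) (hnp : (n <= p)%N)
    (hmp : (m <= p)%N) x, ds_map hnp (ds_map hmn x) = ds_map hmp x
}.

Arguments ds_map {R} d {m n}.

Section DirectLimit.
Variables (R : nzRingType) (V : dirsys R).

Local Notation pre := {n : nat & V n}.
Implicit Types x y z : pre.

Definition dl_rel x y : Prop :=
  exists p (hx : (tag x <= p)%N) (hy : (tag y <= p)%N),
    ds_map V hx (tagged x) = ds_map V hy (tagged y).

Definition dl_eqb x y := `[< dl_rel x y >].

Fact dl_eqb_refl : reflexive dl_eqb.
Proof. by move=> x; apply/asboolP; exists (tag x), (leqnn _), (leqnn _). Qed.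
Fact dl_eqb_sym : symmetric dl_eqb.
Proof.
by move=> x y; apply: asbool_equiv_eq; split=> -[p [hx [hy e]]]; exists p, hy, hx.
Qed.
Fact dl_eqb_trans : transitive dl_eqb.
Proof.
move=> y x z /asboolP[p [hx [hy exy]]] /asboolP[r [hy' [hz eyz]]].
apply/asboolP; pose m := maxn p r.
have hpm : (p <= m)%N := leq_maxl p r.
have hrm : (r <= m)%N := leq_maxr p r.
exists m, (leq_trans hx hpm), (leq_trans hz hrm).
rewrite -(ds_map_comp hx hpm) exy -(ds_map_comp hz hrm) -eyz.
by rewrite !(ds_map_comp _ _ (leq_trans hy hpm)).
Qed.

Canonical dl_equiv := EquivRel dl_eqb dl_eqb_refl dl_eqb_sym dl_eqb_trans.

(* The direct limit of V; when the maps of V are inclusions this is the union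
   of the V n. *)
Definition dirlim := {eq_quot dl_equiv}.
HB.instance Definition _ := Choice.on dirlim.
HB.instance Definition _ := EqQuotient.on dirlim.

Definition dl_in n (x : V n) : dirlim :=
  \pi_dirlim (existT (fun n => V n : Type) n x).

Lemma dl_inP m n (x : V m) (y : V n) :
  dl_in x = dl_in y <->
  exists p (hx : (m <= p)%N) (hy : (n <= p)%N), ds_map V hx x = ds_map V hy y.
Proof.
split=> [/eqP|h]; first by rewrite /dl_in piE => /asboolP.
by apply/eqP; rewrite /dl_in piE; apply/asboolP.
Qed.

Lemma dl_in_map m n (h : (m <= n)%N) (x : V m) : dl_in (ds_map V h x) = dl_in x.
Proof.
by apply/dl_inP; exists n, (leqnn n), h; apply: ds_map_id.
Qed.

Lemma dl_in_repr (a : dirlim) : dl_in (tagged (repr a)) = a.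
Proof. by rewrite -[RHS]reprK /dl_in; case: (repr a). Qed.

Lemma dl_ind (P : dirlim -> Prop) :
  (forall n (x : V n), P (dl_in x)) -> forall a, P a.
Proof. by move=> Pin a; rewrite -(dl_in_repr a). Qed.

Definition dl_zero : dirlim := dl_in (0 : V 0).
Definition dl_opp (a : dirlim) : dirlim := dl_in (- tagged (repr a)).
Definition dl_add (a b : dirlim) : dirlim :=
  dl_in (ds_map V (leq_maxl _ _) (tagged (repr a)) +
         ds_map V (leq_maxr _ _) (tagged (repr b))).
Definition dl_scale (c : R) (a : dirlim) : dirlim :=
  dl_in (c *: tagged (repr a)).

Lemma dl_in0 n : dl_in (0 : V n) = dl_zero.
Proof.
by apply/dl_inP; exists n, (leqnn n), (leq0n n); rewrite !linear0.
Qed.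

Lemma dl_in_opp n (x : V n) : dl_in (- x) = dl_opp (dl_in x).
Proof.
have /dl_inP[p [hx [hy e]]] := dl_in_repr (dl_in x).
by apply/dl_inP; exists p, hy, hx; rewrite !linearN e.
Qed.

Lemma dl_in_scale n c (x : V n) : dl_in (c *: x) = dl_scale c (dl_in x).
Proof.
have /dl_inP[p [hx [hy e]]] := dl_in_repr (dl_in x).
by apply/dl_inP; exists p, hy, hx; rewrite !linearZ /= e.
Qed.

Lemma dl_in_add n (x y : V n) : dl_in (x + y) = dl_add (dl_in x) (dl_in y).
Proof.
have /dl_inP[p [hx [hx' ex]]] := dl_in_repr (dl_in x).
have /dl_inP[r [hy [hy' ey]]] := dl_in_repr (dl_in y).
pose m := maxn p r.
have hpm : (p <= m)%N := leq_maxl p r.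
have hrm : (r <= m)%N := leq_maxr p r.
have hM : (maxn (tag (repr (dl_in x))) (tag (repr (dl_in y))) <= m)%N.
  by rewrite geq_max (leq_trans hx hpm) (leq_trans hy hrm).
apply/esym/dl_inP; exists m, hM, (leq_trans hx' hpm); rewrite !linearD /=.
rewrite (ds_map_comp _ _ (leq_trans hx hpm)) (ds_map_comp _ _ (leq_trans hy hrm)).
rewrite -(ds_map_comp hx hpm) ex -(ds_map_comp hy hrm) ey.
by rewrite !(ds_map_comp _ _ (leq_trans hx' hpm)).
Qed.

Lemma dl_ind2 (P : dirlim -> dirlim -> Prop) :
  (forall n (x y : V n), P (dl_in x) (dl_in y)) -> forall a b, P a b.
Proof.
move=> Pin; elim/dl_ind=> m x; elim/dl_ind=> n y.
by rewrite -(dl_in_map (leq_maxl m n) x) -(dl_in_map (leq_maxr m n) y).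
Qed.

Lemma dl_ind3 (P : dirlim -> dirlim -> dirlim -> Prop) :
  (forall n (x y z : V n), P (dl_in x) (dl_in y) (dl_in z)) ->
  forall a b c, P a b c.
Proof.
move=> Pin a b c; move: a b; apply: dl_ind2 => m x y.
elim/dl_ind: c => n z.
have := Pin _ (ds_map V (leq_maxl m n) x) (ds_map V (leq_maxl m n) y)
  (ds_map V (leq_maxr m n) z).
by rewrite !dl_in_map.
Qed.

Fact dl_addA : associative dl_add.
Proof. by apply: dl_ind3 => n x y z; rewrite -!dl_in_add addrA. Qed.
Fact dl_addC : commutative dl_add.
Proof. by apply: dl_ind2 => n x y; rewrite -!dl_in_add addrC. Qed.
Fact dl_add0 : left_id dl_zero dl_add.
Proof. by elim/dl_ind=> n x; rewrite -(dl_in0 n) -dl_in_add add0r. Qed.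
Fact dl_addN : left_inverse dl_zero dl_opp dl_add.
Proof.
by elim/dl_ind=> n x; rewrite -dl_in_opp -dl_in_add addNr dl_in0.
Qed.

HB.instance Definition _ :=
  GRing.isZmodule.Build dirlim dl_addA dl_addC dl_add0 dl_addN.

Fact dl_scaleA c d a : dl_scale c (dl_scale d a) = dl_scale (c * d) a.
Proof. by elim/dl_ind: a => n x; rewrite -!dl_in_scale scalerA. Qed.
Fact dl_scale1 : left_id 1 dl_scale.
Proof. by elim/dl_ind=> n x; rewrite -dl_in_scale scale1r. Qed.
Fact dl_scaleDr : right_distributive dl_scale +%R.
Proof.
move=> c; apply: dl_ind2 => n x y.
by rewrite -[_ + _]dl_in_add -!dl_in_scale scalerDr dl_in_add.
Qed.
Fact dl_scaleDl a : {morph dl_scale^~ a : c d / c + d}.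
Proof.
by move=> c d; elim/dl_ind: a => n x; rewrite -!dl_in_scale scalerDl dl_in_add.
Qed.

HB.instance Definition _ := GRing.Zmodule_isLmodule.Build R dirlim
  dl_scaleA dl_scale1 dl_scaleDr dl_scaleDl.

Fact dl_in_linear n : linear (@dl_in n).
Proof. by move=> c x y; rewrite dl_in_add dl_in_scale. Qed.
HB.instance Definition _ n :=
  GRing.isLinear.Build R (V n) dirlim *:%R (@dl_in n) (@dl_in_linear n).

End DirectLimit.

(* The n generators of B_{1,n} are indexed by 'I_n: the index 0 stands for t
   and an index i > 0 for sigma_i.  A constructor lists the two sides of a
   defining relation. *)
Inductive artinB_rel n : seq 'I_n -> seq 'I_n -> Prop :=
| artinB_t_s1 (t s : 'I_n) : t = 0 :> nat -> s = 1 :> nat ->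
    artinB_rel [:: s; t; s; t] [:: t; s; t; s]
| artinB_t_s (t i : 'I_n) : t = 0 :> nat -> (1 < i)%N ->
    artinB_rel [:: t; i] [:: i; t]
| artinB_far (i j : 'I_n) : (0 < i)%N -> (i.+1 < j)%N ->
    artinB_rel [:: i; j] [:: j; i]
| artinB_braid (i j : 'I_n) : (0 < i)%N -> j = i.+1 :> nat ->
    artinB_rel [:: i; j; i] [:: j; i; j].

Definition artinB n : Type := presgroup (@artinB_rel n).
HB.instance Definition _ n := Group.on (artinB n).

Definition artinB_gen n (i : 'I_n) : artinB n := pgen (@artinB_rel n) i.

Lemma artinB_rel_widen m n (h : (m <= n)%N) (r s : seq 'I_m) :
  artinB_rel r s -> artinB_rel (map (widen_ord h) r) (map (widen_ord h) s).
Proof.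
by case=> *; [apply: artinB_t_s1 | apply: artinB_t_s | apply: artinB_far
  | apply: artinB_braid].
Qed.

Definition artinB_incl m n (h : (m <= n)%N) : artinB m -> artinB n :=
  presgroup_map (relX := @artinB_rel m) (@artinB_rel n) (widen_ord h).

Lemma artinB_inclM m n (h : (m <= n)%N) :
  {morph @artinB_incl m n h : x y / (x * y)%g}.
Proof. exact: (presgroup_mapM (@artinB_rel_widen m n h)). Qed.

Lemma artinB_incl_cls m n (h : (m <= n)%N) w :
  artinB_incl h (cls _ w) = cls _ (mapw (widen_ord h) w).
Proof. exact: (presgroup_map_cls (@artinB_rel_widen m n h)). Qed.

Lemma artinB_incl_id n (h : (n <= n)%N) b : artinB_incl h b = b.
Proof.
rewrite -[b]clsK [LHS]artinB_incl_cls; congr cls.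
rewrite /mapw -[RHS]map_id; apply: eq_map => -[i e] /=; congr (_, _).
exact: val_inj.
Qed.

Lemma artinB_incl_comp m n p (hmn : (m <= n)%N) (hnp : (n <= p)%N)
    (hmp : (m <= p)%N) b :
  artinB_incl hnp (artinB_incl hmn b) = artinB_incl hmp b.
Proof.
rewrite -[b]clsK [artinB_incl hmn _]artinB_incl_cls.
rewrite [LHS]artinB_incl_cls [RHS]artinB_incl_cls; congr cls.
rewrite /mapw -map_comp; apply: eq_map => -[i e] /=; congr (_, _).
exact: val_inj.
Qed.

Definition expgz (G : groupType) (x : G) (k : int) : G :=
  match k with Posz n => (x ^+ n)%g | Negz n => (x ^- n.+1)%g end.

(* t'_i = sigma_i ... sigma_1 t sigma_1^-1 ... sigma_i^-1 in B_{1,i+1}. *)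
Definition artinB_t' i : artinB i.+1 :=
  let x := (\prod_(0 <= j < i) artinB_gen (inord (i - j)))%g in
  (x * artinB_gen ord0 * x^-1)%g.

(* Infinite selects the algebras H_n(q,infinity), Level d the H_n(q,d). *)
Variant level := Infinite | Level of nat.

Definition level_proper (L : level) : Prop :=
  if L is Level d then (1 <= d)%N else True.

Definition level_exponent (L : level) : pred int :=
  fun k => if L is Level d then 0 <= k < d%:Z else true.

Section HeckeAlgebras.
(* u j stands for u_(j+1). *)
Variables (R : comNzRingType) (q : R) (u : nat -> R) (L : level).

Inductive hecke_rel n : gralg R (artinB n) -> Prop :=
| hecke_quad (i : 'I_n) (s := gr_elt R (artinB_gen i)) : (0 < i)%N ->
    hecke_rel (s ^+ 2 - ((q - 1) *: s + q%:A))
| hecke_cycl d (i : 'I_n) (t := gr_elt R (artinB_gen i)) :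
    L = Level d -> i = 0 :> nat ->
    hecke_rel (\prod_(j < d) (t - (u j)%:A)).

Definition hecke n : Type := quotalg (@hecke_rel n).
HB.instance Definition _ n := GRing.PzRing.on (hecke n).
HB.instance Definition _ n := GRing.Lmodule.on (hecke n).

Definition hecke_pi n (x : gralg R (artinB n)) : hecke n := qpi (@hecke_rel n) x.

Definition hecke_br n (b : artinB n) : hecke n := hecke_pi (gr_elt R b).

Lemma hecke_brM n (b c : artinB n) :
  hecke_br (b * c)%g = hecke_br b * hecke_br c.
Proof.
by rewrite /hecke_br gr_eltM; apply: qpi_mul.
Qed.

Lemma hecke_br1 n : hecke_br (1%g : artinB n) = 1.
Proof. by []. Qed.

Section Inclusion.
Variables (m n : nat) (h : (m <= n)%N).

Definition gr_incl : gralg R (artinB m) -> gralg R (artinB n) :=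
  gr_map (artinB_incl h).

Fact gr_incl_linear : linear gr_incl. Proof. exact: gr_map_linear. Qed.
HB.instance Definition _ :=
  GRing.isLinear.Build R (gralg R (artinB m)) (gralg R (artinB n)) *:%R gr_incl
    gr_incl_linear.

Lemma gr_incl_elt b : gr_incl (gr_elt R b) = gr_elt R (artinB_incl h b).
Proof. exact: gr_mapU. Qed.

Lemma gr_incl_gen (i : 'I_m) :
  gr_incl (gr_elt R (artinB_gen i)) = gr_elt R (artinB_gen (widen_ord h i)).
Proof. by rewrite gr_incl_elt; congr gr_elt; apply: artinB_incl_cls. Qed.

Lemma gr_inclM : {morph gr_incl : x y / x * y}.
Proof. exact: (gr_mapM (artinB_inclM h)). Qed.

Lemma gr_incl1 : gr_incl 1 = 1.
Proof. by rewrite [LHS]gr_incl_elt; congr gr_elt; apply: artinB_incl_cls. Qed.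

Lemma gr_incl_rel x : hecke_rel x -> ideal_gen (@hecke_rel n) (gr_incl x).
Proof.
case=> {x} [i s i_gt0|d i t Ld i0]; apply: ideal_in.
  have -> : gr_incl (s ^+ 2 - ((q - 1) *: s + q%:A)) =
            gr_incl s ^+ 2 - ((q - 1) *: gr_incl s + q%:A).
    by rewrite linearB linearD !linearZ /= gr_incl1 expr2 gr_inclM -expr2.
  by rewrite gr_incl_gen; apply: hecke_quad.
rewrite (big_morph gr_incl gr_inclM gr_incl1).
have e j : gr_incl (t - (u j)%:A) = gr_incl t - (u j)%:A.
  by rewrite linearB linearZ /= gr_incl1.
under eq_bigr => j _ do rewrite e gr_incl_gen.
exact: (@hecke_cycl n d (widen_ord h i) Ld i0).
Qed.

Definition hecke_incl : hecke m -> hecke n :=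
  @quotalg_map R _ _ (@hecke_rel m) (@hecke_rel n) gr_incl.

Lemma hecke_incl_pi x : hecke_incl (hecke_pi x) = hecke_pi (gr_incl x).
Proof. exact: (quotalg_map_pi gr_inclM gr_incl_rel). Qed.

Fact hecke_incl_linear : linear hecke_incl.
Proof. exact: (quotalg_map_linear gr_inclM gr_incl_rel). Qed.
HB.instance Definition _ :=
  GRing.isLinear.Build R (hecke m) (hecke n) *:%R hecke_incl hecke_incl_linear.

Lemma hecke_inclM : {morph hecke_incl : x y / x * y}.
Proof. exact: (quotalg_mapM gr_inclM gr_incl_rel). Qed.

Lemma hecke_incl_br b : hecke_incl (hecke_br b) = hecke_br (artinB_incl h b).
Proof. by rewrite /hecke_br hecke_incl_pi gr_incl_elt. Qed.

End Inclusion.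

Fact hecke_incl_id n (h : (n <= n)%N) x : hecke_incl h x = x.
Proof.
rewrite -[x](qpiK (S := @hecke_rel n)) [LHS]hecke_incl_pi; congr qpi.
elim/gr_ind: (repr x) => [|y y' ey ey'|c g]; first exact: gr_map0.
  by rewrite linearD /= ey ey'.
by rewrite [LHS]gr_mapU artinB_incl_id.
Qed.

Fact hecke_incl_comp m n p (hmn : (m <= n)%N) (hnp : (n <= p)%N) (hmp : (m <= p)%N) x :
  hecke_incl hnp (hecke_incl hmn x) = hecke_incl hmp x.
Proof.
rewrite -[x](qpiK (S := @hecke_rel m)) [hecke_incl hmn _]hecke_incl_pi.
rewrite [LHS]hecke_incl_pi [RHS]hecke_incl_pi; congr hecke_pi.
elim/gr_ind: (repr x) => [|y y' ey ey'|c g]; first by rewrite !linear0.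
  by rewrite !linearD /= ey ey'.
by rewrite /gr_incl !gr_mapU artinB_incl_comp.
Qed.

(* The n-th term is H_{n+1}, so that the family starts with H_1. *)
Definition hecke_sys : dirsys R := {|
  ds_obj n := hecke n.+1;
  ds_map m n h := hecke_incl (h : (m.+1 <= n.+1)%N);
  ds_map_id n h := @hecke_incl_id n.+1 h;
  ds_map_comp m n p hmn hnp hmp := @hecke_incl_comp m.+1 n.+1 p.+1 hmn hnp hmp
|}.

(* The union of the H_n, n >= 1, along the maps induced by the inclusions of
   braid groups. *)
Definition heckeU : Type := dirlim hecke_sys.
HB.instance Definition _ := GRing.Lmodule.on heckeU.

Definition hecke_in n (a : hecke n.+1) : heckeU := @dl_in R hecke_sys n a.

(* g_i in H_{i+1}; meaningful for i >= 1 only. *)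
Definition hecke_g i : hecke i.+1 := hecke_br (artinB_gen ord_max).

(* The power t'_i ^ k in H_{i+1} for k : int, taken among the images of braids,
   where t'_i is invertible. *)
Definition hecke_t'z i (k : int) : hecke i.+1 := hecke_br (expgz (artinB_t' i) k).

(* n.+1 ranges over the integers n >= 1 indexing the H_n; the values of s outside
   the exponents k != 0 of the family are not used. *)
Definition markov_rules (z : R) (s : int -> R) (tr : heckeU -> R) : Prop :=
  [/\ forall n (a b : hecke n.+1), tr (hecke_in (a * b)) = tr (hecke_in (b * a)),
      forall n, tr (hecke_in (1 : hecke n.+1)) = 1,
      forall n (a : hecke n.+1),
        tr (hecke_in (hecke_incl (leqnSn n.+1) a * hecke_g n.+1)) =
        z * tr (hecke_in a)
    & forall n (a : hecke n.+1) (k : int), k \in level_exponent L -> k != 0 ->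
        tr (hecke_in (hecke_incl (leqnSn n.+1) a * hecke_t'z n.+1 k)) =
        s k * tr (hecke_in a)].

End HeckeAlgebras.

(* The free abelian group on the symbols q, u_1, u_2, ..., written
   multiplicatively; a monomial is its finitely supported family of exponents,
   that of q at None and that of u_(j+1) at Some j. *)
Definition laurent_monom : Type := {malg int[option nat]}.
HB.instance Definition _ := GRing.Zmodule.on laurent_monom.

Section LaurentMonomials.
Implicit Types m : laurent_monom.
Let mul m m' := m + m'.
Let inv m := - m.
Fact lm_mulA : associative mul. Proof. exact: addrA. Qed.
Fact lm_mul1 : left_id 0 mul. Proof. exact: add0r. Qed.
Fact lm_1mul : right_id 0 mul. Proof. exact: addr0. Qed.
Fact lm_mulV : left_inverse 0 inv mul. Proof. exact: addNr. Qed.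
Fact lm_Vmul : right_inverse 0 inv mul. Proof. exact: addrN. Qed.
HB.instance Definition _ :=
  isGroup.Build laurent_monom lm_mulA lm_mul1 lm_1mul lm_mulV lm_Vmul.
Fact lm_mulC m m' : (m * m')%g = (m' * m)%g.
Proof. exact: addrC. Qed.
End LaurentMonomials.

(* Z[q^{+-1}, u_1^{+-1}, u_2^{+-1}, ...] *)
Definition laurent : Type := gralg int laurent_monom.
HB.instance Definition _ := GRing.NzRing.on laurent.

Fact laurent_mulC : @commutative laurent laurent *%R.
Proof. by apply: gr_mulC; apply: lm_mulC. Qed.
HB.instance Definition _ :=
  GRing.PzRing_hasCommutativeMul.Build laurent laurent_mulC.

Definition lvar (i : option nat) : laurent :=
  gr_elt int (<< i >> : laurent_monom).
Definition qq : laurent := lvar None.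
(* uu j is u_(j+1). *)
Definition uu (j : nat) : laurent := lvar (Some j).

(* Main.v *)
(* For d = infinity the trace is the composite of maps E_n : H_(n+1) -> H_n that
   are H_n-bilinear and send t'_n^k to s_k and g_n to z.  As H_(n+1) is spanned
   over H_n by the elements g_n ... g_(j+1) t'_j^k, a left H_n-linear map from
   H_(n+1) to H_n should be a family (phi j k) of elements of H_n, and right
   multiplication in H_(n+1) should act on such families by explicit operators.
   These operators do satisfy the defining relations, so H_(n+1) acts on the
   families, and E_n x is defined as the (n, 0) entry of the image under x of the
   family of prescribed values: no freeness of H_(n+1) over H_n is needed.  The
   computations rest on
     g t^k g^-1 t = t g t^k g^-1 + (1 - q^-1) (t^k g t - g t^(k+1)),  g = g_1.
   The trace property reduces to E_(n-1) (E_n (g_n y)) = E_(n-1) (E_n (y g_n)),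
   which is checked for y in H_n t'_n^k and in H_n g_n H_n; these span H_(n+1).
   For finite d the weights s_k are extended to all integers k by the recurrence
   with characteristic polynomial (X - u_1) ... (X - u_d); the trace of the
   generic algebra then kills the ideal generated by (t - u_1) ... (t - u_d).
   Uniqueness follows from the same spanning set and the same recurrence. *)

(* A family records a left linear map through its values at the spanning elements c, and x sends it
   to the values at c x; hence products act in their given order. Left linearity of E_n is built
   into these operators. Right linearity dictates the prescribed values: on that one family every
   element of H_n must act as right multiplication, and the operators commute with right
   multiplications.

   The tower starts at the scalars H_0, absent from the statement, so that t^k gets its weight from
   E_0 just as t'_n^k does from E_n. In the uniqueness part the rules, which begin at n = 1, reach
   t^k only after t is conjugated to t'_1.

   The obstacle in the trace property is y = t'_(n-1)^l t'_n^k: moving one power past the other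
   creates a sum of terms quadratic in the weights, which must collapse for arbitrary s. It
   telescopes because its two halves are the same sum read in opposite directions.

   For finite d, negative powers of t'_n still occur although rule 4 does not mention them; the
   inverses of the u_j let the recurrence run backwards and fix their weights. *)
Require Import Defs.
From HB Require Import structures.
From mathcomp Require Import all_boot all_algebra boolp functions finmap.
From mathcomp.multinomials Require Import monalg.
From mathcomp Require Import zify ring.
Set Implicit Arguments.
Unset Strict Implicit.
Unset Printing Implicit Defensive.
Import GRing.Theory.
Local Open Scope ring_scope.

(** * Linear identities *)

Section LinearExpressions.
Variables (R : comNzRingType) (V : lmodType R).

Inductive lexp :=
| LVar of nat | LZero | LAdd of lexp & lexp | LOpp of lexp
| LScale of R & lexp.

Variable s : seq V.

Fixpoint leval e : V :=
  match e with
  | LVar i => nth 0 s i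
  | LZero => 0
  | LAdd e1 e2 => leval e1 + leval e2
  | LOpp e1 => - leval e1
  | LScale c e1 => c *: leval e1
  end.

(** The test is [PeanoNat.Nat.eqb] so that [cbn] in [lin] decides it on numerals and leaves bare
    ring identities. *)
Fixpoint lcoef (i : nat) e : R :=
  match e with
  | LVar j => if PeanoNat.Nat.eqb i j then 1 else 0
  | LZero => 0
  | LAdd e1 e2 => lcoef i e1 + lcoef i e2
  | LOpp e1 => - lcoef i e1
  | LScale c e1 => c * lcoef i e1
  end.

Fixpoint lcoef_eq n e1 e2 : Prop :=
  if n is n'.+1 then lcoef n' e1 = lcoef n' e2 /\ lcoef_eq n' e1 e2 else True.

Lemma leval_coef e : leval e = \sum_(i < size s) lcoef i e *: nth 0 s i.
Proof.
elim: e => /= [j||e1 -> e2 ->|e1 ->|c e1 ->].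
- have eqbE (a b : nat) : PeanoNat.Nat.eqb a b = (a == b).
    by apply/idP/eqP => [/PeanoNat.Nat.eqb_eq|/PeanoNat.Nat.eqb_eq].
  have [js|js] := ltnP j (size s); last first.
    rewrite nth_default // big1 // => i _; rewrite eqbE.
    by rewrite (ltn_eqF (leq_trans (ltn_ord i) js)) scale0r.
  rewrite (bigD1 (Ordinal js)) //= eqbE eqxx scale1r big1 ?addr0 // => i ij.
  by rewrite eqbE (_ : _ == _ = false) ?scale0r //; apply/negbTE.
- by rewrite big1 // => i _; rewrite scale0r.
- by rewrite -big_split; apply: eq_bigr => i _; rewrite scalerDl.
- by rewrite -sumrN; apply: eq_bigr => i _; rewrite scaleNr.
- by rewrite scaler_sumr; apply: eq_bigr => i _; rewrite scalerA.
Qed.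

Lemma leval_eq e1 e2 : lcoef_eq (size s) e1 e2 -> leval e1 = leval e2.
Proof.
move=> e12; rewrite !leval_coef; apply: eq_bigr => i _; congr (_ *: _).
elim: (size s) (nat_of_ord i) (ltn_ord i) e12 => //= n IHn m; rewrite ltnS.
by rewrite leq_eqVlt => /orP[/eqP -> [] //|/IHn IH [_ /IH]].
Qed.

End LinearExpressions.

Ltac lin_add x l :=
  lazymatch l with
  | nil => constr:(cons x l)
  | cons ?y ?l' =>
    match constr:(tt) with
    | _ => let _ := match constr:(tt) with _ => unify x y end in l
    | _ => let l2 := lin_add x l' in constr:(cons y l2)
    end
  end.

Ltac lin_atoms e l :=
  lazymatch e with
  | (?a + ?b)%R => let l1 := lin_atoms a l in lin_atoms b l1
  | (- ?a)%R => lin_atoms a l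
  | (_ *: ?a)%R => lin_atoms a l
  | 0%R => l
  | _ => lin_add e l
  end.

Ltac lin_index x l :=
  lazymatch l with
  | cons ?y ?l' =>
    match constr:(tt) with
    | _ => let _ := match constr:(tt) with _ => unify x y end in constr:(O)
    | _ => let i := lin_index x l' in constr:(S i)
    end
  end.

Ltac lin_reify R e l :=
  lazymatch e with
  | (?a + ?b)%R =>
    let a' := lin_reify R a l in let b' := lin_reify R b l in
    constr:(@LAdd R a' b')
  | (- ?a)%R => let a' := lin_reify R a l in constr:(@LOpp R a')
  | (?c *: ?a)%R => let a' := lin_reify R a l in constr:(@LScale R c a')
  | 0%R => constr:(@LZero R)
  | _ => let i := lin_index e l in constr:(@LVar R i)
  end.

(* Reduces an equation between linear combinations of the same vectors to the
   equations between their coefficients. *)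
Ltac lin R V :=
  lazymatch goal with
  | |- ?a = ?b =>
    let l0 := lin_atoms a (@nil V) in
    let l := lin_atoms b l0 in
    let a' := lin_reify R a l in
    let b' := lin_reify R b l in
    apply: (@leval_eq R V l a' b');
    cbn [lcoef_eq size lcoef PeanoNat.Nat.eqb];
    repeat split
  end.

(** * Recurrences and powers indexed by the integers *)

(** Invertibility of [u] lets the recurrence run both ways from [x]; [fn n] is the value at [-n]. *)
Lemma int_recurrence (R : comNzRingType) (u v : R) (b : int -> R) (x : R) :
  u * v = 1 -> exists2 f : int -> R, f 0 = x & forall k, f (k + 1) = u * f k + b k.
Proof.
move=> uv; pose fix fp n := if n is n'.+1 then u * fp n' + b n' else x.
pose fix fn n := if n is n'.+1 then v * (fn n' - b (Negz n')) else x.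
exists (fun k => match k with Posz n => fp n | Negz n => fn n.+1 end) => //.
case=> [n|[|n]]; first by rewrite -PoszD addn1.
  by rewrite /= mulrA uv mul1r subrK.
have -> : Negz n.+1 + 1 = Negz n by lia.
by rewrite [fn n.+2]/= mulrA uv mul1r subrK.
Qed.

Lemma int_shift_const (T : Type) (f : int -> T) :
  (forall k, f (k + 1) = f k) -> forall k, f k = f 0.
Proof.
move=> fS; elim=> [//|k IHk|k IHk]; first by rewrite -addn1 PoszD fS.
by rewrite -IHk -(fS (- k.+1%:Z)); congr f; lia.
Qed.

(* The product of the commuting operators f |-> f (. + 1) - u_j f, j < d. *)
Fixpoint shiftop (R : comNzRingType) (d : nat) (u : nat -> R) (f : int -> R) :
    int -> R :=
  if d is d'.+1 then shiftop d' (u \o succn) (fun k => f (k + 1) - u 0%N * f k)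
  else f.

(** A cascade of first order recurrences: a solution [f'] for the remaining factors is the
    inhomogeneous term of the recurrence with ratio [u 0]. Its initial values are those forced by
    [s]. *)
Lemma shiftop_exists (R : comNzRingType) d (u v : nat -> R) (s : int -> R) :
  (forall j, u j * v j = 1) ->
  exists2 f : int -> R, (forall k : nat, (k < d)%N -> f k = s k) &
    forall k, shiftop d u f k = 0.
Proof.
elim: d u v s => [|d IHd] u v s uv; first by exists (fun _ => 0).
have [f' f's f'0] := IHd (u \o succn) (v \o succn)
  (fun k => s (k + 1) - u 0%N * s k) (fun j => uv j.+1).
have [f f0 fS] := int_recurrence f' (s 0) (uv 0%N).
have fS' : (fun k => f (k + 1) - u 0%N * f k) = f'.
  by apply/funext => k; rewrite fS addrAC subrr add0r.
exists f => [k|k]; last by rewrite /= fS'.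
elim: k => [_|k IHk kd]; first exact: f0.
by rewrite -addn1 PoszD fS IHk ?f's ?(ltnW kd) // addrC subrK.
Qed.

Lemma shiftop_unique (R : comNzRingType) d (u v : nat -> R) (f f' : int -> R) :
  (forall j, u j * v j = 1) ->
  (forall k : nat, (k < d)%N -> f k = f' k) ->
  (forall k, shiftop d u f k = 0) -> (forall k, shiftop d u f' k = 0) ->
  forall k, f k = f' k.
Proof.
elim: d u v f f' => [|d IHd] u v f f' uv ff' f0 f'0 k; first by rewrite [LHS]f0
  [RHS]f'0.
have fS : forall k, f (k + 1) - u 0%N * f k = f' (k + 1) - u 0%N * f' k.
  apply: (IHd (u \o succn) (v \o succn)) => // [j|j jd]; first exact: uv.
  by rewrite -[j%:Z + 1](PoszD j 1) addn1 !ff' // ltnW.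
have hS j : f (j + 1) - f' (j + 1) = u 0%N * (f j - f' j).
  by have /eqP := fS j; rewrite subr_eq mulrBr => /eqP ->; ring.
suff h0 j : f j - f' j = 0 by apply/eqP; rewrite -subr_eq0 h0.
elim: j => [|j IHj|j IHj]; first by rewrite ff' ?subrr.
  by rewrite -addn1 PoszD hS IHj mulr0.
have := hS (- j.+1%:Z); have -> : - j.+1%:Z + 1 = - j%:Z by lia.
rewrite IHj => /(congr1 ( *%R (v 0%N))).
by rewrite mulr0 mulrA (mulrC (v _)) uv mul1r.
Qed.

Section Commutation.
Variables (R : comNzRingType) (A : algType R).
Implicit Types a b d x y g : A.

Lemma comm_inv x g gi : g * gi = 1 -> gi * g = 1 ->
  GRing.comm x g -> GRing.comm x gi.
Proof.
move=> gV Vg xg; rewrite /GRing.comm -[LHS]mul1r -Vg -mulrA (mulrA g) -xg.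
by rewrite -!mulrA gV mulr1.
Qed.

Lemma comm_scale c x y : GRing.comm x y -> GRing.comm x (c *: y).
Proof. by move=> xy; rewrite /GRing.comm -scalerAr xy scalerAl. Qed.

Lemma comm_alg c x : GRing.comm x c%:A.
Proof. exact/comm_scale/commr1. Qed.

(** Products are kept nested to the right; quantifying over the tail [x] lets an identity between
    consecutive factors be rewritten inside a longer product. *)
Lemma mulrA2 a b d : a * b = d -> forall x, a * (b * x) = d * x.
Proof. by move=> <- x; rewrite mulrA. Qed.

Lemma mulrA3 a b e d : a * (b * e) = d -> forall x, a * (b * (e * x)) = d * x.
Proof. by move=> <- x; rewrite !mulrA. Qed.

Definition int_powers (t : int -> A) :=
  t 0 = 1 /\ forall k l, t (k + l) = t k * t l.

Lemma comm_int_powers x t k : int_powers t ->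
  GRing.comm x (t 1) -> GRing.comm x (t k).
Proof.
move=> [t0 tD] xt.
have xtV : GRing.comm x (t (-1)).
  by apply: (comm_inv _ _ xt); rewrite -tD ?subrr ?addNr t0.
elim: k => [|k IHk|k IHk]; first by rewrite t0; apply: commr1.
  by rewrite -addn1 PoszD tD; apply: commrM.
by rewrite -addn1 PoszD opprD tD; apply: commrM.
Qed.

Lemma int_powers_eq t t' : int_powers t -> int_powers t' -> t 1 = t' 1 ->
  forall k, t k = t' k.
Proof.
move=> [t0 tD] [t'0 t'D] t1.
have tV : t (-1) = t' (-1).
  rewrite -[LHS]mulr1 -t'0 -(subrr 1) t'D -t1 mulrA -tD addNr t0.
  by rewrite mul1r.
elim=> [|k IHk|k IHk]; first by rewrite t0.
  by rewrite -addn1 PoszD tD t'D IHk t1.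
by rewrite -addn1 PoszD opprD tD t'D IHk tV.
Qed.

(** On the sequence of values [f (t k)], multiplication by a factor [t 1 - (u j)%:A] acts as a shift
    operator. This turns the cyclotomic relation into a linear recurrence. *)
Lemma scalar_shiftop (f : {scalar A}) t (d : nat) (u : nat -> R) k : int_powers t ->
  f (t k * \prod_(j < d) (t 1 - (u j)%:A)) = shiftop d u (f \o t) k.
Proof.
move=> tP; have [t0 tD] := tP; elim: d u f => [|d IHd] u f.
  by rewrite big_ord0 mulr1.
pose y := t 1 - (u 0%N)%:A.
have fy_lin : scalar (fun x => f (y * x)).
  by move=> c a b; rewrite mulrDr -scalerAr linearP.
pose fy : {scalar A} := HB.pack (fun x => f (y * x)) (GRing.isLinear.Build _ _
  _ _ _ fy_lin).
have fyE l : fy (t l) = f (t (l + 1)) - u 0%N * f (t l).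
  rewrite -[LHS]/(f (y * t l)) /y mulrBl -tD -scalerAl mul1r linearB linearZ /=.
  by rewrite addrC (addrC 1) addrC.
rewrite big_ord_recl mulrA.
have -> : t k * (t 1 - (u (@ord0 d))%:A) = y * t k.
  rewrite /y mulrBr mulrBl -!tD (addrC 1); congr (_ - _).
  exact: comm_alg.
rewrite -mulrA; apply: etrans (IHd (u \o succn) fy) _ => /=; congr (shiftop _ _ _ _).
by apply/funext => l; exact: fyE.
Qed.

Lemma scalar_mull_shiftop (f : {scalar A}) a t (d : nat) (u : nat -> R) k :
  int_powers t -> f (a * (t k * \prod_(j < d) (t 1 - (u j)%:A))) =
  shiftop d u (fun k => f (a * t k)) k.
Proof.
have fa_lin : scalar (fun x => f (a * x)).
  by move=> c x y; rewrite mulrDr -scalerAr linearP.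
pose fa : {scalar A} := HB.pack (fun x => f (a * x)) (GRing.isLinear.Build _ _
  _ _ _ fa_lin).
exact: (scalar_shiftop fa).
Qed.

Lemma prod_conj (d : nat) (w wi : A) (x : 'I_d -> A) : w * wi = 1 -> wi * w = 1 ->
  \prod_(j < d) (w * (x j * wi)) = w * (\prod_(j < d) x j * wi).
Proof.
move=> wV Vw; elim: d x => [|d IHd] x; first by rewrite !big_ord0 mul1r wV.
by rewrite !big_ord_recl IHd -!mulrA (mulrA2 Vw) mul1r.
Qed.

Lemma int_powers_comm t k l : int_powers t -> GRing.comm (t k) (t l).
Proof. by move=> [_ tD]; rewrite /GRing.comm -!tD addrC. Qed.

End Commutation.

(** * Relations in Hecke algebras of type B *)

(* The inverse of a root x of (X + 1)(X - q), where qi = q^-1. *)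
HB.lock Definition hecke_inv (R : comNzRingType) (A : algType R) (qi : R)
    (x : A) : A := qi *: x - (1 - qi)%:A.

(** * One quadratic generator and one element t under the four-term relation *)

Section RankTwo.
Variables (R : comNzRingType) (A : algType R) (q qi : R).
Local Notation hecke_inv := (hecke_inv qi).

Lemma comm_hecke_inv (x y : A) : GRing.comm x y -> GRing.comm x (hecke_inv y).
Proof.
move=> xy; rewrite hecke_inv.unlock.
by apply: commrD; [apply: comm_scale | apply/commrN/comm_alg].
Qed.

Hypothesis qqi : q * qi = 1.
Variables (g : A) (t : int -> A).
Local Notation gi := (hecke_inv g).
Hypothesis g_quad : g * g = (q - 1) *: g + q%:A.
Hypothesis tP : int_powers t.
Hypothesis gt4 : g * t 1 * g * t 1 = t 1 * g * t 1 * g.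

Lemma hecke_mul_gV : g * gi = 1.
Proof.
rewrite hecke_inv.unlock mulrBr -!scalerAr g_quad mulr1 scalerDr !scalerA
  (mulrC qi q) qqi.
by rewrite mulrBr mulr1 (mulrC qi) qqi scale1r addrAC subrr add0r.
Qed.

Lemma hecke_mul_Vg : gi * g = 1.
Proof.
rewrite hecke_inv.unlock mulrBl -!scalerAl g_quad mul1r scalerDr !scalerA
  (mulrC qi q) qqi.
by rewrite mulrBr mulr1 (mulrC qi) qqi scale1r addrAC subrr add0r.
Qed.

Lemma hecke_gE : g = (q - 1)%:A + q *: gi.
Proof.
by rewrite hecke_inv.unlock scalerBr !scalerA mulrBr mulr1 qqi scale1r addrC subrK.
Qed.

Lemma hecke_gtg_comm k : GRing.comm (g * t 1 * g) (t k).
Proof. by apply: comm_int_powers => //; rewrite /GRing.comm gt4 !mulrA. Qed.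

(** Inserting [g * gi] after [t 1] exposes [g * t 1 * g], which commutes with [t k]; the quadratic
    relation then expands [g * g]. *)
Lemma hecke_gtgt k :
  g * (t k * (g * t 1)) =
  (q - 1) *: (t k * (g * t 1)) + q *: (t 1 * (g * (t k * gi))).
Proof.
have gtE : g * t 1 = g * (t 1 * (g * gi)) by rewrite hecke_mul_gV mulr1.
have Yt x : t k * (g * (t 1 * (g * x))) = g * (t 1 * (g * (t k * x))).
  by have := hecke_gtg_comm k; rewrite /GRing.comm !mulrA => ->.
by rewrite gtE Yt (mulrA2 g_quad) mulrDl -!scalerAl mul1r.
Qed.

(** Expanding [gi] on the left by its definition reduces to [hecke_gtgt]. It is reused for every
    pair [g j.+1], [tconj j]. *)
Lemma hecke_conj_comm k :
  g * (t k * (gi * t 1)) = t 1 * (g * (t k * gi)) +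
    (1 - qi) *: (t k * (g * t 1) - g * t (k + 1)).
Proof.
rewrite {1}hecke_inv.unlock mulrBl -scalerAl mulrBr -scalerAr mulrBr -scalerAr
  hecke_gtgt.
rewrite scalerDr !scalerA (mulrC qi q) qqi scale1r mulrBr mulr1 (mulrC qi) qqi.
rewrite -!scalerAl mul1r -!scalerAr scalerBr (addrC (_ *: _)) addrA -addrA.
by rewrite tP.2 addrA.
Qed.

End RankTwo.

(** Generators are indexed by [nat] and constrained only below [n], so one index serves in two
    consecutive algebras. All integer powers of t are given at once, which avoids choosing an
    inverse. *)
Record typeB_hecke (R : comNzRingType) (A : algType R) (q : R) (n : nat)
    (g : nat -> A) (t : int -> A) : Prop := TypeBHecke {
  tb_quad : forall i, (0 < i < n)%N -> g i * g i = (q - 1) *: g i + q%:A;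
  tb_far : forall i j, (0 < i)%N -> (i.+1 < j < n)%N -> GRing.comm (g i) (g j);
  tb_braid : forall i, (0 < i)%N -> (i.+1 < n)%N ->
    g i * (g i.+1 * g i) = g i.+1 * (g i * g i.+1);
  tb_pow : int_powers t;
  tb_tg : forall i k, (1 < i < n)%N -> GRing.comm (t k) (g i);
  tb_t4 : (1 < n)%N -> g 1%N * t 1 * g 1%N * t 1 = t 1 * g 1%N * t 1 * g 1%N
}.

(* Locked, since matching against a product would unfold these fixpoints. *)
HB.lock Definition tconj (R : comNzRingType) (A : algType R) (qi : R)
    (g : nat -> A) (t : int -> A) : nat -> int -> A :=
  fix tconj j k :=
    if j is j'.+1 then g j * (tconj j' k * hecke_inv qi (g j)) else t k.

(* g_m ... g_(i+1) *)
HB.lock Definition gdown (R : comNzRingType) (A : algType R) (g : nat -> A)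
    (i : nat) : nat -> A :=
  fix gdown m :=
    if m is m'.+1 then if (i < m)%N then g m * gdown m' else 1 else 1.

(* g_1^-1 ... g_m^-1 *)
HB.lock Definition ginvs (R : comNzRingType) (A : algType R) (qi : R)
    (g : nat -> A) : nat -> A :=
  fix ginvs m := if m is m'.+1 then ginvs m' * hecke_inv qi (g m) else 1.

Section TypeB.
Variables (R : comNzRingType) (A : algType R) (q qi : R).
Hypothesis qqi : q * qi = 1.
Variables (n : nat) (g : nat -> A) (t : int -> A).
Hypothesis H : typeB_hecke q n g t.
Local Notation gi i := (hecke_inv qi (g i)).

Local Notation tconj := (tconj qi g t).
Local Notation gdown := (gdown g).
Local Notation ginvs := (ginvs qi g).

Lemma tconj0 k : tconj 0 k = t k. Proof. by rewrite tconj.unlock. Qed.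

Lemma tconjE j k : tconj j.+1 k = g j.+1 * (tconj j k * gi j.+1).
Proof. by rewrite tconj.unlock. Qed.

Lemma gdown0 i : gdown i 0 = 1. Proof. by rewrite gdown.unlock. Qed.

Lemma gdown_if i m :
  gdown i m.+1 = if (i <= m)%N then g m.+1 * gdown i m else 1.
Proof. by rewrite gdown.unlock. Qed.

Lemma ginvs0 : ginvs 0 = 1. Proof. by rewrite ginvs.unlock. Qed.

Lemma ginvsS m : ginvs m.+1 = ginvs m * gi m.+1.
Proof. by rewrite ginvs.unlock. Qed.

Lemma tconj_gdown j k : (j < n)%N -> tconj j k = gdown 0 j * (t k * ginvs j).
Proof.
elim: j => [|j IHj] jn; first by rewrite tconj0 gdown0 ginvs0 mul1r mulr1.
by rewrite tconjE IHj ?(ltnW jn) // gdown_if ginvsS !mulrA.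
Qed.

Lemma mul_gV i : (0 < i < n)%N -> g i * gi i = 1.
Proof. by move=> /(tb_quad H); apply: hecke_mul_gV. Qed.

Lemma mul_Vg i : (0 < i < n)%N -> gi i * g i = 1.
Proof. by move=> /(tb_quad H); apply: hecke_mul_Vg. Qed.

Lemma comm_gg i j : (0 < i)%N -> (i.+1 < j < n)%N -> GRing.comm (g j) (g i).
Proof. by move=> *; apply/commr_sym/(tb_far H). Qed.

Lemma comm_gt i k : (1 < i < n)%N -> GRing.comm (g i) (t k).
Proof. by move=> *; apply/commr_sym/(tb_tg H). Qed.

Lemma braidV i : (0 < i)%N -> (i.+1 < n)%N ->
  g i.+1 * (gi i * gi i.+1) = gi i * (gi i.+1 * g i).
Proof.
move=> i0 i1; have Hi : (0 < i < n)%N by lia.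
have HSi : (0 < i.+1 < n)%N by lia.
rewrite -[LHS](mul1r) -(mul_Vg Hi) -!mulrA.
congr (_ * _); rewrite -[LHS](mul1r) -(mul_Vg HSi) -!mulrA.
congr (_ * _).
have -> : g i.+1 * (g i * (g i.+1 * (gi i * gi i.+1))) =
          g i * (g i.+1 * g i) * (gi i * gi i.+1).
  by rewrite (tb_braid H) // !mulrA.
by rewrite -!mulrA (mulrA2 (mul_gV Hi)) mul1r mul_gV // mulr1.
Qed.

Lemma braidV2 i : (0 < i)%N -> (i.+1 < n)%N ->
  g i.+1 * (g i * gi i.+1) = gi i * (g i.+1 * g i).
Proof.
move=> i0 i1; have Hi : (0 < i < n)%N by lia.
have HSi : (0 < i.+1 < n)%N by lia.
rewrite -[LHS](mul1r) -(mul_Vg Hi) -!mulrA; congr (_ * _).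
have -> : g i * (g i.+1 * (g i * gi i.+1)) = g i * (g i.+1 * g i) * gi i.+1.
  by rewrite !mulrA.
by rewrite (tb_braid H) // -!mulrA mul_gV // mulr1.
Qed.

Lemma tconjS j k : (j.+1 < n)%N -> g j.+1 * tconj j k = tconj j.+1 k * g j.+1.
Proof. by move=> jn; rewrite tconjE -!mulrA mul_Vg ?mulr1. Qed.

Lemma tconj_pow j : (j < n)%N -> int_powers (tconj j).
Proof.
elim: j => [|j IHj] jn; first by have [t0 tD] := tb_pow H; split=> *; rewrite !tconj0.
have [t0 tD] := IHj (ltnW jn); split=> [|k l]; rewrite !tconjE.
  by rewrite t0 mul1r mul_gV.
by rewrite tD -!mulrA (mulrA2 (mul_Vg _)) // mul1r.
Qed.

Lemma tconj_comm_high j i k : (j.+1 < i < n)%N -> GRing.comm (g i) (tconj j k).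
Proof.
elim: j => [|j IHj] ji; first by rewrite tconj0; apply: comm_gt.
have ij : GRing.comm (g i) (g j.+1) by apply: comm_gg => //; lia.
rewrite tconjE; apply: commrM => //; apply: commrM; first by apply: IHj; lia.
exact: comm_hecke_inv.
Qed.

Lemma tconj_comm_low j i k : (0 < i < j)%N -> (j < n)%N ->
  GRing.comm (g i) (tconj j k).
Proof.
elim: j => [|j IHj] ij jn; first by lia.
have [ij'|ij'] := ltnP i j.
  have iSj : GRing.comm (g i) (g j.+1) by apply: (tb_far H); lia.
  rewrite tconjE; apply: commrM => //; apply: commrM; first by apply: IHj; lia.
  exact: comm_hecke_inv.
have -> : j = i by lia.
case: i ij {IHj} jn ij' => // i ij jn ij'.
(* Two braid moves turn [g i.+1] into [g i.+2] between the conjugating factors, where it meets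
   [tconj i k] and commutes with it. *)
have Sij : GRing.comm (g i.+2) (tconj i k) by apply: tconj_comm_high; lia.
rewrite /GRing.comm !tconjE -!mulrA -braidV; [|lia..].
rewrite (mulrA2 (esym Sij)) -!mulrA.
by rewrite (mulrA3 (tb_braid H _ _)) ?mulrA //; lia.
Qed.

(** Conjugation by [g j.+1 * g j.+2] carries the pair [g j.+1], [tconj j 1] to the pair [g j.+2],
    [tconj j.+1 1], and the four-term relation with it. *)
Lemma tconj4 j : (j.+1 < n)%N ->
  g j.+1 * tconj j 1 * g j.+1 * tconj j 1 = tconj j 1 * g j.+1 * tconj j 1 * g j.+1.
Proof.
elim: j => [|j IHj] jn; first by rewrite tconj0; apply: (tb_t4 H).
have SSj : (0 < j.+2 < n)%N by lia.
have Sj : (0 < j.+1 < n)%N by lia.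
set x := tconj j 1; set x' := tconj j.+1 1.
have e1 : x' * (g j.+1 * g j.+2) = g j.+1 * (g j.+2 * x).
  rewrite /x' tconjE -!mulrA (mulrA2 (mul_Vg Sj)) mul1r; congr (_ * _).
  by apply/esym; apply: tconj_comm_high; lia.
have e2 : g j.+2 * (g j.+1 * g j.+2) = g j.+1 * (g j.+2 * g j.+1).
  by rewrite (tb_braid H).
have IHx : g j.+1 * x * g j.+1 * x = x * g j.+1 * x * g j.+1.
  exact: IHj (ltnW jn).
clearbody x x'; have c1 y : x' * (g j.+1 * (g j.+2 * y)) = g j.+1 * (g j.+2 *
  (x * y)).
  by rewrite (mulrA3 e1) -!mulrA.
have c2 y : g j.+2 * (g j.+1 * (g j.+2 * y)) = g j.+1 * (g j.+2 * (g j.+1 * y)).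
  by rewrite (mulrA3 e2) -!mulrA.
have wV : g j.+1 * (g j.+2 * (gi j.+2 * gi j.+1)) = 1.
  by rewrite (mulrA2 (mul_gV SSj)) mul1r mul_gV.
rewrite -[LHS]mulr1 -[RHS]mulr1 -wV -!mulrA !(c1, c2).
by do 2!congr (_ * _); rewrite !mulrA IHx.
Qed.

Lemma tconj_mulr_prev j k : (j.+1 < n)%N ->
  tconj j.+1 k * tconj j 1 = tconj j 1 * tconj j.+1 k +
  (1 - qi) *: (tconj j k * (g j.+1 * tconj j 1) - g j.+1 * tconj j (k + 1)).
Proof.
move=> jn; rewrite tconjE -!mulrA; apply: (hecke_conj_comm qqi).
- by apply: (tb_quad H).
- exact/tconj_pow/ltnW.
- exact: tconj4.
Qed.

Lemma gdown_id m : gdown m m = 1.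
Proof. by case: m => [|m]; [apply: gdown0 | rewrite gdown_if ltnn]. Qed.

Lemma gdownS i m : (i <= m)%N -> gdown i m.+1 = g m.+1 * gdown i m.
Proof. by move=> im; rewrite gdown_if im. Qed.

Lemma gdownSr i m : (i < m)%N -> gdown i m = gdown i.+1 m * g i.+1.
Proof.
elim: m => // m IHm; rewrite ltnS leq_eqVlt => /orP[/eqP ->|im].
  by rewrite gdownS // !gdown_id mul1r mulr1.
by rewrite gdownS ?(ltnW im) // IHm // gdownS // mulrA.
Qed.

Lemma comm_gdown i m x :
  (forall l, (i < l <= m)%N -> GRing.comm x (g l)) -> GRing.comm x (gdown i m).
Proof.
elim: m => [|m IHm] xg; first by rewrite gdown0; apply: commr1.
rewrite gdown_if; case: ifP => im; last exact: commr1.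
apply: commrM; first by apply: xg; lia.
by apply: IHm => l il; apply: xg; lia.
Qed.

Lemma gdown_comm_high i j m : (m.+1 < j < n)%N -> GRing.comm (g j) (gdown i m).
Proof. by move=> mj; apply: comm_gdown => l il; apply: comm_gg; lia. Qed.

Lemma gdown_cat i j m : (i <= j <= m)%N -> gdown j m * gdown i j = gdown i m.
Proof.
elim: m => [|m IHm] ijm.
  have [-> ->] : i = 0%N /\ j = 0%N by lia.
  by rewrite gdown0 mul1r.
have [jm|jm] := ltnP j m.+1.
  by rewrite !gdownS -?mulrA ?IHm //; lia.
by have -> : j = m.+1; [lia | rewrite gdown_id mul1r].
Qed.

Lemma gdown_conj i j m : (i < j < m)%N -> (m < n)%N ->
  g j * gdown i m = gdown i m * g j.+1.
Proof.
elim: m => [|m IHm] ijm mn; first by lia.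
rewrite !gdownS; [|lia..].
have [jm|jm] := ltnP j m.
  rewrite mulrA (tb_far H) -?mulrA ?IHm; by [lia | rewrite mulrA].
have jE : j = m by lia.
subst j; case: m {IHm jm} ijm mn => [|m] ijm mn; first by lia.
rewrite gdownS; last by lia.
rewrite (mulrA3 (tb_braid H _ _)) -?mulrA; [|lia..].
by do 2!congr (_ * _); apply: gdown_comm_high; lia.
Qed.

Lemma ginvs_comm j m : (m.+1 < j < n)%N -> GRing.comm (g j) (ginvs m).
Proof.
elim: m => [|m IHm] mj; first by rewrite ginvs0; apply: commr1.
rewrite ginvsS; apply: commrM; first by apply: IHm; lia.
by apply/comm_hecke_inv/comm_gg; lia.
Qed.

Lemma ginvs_conj j m : (0 < j < m)%N -> (m < n)%N ->
  g j.+1 * ginvs m = ginvs m * g j.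
Proof.
elim: m => [|m IHm] jm mn; first by lia.
rewrite ginvsS.
have [jm'|jm'] := ltnP j m.
  rewrite mulrA IHm; [|lia..].
  by rewrite -!mulrA; congr (_ * _); apply/comm_hecke_inv/(tb_far H); lia.
have jE : j = m by lia.
subst j; case: m {IHm jm'} jm mn => // m _ mn.
rewrite ginvsS -!mulrA mulrA ginvs_comm -?mulrA; last by lia.
by rewrite braidV.
Qed.

(** The factor [g 1] cancels the first inverse, and what remains, g_2^-1 ... g_m^-1, commutes with
    t. *)
Lemma g1_ginvs_comm_t m k : (0 < m < n)%N ->
  GRing.comm (t k) (g 1%N * ginvs m).
Proof.
elim: m => // m IHm mn; case: m IHm mn => [_ mn|m IHm mn].
  by rewrite ginvsS ginvs0 mul1r mul_gV //; apply: commr1.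
rewrite ginvsS mulrA; apply: commrM; first by apply: IHm; lia.
by apply/comm_hecke_inv/(tb_tg H).
Qed.

Lemma ginvs_gdown m : (m < n)%N -> ginvs m * gdown 0 m = 1.
Proof.
elim: m => [|m IHm] mn; first by rewrite ginvs0 gdown0 mul1r.
rewrite gdownS // ginvsS -mulrA (mulrA2 (mul_Vg _)) // mul1r IHm //.
exact: ltnW.
Qed.

Lemma gdown_ginvs m : (m < n)%N -> gdown 0 m * ginvs m = 1.
Proof.
move=> mn; rewrite -(tconj_pow mn).1 tconj_gdown // (tb_pow H).1.
by rewrite mul1r.
Qed.

Lemma tconj_prod (d : nat) (u : nat -> R) j : (j < n)%N ->
  \prod_(i < d) (tconj j 1 - (u i)%:A) =
  gdown 0 j * (\prod_(i < d) (t 1 - (u i)%:A) * ginvs j).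
Proof.
move=> jn; rewrite -prod_conj ?gdown_ginvs ?ginvs_gdown //.
apply: eq_bigr => i _; rewrite tconj_gdown // mulrBl mulrBr; congr (_ - _).
by rewrite -scalerAl mul1r -scalerAr gdown_ginvs.
Qed.

(** Conjugation by [g j.+2] lengthens both [ginvs] and [gdown] in the correction term by one step,
    which drives the induction. The factor [gdown 0 j.+1] followed by a power of t explains why
    [top] refers to row 0. *)
Lemma tconj_mulr_t j k : (j.+1 < n)%N ->
  tconj j.+1 k * t 1 = t 1 * tconj j.+1 k +
  (1 - qi) *: (t k * (ginvs j * (gdown 0 j.+1 * t 1))
               - ginvs j * (gdown 0 j.+1 * t (k + 1))).
Proof.
elim: j => [|j IHj] jn.
  have := tconj_mulr_prev k jn; rewrite !tconj0 => ->.
  by rewrite gdownS // gdown0 ginvs0 !mul1r mulr1.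
have SSj : (0 < j.+2 < n)%N by lia.
have tg l : GRing.comm (t l) (g j.+2) by apply: (tb_tg H).
have ginvsC : GRing.comm (g j.+2) (ginvs j) by apply: ginvs_comm; lia.
have gdownC : GRing.comm (gi j.+2) (gdown 0 j).
  by apply/commr_sym/comm_hecke_inv/commr_sym/gdown_comm_high; lia.
have conjE l : g j.+2 * (ginvs j * (gdown 0 j.+1 * (t l * gi j.+2))) =
               ginvs j.+1 * (gdown 0 j.+2 * t l).
  rewrite (mulrA2 ginvsC) (gdownS (leq0n j.+1)) (gdownS (leq0n j)) ginvsS -!mulrA.
  rewrite (comm_hecke_inv _ (tg l)) (mulrA2 (esym gdownC)) -!mulrA.
  by congr (_ * _); rewrite (mulrA3 (braidV2 _ _)) // -!mulrA.
rewrite (tconjE j.+1) -!mulrA -(comm_hecke_inv _ (tg 1)).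
rewrite (mulrA2 (IHj (ltnW jn))) mulrDl mulrDr -!scalerAl -!scalerAr.
rewrite mulrBl mulrBr -!mulrA !(mulrA2 (esym (tg _))) -!mulrA.
by rewrite !conjE.
Qed.

End TypeB.

(** * The operators on families of coset values *)

Section CosetModule.
Variables (R : comNzRingType) (A : algType R) (q qi : R).
Hypothesis qqi : q * qi = 1.
Variables (n : nat) (g : nat -> A) (t : int -> A).
Hypothesis H : typeB_hecke q n g t.
Local Notation gi i := (hecke_inv qi (g i)).
Local Notation V := (nat -> int -> A).
Implicit Types phi : V.

(* phi j k stands for the value at g_n ... g_(j+1) t'_j^k of a left linear map;
   beyond n, the generators act by the character g_i = q, t = 1. *)
Definition gop i phi : V := fun j k =>
  if (n < j)%N then q *: phi j k else
  if (i < j)%N then g i * phi j k else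
  if i == j then phi j.-1 k else
  if i == j.+1 then (q - 1) *: phi j k + q *: phi j.+1 k else
  g i.-1 * phi j k.

(** Multiply g_n ... g_(j+1) t'_j^k by t on the right and apply [tconj_mulr_t]: the leading factors
    commute with t and [ginvs], and in the correction they complete [gdown] to g_n ... g_1, the
    label of row 0. *)
Definition top phi : V := fun j k =>
  if (n < j)%N then phi j k else
  if j is j'.+1 then
    t 1 * phi j k + (1 - qi) *: (t k * (ginvs qi g j' * phi 0%N 1)
                                 - ginvs qi g j' * phi 0%N (k + 1))
  else phi 0%N (k + 1).

(** Solves [top] for its argument. The columns 0 and [k] stand where [top] has 1 and [k + 1], since
    row 0 of the preimage is shifted by one. *)
Definition topV phi : V := fun j k =>
  if (n < j)%N then phi j k else
  if j is j'.+1 then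
    t (-1) * (phi j k - (1 - qi) *: (t k * (ginvs qi g j' * phi 0%N 0)
                                     - ginvs qi g j' * phi 0%N k))
  else phi 0%N (k - 1).

Lemma gop_out i phi j k : (n < j)%N -> gop i phi j k = q *: phi j k.
Proof. by rewrite /gop => ->. Qed.

Lemma gop_lt i phi j k : (i < j <= n)%N -> gop i phi j k = g i * phi j k.
Proof. by case/andP=> ij jn; rewrite /gop ltnNge jn ij. Qed.

(** In the algebra t'_j^k g_j = g_j t'_(j-1)^k, so right multiplication by g_j lengthens the chain
    g_n ... g_(j+1). In [gop_S] the chain is shortened instead, at the cost of a g_(j+1)^2. *)
Lemma gop_eq i phi k : (i < n)%N -> gop i.+1 phi i.+1 k = phi i k.
Proof. by move=> jn; rewrite /gop ltnNge jn ltnn eqxx. Qed.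

Lemma gop_S i phi k : (i < n)%N ->
  gop i.+1 phi i k = (q - 1) *: phi i k + q *: phi i.+1 k.
Proof.
move=> jn; rewrite /gop ltnNge (ltnW jn) /= ltnNge leqnSn /= eqxx.
by rewrite (gtn_eqF (ltnSn i)).
Qed.

Lemma gop_gt i phi j k : (j < i)%N -> (j <= n)%N ->
  gop i.+1 phi j k = g i * phi j k.
Proof.
by move=> ji jn; rewrite /gop !ifN //; lia.
Qed.

Lemma gop_quad i phi j k : (0 < i <= n)%N ->
  gop i (gop i phi) j k = (q - 1) *: gop i phi j k + q *: phi j k.
Proof.
case: i => // i /= i_n; have [nj|jn] := ltnP n j.
  by rewrite !gop_out // scalerBl scale1r subrK.
have [ij|ji|<-] := ltngtP i.+1 j.
- rewrite !gop_lt ?ij // mulrA (tb_quad H) ?mulrDl; last by lia.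
  by rewrite -!scalerAl mul1r.
- have [ji'|ij'|ji'] := ltngtP j i.
  + rewrite !gop_gt // mulrA (tb_quad H) ?mulrDl; last by lia.
    by rewrite -!scalerAl mul1r.
  + by lia.
  + by rewrite ji' gop_S // gop_eq.
- by rewrite gop_eq // gop_S // gop_eq.
Qed.

Lemma gop_far i i' phi j k : (0 < i)%N -> (i.+1 < i' <= n)%N ->
  gop i (gop i' phi) j k = gop i' (gop i phi) j k.
Proof.
case: i => [//|i] _; case: i' => // i' ii'; have [nj|jn] := ltnP n j.
  by rewrite !gop_out.
have [ij|ji|ij] := ltngtP i.+1 j.
- have [i'j|ji'|i'j] := ltngtP i'.+1 j.
  + rewrite !gop_lt; [|lia..].
    by rewrite !mulrA (tb_far H) //; lia.
  + have [ji|ij'|ji''] := ltngtP j i'; last 1 first.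
    * subst j; rewrite !(@gop_lt i.+1) ?gop_S ?(@gop_lt i.+1); [|lia..].
      by rewrite mulrDr -!scalerAr.
    * rewrite !(@gop_lt i.+1) ?(@gop_gt i') ?(@gop_lt i.+1); [|lia..].
      by rewrite !mulrA (tb_far H) //; lia.
    * by lia.
  + by subst j; rewrite !(@gop_lt i.+1) ?gop_eq ?(@gop_lt i.+1) //; lia.
- rewrite (@gop_gt i'); [|lia..].
  have [ji'|ij'|ji'] := ltngtP j i.
  + rewrite !gop_gt; [|lia..].
    by rewrite !mulrA (tb_far H) //; lia.
  + by lia.
  + subst j; rewrite !gop_S ?gop_gt; [|lia..].
    by rewrite mulrDr -!scalerAr.
- subst j; rewrite gop_eq; last by lia.
  by rewrite !(@gop_gt i') ?gop_eq //; lia.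
Qed.

Lemma gop_braid i phi j k : (0 < i)%N -> (i < n)%N ->
  gop i (gop i.+1 (gop i phi)) j k = gop i.+1 (gop i (gop i.+1 phi)) j k.
Proof.
case: i => [//|i] _ i_n; have [nj|jn] := ltnP n j; first by rewrite !gop_out.
(* Only rows [i], [i.+1] and [i.+2] are mixed; on the other rows up to [n] both sides are left
   multiplications related by the braid relation of [A]. *)
have E0 psi : gop i.+1 psi i k = (q - 1) *: psi i k + q *: psi i.+1 k.
  by apply: gop_S; lia.
have E1 psi : gop i.+1 psi i.+1 k = psi i k by apply: gop_eq; lia.
have E2 psi : gop i.+1 psi i.+2 k = g i.+1 * psi i.+2 k by apply: gop_lt; lia.
have F0 psi : gop i.+2 psi i k = g i.+1 * psi i k by apply: gop_gt; lia.
have F1 psi : gop i.+2 psi i.+1 k = (q - 1) *: psi i.+1 k + q *: psi i.+2 k.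
  exact: gop_S.
have F2 psi : gop i.+2 psi i.+2 k = psi i.+1 k by apply: gop_eq; lia.
have [ij|ji|<-] := ltngtP i.+2 j; last by rewrite !(E0, E1, E2, F0, F1, F2).
- rewrite !gop_lt; [|lia..].
  by rewrite (mulrA3 (tb_braid H _ _)) -?mulrA //; lia.
- have [ji'|ij'|ji'] := ltngtP j i.
  + rewrite !gop_gt; [|lia..].
    by rewrite (mulrA3 (tb_braid H _ _)) -?mulrA //; lia.
  + have -> : j = i.+1 by lia.
    by rewrite !(E0, E1, E2, F0, F1, F2) mulrDr -!scalerAr.
  + rewrite ji' !(E0, E1, E2, F0, F1, F2) !mulrDr !scalerDr -!scalerAr !mulrDr.
    rewrite -!scalerAr (mulrA (g i.+1)) (tb_quad H) ?mulrDl; last by lia.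
    rewrite -!scalerAl mul1r !scalerDr -!addrA; congr (_ + _).
    by rewrite addrCA; congr (_ + _); rewrite ?scalerA ?(mulrC q) addrC.
Qed.

Lemma top_out phi j k : (n < j)%N -> top phi j k = phi j k.
Proof. by rewrite /top => ->. Qed.

Lemma top0 phi k : top phi 0%N k = phi 0%N (k + 1). Proof. by []. Qed.

Lemma topS phi j k : (j < n)%N -> top phi j.+1 k =
  t 1 * phi j.+1 k + (1 - qi) *: (t k * (ginvs qi g j * phi 0%N 1)
                                  - ginvs qi g j * phi 0%N (k + 1)).
Proof. by move=> jn; rewrite /top ltnNge jn. Qed.

Lemma topK phi j k : topV (top phi) j k = phi j k.
Proof.
have [t0 tD] := tb_pow H; have [nj|jn] := ltnP n j.
  by rewrite /topV nj top_out.
rewrite /topV ltnNge jn /=; case: j jn => [|j] jn; first by rewrite top0 subrK.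
by rewrite topS // !top0 add0r addrK mulrA -tD addNr t0 mul1r.
Qed.

Lemma topVK phi j k : top (topV phi) j k = phi j k.
Proof.
have [t0 tD] := tb_pow H; have [nj|jn] := ltnP n j.
  by rewrite /top nj /topV nj.
case: j jn => [|j] jn; first by rewrite top0 /topV /= addrK.
rewrite topS // {1}/topV ltnNge jn /= mulrA -tD subrr t0 mul1r.
by rewrite /topV /= subrr addrK subrK.
Qed.

Lemma top_gop i phi j k : (1 < i <= n)%N ->
  top (gop i phi) j k = gop i (top phi) j k.
Proof.
case: i => // i i_n; have [nj|jn] := ltnP n j.
  by rewrite top_out // !gop_out // top_out.
have tg l : GRing.comm (t l) (g i) -> forall x, t l * (g i * x) = g i * (t l * x).
  by move=> tgi x; rewrite !mulrA tgi.
have G0 l : gop i.+1 phi 0%N l = g i * phi 0%N l by apply: gop_gt; lia.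
case: j jn => [|j] jn; first by rewrite top0 G0 gop_gt ?top0 //; lia.
rewrite topS // !G0.
have [ij|ji|ij] := ltngtP i.+1 j.+1.
- rewrite !gop_lt ?topS //; [|lia..].
  have gG x : ginvs qi g j * (g i * x) = g i.+1 * (ginvs qi g j * x).
    by rewrite !mulrA (ginvs_conj qqi H) //; lia.
  rewrite !gG (mulrA2 (tb_tg H _ _)) -?mulrA; last by lia.
  rewrite (mulrA2 (tb_tg H _ _)) -?mulrA; last by lia.
  by rewrite [RHS]mulrDr -scalerAr mulrBr.
- have [ji'|ij'|ji'] := ltngtP j.+1 i.
  + rewrite !gop_gt ?topS //; try by lia.
    have gG x : ginvs qi g j * (g i * x) = g i * (ginvs qi g j * x).
      by rewrite !mulrA (ginvs_comm qi H) //; lia.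
    rewrite !gG !tg; [|by apply: (tb_tg H); lia..].
    by rewrite [RHS]mulrDr -scalerAr mulrBr.
  + by lia.
  + subst i; rewrite !gop_S ?topS //; try by lia.
    (* Writing [g j.+1] through its inverse lets that inverse extend [ginvs] by one factor. *)
    have gG x : ginvs qi g j * (g j.+1 * x) =
        (q - 1) *: (ginvs qi g j * x) + q *: (ginvs qi g j.+1 * x).
      rewrite (hecke_gE qqi (g j.+1)) mulrDl mulrDr -!scalerAl mul1r -!scalerAr.
      by rewrite ginvsS mulrA.
    rewrite !gG !mulrDr -!scalerAr !scalerDr !scalerN.
    by lin R A; ring: qqi.
- case: ij => ij; subst j; case: i jn i_n tg G0 => // i jn i_n tg G0.
  rewrite !gop_eq; [|lia..].
  have gG x : ginvs qi g i.+1 * (g i.+1 * x) = ginvs qi g i * x.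
    by rewrite ginvsS -mulrA (mulrA2 (mul_Vg qqi H _)) ?mul1r //; lia.
  by rewrite !gG topS //; lia.
Qed.

Lemma top_gop4 phi j k : (0 < n)%N ->
  top (gop 1 (top (gop 1 phi))) j k = gop 1 (top (gop 1 (top phi))) j k.
Proof.
move=> n0; have [nj|jn] := ltnP n j.
  rewrite ?(top_out, gop_out) //.
have [t0 tD] := tb_pow H.
pose Q (psi : V) (l : int) := (q - 1) *: psi 0%N l + q *: psi 1%N l.
have Q0 psi l : gop 1 psi 0%N l = Q psi l by apply: gop_S.
have E1 psi l : gop 1 psi 1%N l = psi 0%N l by apply: gop_eq.
have E2 psi l : top psi 1%N l =
    t 1 * psi 1%N l + (1 - qi) *: (t l * psi 0%N 1 - psi 0%N (l + 1)).
  by rewrite topS // ginvs0 !mul1r.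
(* Every row of [top] above row 0 depends on its own entry and on row 0 alone, so row 0 of the inner
   composite is computed once. *)
have P0 psi l : gop 1 (top (gop 1 psi)) 0 l =
    q *: (t 1 * psi 0%N l) + (q - 1) *: (t l * Q psi 1).
  by rewrite Q0 /Q top0 E2 !Q0 E1; lin R A; ring: qqi.
have QT l : Q (top phi) l = q *: (t 1 * phi 1%N l) + (q - 1) *: (t l * phi 0%N 1).
  by rewrite /Q top0 E2; lin R A; ring: qqi.
have tC x : t k * (t 1 * x) = t 1 * (t k * x).
  by rewrite !mulrA -!tD addrC.
have tk1 : t (k + 1) = t 1 * t k by rewrite -tD addrC.
case: j jn => [_|j jn].
  rewrite top0 !P0 QT tk1 /Q top0 -!mulrA !(mulrDr, tC, =^~ scalerAr).
  by lin R A; ring: qqi.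
rewrite topS // !P0.
case: j jn => [_|j jn].
  rewrite !E1 !top0 !Q0 QT ginvs0 !mul1r tk1 /Q -!mulrA !(mulrDr, tC, =^~ scalerAr).
  by lin R A; ring: qqi.
have gE x : g 1%N * x = (q - 1) *: x + q *: (gi 1%N * x).
  by rewrite {1}(hecke_gE qqi (g 1%N)) mulrDl -!scalerAl mul1r.
have n1 : (1 < n)%N by lia.
(* [D] is g_2^-1 ... g_(j+1)^-1 and commutes with all powers of t. Replacing [G] by g_1^-1 [D]
   leaves only rank two relations between g_1 and t. *)
set G := ginvs qi g j.+1; pose D := g 1%N * G.
have DT l x : D * (t l * x) = t l * (D * x).
  have tD' : GRing.comm (t l) D by apply: (g1_ginvs_comm_t qqi H).
  by rewrite mulrA -tD' mulrA.
have GE x : G * x = gi 1%N * (D * x).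
  by rewrite /D -mulrA (mulrA2 (mul_Vg qqi H _)) ?mul1r.
have gG_DE x : g 1%N * (G * x) = D * x by rewrite mulrA.
have TS psi l : top psi j.+2 l = t 1 * psi j.+2 l +
    (1 - qi) *: (t l * (G * psi 0%N 1) - G * psi 0%N (l + 1)) by apply: topS.
have GL psi l : gop 1 psi j.+2 l = g 1%N * psi j.+2 l by apply: gop_lt.
clearbody D G.
have key x : g 1%N * (t k * (G * (t 1 * x))) = t 1 * (g 1%N * (t k * (G * x))) +
    (q - 1) *: (t k * (G * (t 1 * x)) - G * (t (k + 1) * x)).
  rewrite !GE !DT; move: (D * x) => y.
  have := tconj_mulr_prev (j := 0) qqi H k n1.
  rewrite tconjE !tconj0 => /(congr1 ( *%R^~ y)).
  rewrite !(mulrDl, mulNr) -!scalerAl mulrBl -!mulrA => ->; rewrite !gE.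
  rewrite tk1 -!mulrA !(mulrDr, tC, =^~ scalerAr).
  by lin R A; ring: qqi.
have gtg x : g 1%N * (t 1 * (g 1%N * (t k * (G * x)))) =
    q *: (t k * (G * (t 1 * x))) + (q - 1) *: (g 1%N * (G * (t (k + 1) * x))).
  have := hecke_gtg_comm (tb_pow H) (tb_t4 H n1) k.
  move=> /(congr1 ( *%R^~ (G * x))); rewrite -!mulrA => ->.
  rewrite !gG_DE GE gE !DT tk1 -!mulrA !(mulrDr, tC, =^~ scalerAr).
  by lin R A; ring: qqi.
have gtg1 x : g 1%N * (t 1 * (g 1%N * (G * x))) =
    q *: (G * (t 1 * x)) + (q - 1) *: (t 1 * (g 1%N * (G * x))).
  by rewrite gG_DE GE !DT gE addrC.
have gGt x : g 1%N * (G * (t 1 * x)) = t 1 * (g 1%N * (G * x)).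
  by rewrite !gG_DE DT.
have gt4 x : g 1%N * (t 1 * (g 1%N * (t 1 * x))) = t 1 * (g 1%N * (t 1 * (g 1%N
  * x))).
  by have := tb_t4 H n1; rewrite !mulrA => ->.
rewrite !GL !TS !GL TS !Q0 !QT /Q.
rewrite !(mulrDr, mulrN, =^~ scalerAr) !(gt4, gtg, gtg1, gGt, key).
by lin R A; ring: qqi.
Qed.

End CosetModule.

(** * The prescribed values, on which the operators act as right multiplication *)

Section MarkovVector.
Variables (R : comNzRingType) (A : algType R) (q qi : R).
Hypothesis qqi : q * qi = 1.
Variables (n : nat) (g : nat -> A) (t : int -> A).
Hypothesis H : typeB_hecke q n g t.
Variables (z : R) (s : int -> R).
Local Notation gi i := (hecke_inv qi (g i)).
Local Notation tconj := (tconj qi g t).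

(* The prescribed values of E_n at g_n ... g_(j+1) t'_j^k. *)
Definition markov_vec (j : nat) (k : int) : A :=
  if (j < n)%N then z *: (gdown g j n.-1 * tconj j k)
  else if j == n then (s k)%:A else 0.

Lemma markov_vec_lt j k : (j < n)%N ->
  markov_vec j k = z *: (gdown g j n.-1 * tconj j k).
Proof. by rewrite /markov_vec => ->. Qed.

Lemma markov_vec_n k : markov_vec n k = (s k)%:A.
Proof. by rewrite /markov_vec ltnn eqxx. Qed.

Lemma markov_vec_gt j k : (n < j)%N -> markov_vec j k = 0.
Proof. by move=> nj; rewrite /markov_vec !ifN //; lia. Qed.

(** The index [n] is excluded because [g n] is not a generator of [A]; for the others this gives the
    right linearity of E_n. *)
Lemma gop_markov_vec i j k : (0 < i < n)%N ->
  gop q n g i markov_vec j k = markov_vec j k * g i.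
Proof.
case: i => [//|i] i_n; have [nj|jn] := ltnP n j.
  by rewrite gop_out // !markov_vec_gt // mul0r scaler0.
have [ij|ji|<-] := ltngtP i.+1 j.
- rewrite gop_lt; last by lia.
  have [jn'|jn'] := ltnP j n; last first.
    have -> : j = n by lia.
    by rewrite markov_vec_n -comm_alg.
  rewrite markov_vec_lt // -scalerAl -scalerAr; congr (_ *: _).
  apply: commrM; last by apply: (tconj_comm_low qqi H); lia.
  by apply: comm_gdown => l jl; apply: (tb_far H); lia.
- have [ji'|ij'|ji'] := ltngtP j i; last 1 first.
  + subst j; rewrite gop_S ?markov_vec_lt; [|lia..].
    rewrite (@gdownSr _ _ g i) -?scalerAl -?mulrA; [|lia..].
    rewrite (mulrA (g i.+1)) (tconjS qqi H); last by lia.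
    rewrite -(mulrA (tconj _ _)) (tb_quad H) // !mulrDr -!scalerAr mulr1.
    rewrite -(tconjS qqi H) ?mulrDr -?scalerAr; last by lia.
    by lin R A; ring.
  + rewrite gop_gt // !markov_vec_lt; [|lia..].
    rewrite -scalerAl -scalerAr mulrA (gdown_conj H); [|lia..].
    by rewrite -!mulrA (tconj_comm_high qi H) //; lia.
  + by lia.
- rewrite gop_eq ?markov_vec_lt; [|lia..].
  rewrite gdownSr -?scalerAl -?mulrA ?(tconjS qqi H) //; lia.
Qed.

Lemma top_markov_vec j k : (0 < n)%N ->
  top qi n g t markov_vec j k = markov_vec j k * t 1.
Proof.
move=> n0; have [t0 tD] := tb_pow H; have [nj|jn] := ltnP n j.
  by rewrite top_out // markov_vec_gt // mul0r.
case: j jn => [|j] jn.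
  by rewrite top0 !markov_vec_lt // -scalerAl -mulrA !tconj0 tD.
rewrite topS //; have [Sjn|Sjn] := ltnP j.+1 n; last first.
  (* In row [n] the correction vanishes: [ginvs] undoes [gdown], leaving [z] times t^k t - t^(k+1),
     and the scalar value commutes with t. *)
  have jE : j.+1 = n by lia.
  have -> : j = n.-1 by lia.
  rewrite prednK // markov_vec_n !markov_vec_lt // -!scalerAr !tconj0.
  rewrite (mulrA2 (ginvs_gdown qqi H _)); last by lia.
  rewrite (mulrA2 (ginvs_gdown qqi H _)); last by lia.
  by rewrite !mul1r tD subrr scaler0 addr0 mulr1 -scalerAl mul1r.
rewrite !markov_vec_lt // -!scalerAl -mulrA (tconj_mulr_t qqi H) //.
have gdC l : GRing.comm (t l) (gdown g j.+1 n.-1).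
  by apply: comm_gdown => i ij; apply: (tb_tg H); lia.
have giC : GRing.comm (ginvs qi g j) (gdown g j.+1 n.-1).
  by apply: comm_gdown => i ij; apply/commr_sym/(ginvs_comm qi H); lia.
rewrite mulrDr (mulrA2 (esym (gdC 1))) -!scalerAr mulrBr.
rewrite (mulrA2 (esym (gdC k))) -!mulrA !(mulrA2 (esym giC)) -!mulrA.
rewrite !(mulrA2 (gdown_cat _ _)); [|lia..].
by rewrite !tconj0; lin R A; ring.
Qed.

End MarkovVector.

(** * Actions of the presented algebras *)

Section Action.
Variables (R : comNzRingType) (V : lmodType R) (m : nat).
Variables (op opV : 'I_m -> V -> V).
Hypothesis op_lin : forall i, linear (op i).
Hypothesis opV_lin : forall i, linear (opV i).
Hypothesis opK : forall i, cancel (op i) (opV i).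
Hypothesis opVK : forall i, cancel (opV i) (op i).
Hypothesis op_rel : forall r s v, artinB_rel r s -> foldr op v r = foldr op v s.

Definition word_act (w : seq ('I_m * bool)) (v : V) : V :=
  foldr (fun p v => if p.2 then op p.1 v else opV p.1 v) v w.

Lemma word_act_eq w w' v :
  pres_eq (@artinB_rel m) w w' -> word_act w v = word_act w' v.
Proof.
move=> ww'; elim: ww' v => {w w'} //.
- by move=> w w' x _ xw _ w'x v; rewrite xw.
- by move=> v v' w w' _ vv' _ ww' x; rewrite /word_act !foldr_cat -!/(word_act
    _ _) ww' vv'.
- by move=> i [] v /=; rewrite ?opK ?opVK.
- move=> r s rs v; have := op_rel v rs.
  have actE l : word_act (posw l) v = foldr op v l by elim: l => //= i l ->.
  by rewrite !actE.
Qed.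

Lemma word_act_linear w : linear (word_act w).
Proof.
move=> c x y; elim: w => [|[i []] w IHw] //=; rewrite {}IHw.
  exact: op_lin.
exact: opV_lin.
Qed.

Definition braid_act (b : artinB m) (v : V) : V := word_act (repr b) v.

HB.instance Definition _ b :=
  GRing.isLinear.Build R V V *:%R (braid_act b) (word_act_linear (repr b)).

Lemma braid_act_cls w v : braid_act (cls _ w) v = word_act w v.
Proof. exact/word_act_eq/repr_cls. Qed.

Lemma braid_actM b c v : braid_act (b * c)%g v = braid_act b (braid_act c v).
Proof. by rewrite [LHS]braid_act_cls /word_act foldr_cat. Qed.

Lemma braid_act1 v : braid_act 1%g v = v.
Proof. exact: braid_act_cls. Qed.

Definition gralg_act (x : gralg R (artinB m)) (v : V) : V :=
  \sum_(b <- msupp x) x@_b *: braid_act b v.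

Lemma gralg_actEw (d : {fset (artinB m)}) (x : gralg R (artinB m)) v :
  (msupp x `<=` d)%fset -> gralg_act x v = \sum_(b <- d) x@_b *: braid_act b v.
Proof.
move=> le; apply: big_fset_incl => // k _ /mcoeff_outdom ->.
by rewrite scale0r.
Qed.

Lemma gralg_actU c b v : gralg_act << c *g b >> v = c *: braid_act b v.
Proof. by rewrite (gralg_actEw v msuppU_le) big_seq_fset1 mcoeffUU. Qed.

Lemma gralg_act0 v : gralg_act 0 v = 0.
Proof. by rewrite /gralg_act msupp0 big_seq_fset0. Qed.

Lemma gralg_actD x y v : gralg_act (x + y) v = gralg_act x v + gralg_act y v.
Proof.
rewrite (gralg_actEw v (fsubsetUl (msupp x) (msupp y))).
rewrite (gralg_actEw v (fsubsetUr (msupp x) (msupp y))).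
rewrite (gralg_actEw v (msuppD_le x y)) -big_split /=; apply/eq_bigr=> k _.
by rewrite mcoeffD scalerDl.
Qed.

Lemma gralg_actZ c x v : gralg_act (c *: x) v = c *: gralg_act x v.
Proof.
elim/gr_ind: x => [|x y ex ey|d b].
- by rewrite scaler0 !gralg_act0 scaler0.
- by rewrite scalerDr !gralg_actD ex ey scalerDr.
- by rewrite gr_scaleU !gralg_actU scalerA.
Qed.

Lemma gralg_act_linear x : linear (gralg_act x).
Proof.
move=> c v w; rewrite scaler_sumr -big_split; apply: eq_bigr => b _ /=.
by rewrite linearP scalerDr !scalerA mulrC.
Qed.
HB.instance Definition _ x :=
  GRing.isLinear.Build R V V *:%R (gralg_act x) (gralg_act_linear x).

Lemma gralg_actM x y v : gralg_act (x * y) v = gralg_act x (gralg_act y v).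
Proof.
elim/gr_ind: x => [|x x' ex ex'|c b].
- by rewrite mul0r !gralg_act0.
- by rewrite mulrDl !gralg_actD ex ex'.
elim/gr_ind: y => [|y y' ey ey'|d b'].
- by rewrite mulr0 !gralg_act0 linear0.
- by rewrite mulrDr !gralg_actD linearD /= ey ey'.
rewrite gr_MUU !gralg_actU braid_actM -scalerA; congr (_ *: _).
by rewrite linearZ.
Qed.

Variables (q : R) (u : nat -> R) (L : level).
Hypothesis rel_act0 : forall x v, @hecke_rel R q u L m x ->
  gralg_act x v = 0.

Definition hecke_act (x : hecke q u L m) (v : V) : V := gralg_act (repr x) v.

Lemma hecke_act_pi x v : hecke_act (hecke_pi q u L x) v = gralg_act x v.
Proof.
apply/eqP; rewrite -subr_eq0 -scaleN1r -gralg_actZ -gralg_actD scaleN1r; apply/eqP.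
elim: (repr_qpi (@hecke_rel R q u L m) x) v => {x}.
- by move=> x Sx v; apply: rel_act0.
- exact: gralg_act0.
- by move=> x y _ Ix _ Iy v; rewrite gralg_actD Ix Iy addr0.
- by move=> a x _ Ix v; rewrite gralg_actM Ix linear0.
- by move=> a x _ Ix v; rewrite gralg_actM Ix.
Qed.

Lemma hecke_pi_repr (x : hecke q u L m) : hecke_pi q u L (repr x) = x.
Proof. exact: qpiK. Qed.

Lemma hecke_actP c x y v :
  hecke_act (c *: x + y) v = c *: hecke_act x v + hecke_act y v.
Proof.
rewrite -[x]hecke_pi_repr -[y]hecke_pi_repr -[hecke_pi _ _ _ (repr y)]/(qpi _ _).
rewrite -[_ + _](linearP (@qpi R _ (@hecke_rel R q u L m))).
by rewrite !hecke_act_pi gralg_actD gralg_actZ.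
Qed.

Lemma hecke_actM x y v : hecke_act (x * y) v = hecke_act x (hecke_act y v).
Proof.
rewrite -[x]hecke_pi_repr -[y]hecke_pi_repr.
rewrite -[_ * _](rmorphM (@qpi R _ (@hecke_rel R q u L m))).
by rewrite !hecke_act_pi gralg_actM.
Qed.

Lemma hecke_act_br b v : hecke_act (hecke_br q u L b) v = braid_act b v.
Proof. by rewrite hecke_act_pi gralg_actU scale1r. Qed.

Lemma hecke_act1 v : hecke_act 1 v = v.
Proof. by rewrite [LHS]hecke_act_br braid_act1. Qed.

Lemma hecke_act_gen i v : hecke_act (hecke_br q u L (artinB_gen i)) v = op i v.
Proof. by rewrite hecke_act_br [LHS]braid_act_cls. Qed.

End Action.

(** * Algebra structure and nontriviality for d = infinity *)

Section Affine.
Variables (R : comNzRingType) (q : R) (u : nat -> R) (m : nat).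
Local Notation H := (hecke q u Infinite m).

Lemma affine_rel_act0 (V : lmodType R) (op opV : 'I_m -> V -> V)
    (op_lin : forall i, linear (op i))
    (opV_lin : forall i, linear (opV i))
    (opK : forall i, cancel (op i) (opV i))
    (opVK : forall i, cancel (opV i) (op i))
    (op_rel : forall r s v, artinB_rel r s -> foldr op v r = foldr op v s)
    (op_quad : forall (i : 'I_m) v, (0 < i)%N ->
      op i (op i v) = (q - 1) *: op i v + q *: v) x v :
  @hecke_rel R q u Infinite m x -> gralg_act op opV x v = 0.
Proof.
case=> [i s i_gt0|] //.
have actE w : gralg_act op opV (gr_elt R (artinB_gen i)) w = op i w.
  rewrite /gr_elt (gralg_actU op opV) scale1r.
  exact: (@braid_act_cls _ _ _ _ _ opK opVK op_rel).
have act1 w : gralg_act op opV 1 w = w.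
  rewrite (gralg_actU op opV) scale1r.
  exact: (@braid_act1 _ _ _ _ _ opK opVK op_rel).
rewrite -scaleN1r gralg_actD gralg_actZ gralg_actD !gralg_actZ act1 expr2.
rewrite (gralg_actM op_lin opV_lin opK opVK op_rel) !actE op_quad //.
by rewrite scaleN1r subrr.
Qed.

(* The character g_i = -1, t = 1 shows that the algebra is not trivial, as the
   algType structure requires. *)
Lemma affine_hecke_neq0 : (1 : H) != 0.
Proof.
pose op (i : 'I_m) (x : R^o) : R^o := if i == 0 :> nat then x else - x.
have op_lin i : linear (op i).
  move=> c x y; rewrite /op; case: ifP => // _.
  by rewrite opprD scalerN.
have opK i : cancel (op i) (op i).
  by move=> x; rewrite /op; case: ifP => // ->; rewrite ?opprK.
have op_rel r s v : artinB_rel r s -> foldr op v r = foldr op v s.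
  case=> [t s' t0 s1|t i t0 i1|i j i0 ij|i j i0 ij]; rewrite /= /op.
  - by rewrite t0 s1.
  - by rewrite t0; case: ifP.
  - by case: ifP; case: ifP.
  - by rewrite ij /= (gtn_eqF i0) .
have quad (i : 'I_m) v : (0 < i)%N -> op i (op i v) = (q - 1) *: op i v + q *: v.
  move=> i0; rewrite /op (gtn_eqF i0) opprK scalerN -scaleNr -scalerDl.
  by rewrite opprB subrK scale1r.
have rel0 := affine_rel_act0 op_lin op_lin opK opK op_rel quad.
apply/eqP => e; have := oner_neq0 R; apply/negP; rewrite negbK; apply/eqP.
have h1 := hecke_act1 op_lin op_lin opK opK op_rel rel0 (1 : R^o).
rewrite -[LHS]h1 e -[0](scale0r (0 : H)) -[_ *: _]addr0.
rewrite (hecke_actP op_lin op_lin opK opK op_rel rel0) scale0r add0r.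
by rewrite [LHS](hecke_act_pi op_lin op_lin opK opK op_rel rel0) gralg_act0.
Qed.

HB.instance Definition _ :=
  GRing.PzSemiRing_isNonZero.Build H affine_hecke_neq0.

Fact affine_scaleAl (c : R) (x y : H) : c *: (x * y) = c *: x * y.
Proof. exact: quotalg_scaleAl. Qed.

HB.instance Definition _ := GRing.Lmodule_isLalgebra.Build R H affine_scaleAl.

Fact affine_scaleAr (c : R) (x y : H) : c *: (x * y) = x * (c *: y).
Proof.
pose S := @hecke_rel R q u Infinite m.
rewrite -[x](qpiK (S := S)) -[y](qpiK (S := S)).
transitivity (qpi S (c *: (repr x * repr y))).
  by rewrite [RHS]qpi_scale [in RHS]qpi_mul.
by rewrite scalerAr [LHS]qpi_mul [in LHS]qpi_scale.
Qed.

HB.instance Definition _ := GRing.Lalgebra_isAlgebra.Build R H affine_scaleAr.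

End Affine.

(** * Generators and inclusions of the affine algebras *)

Lemma expgzS (G : groupType) (x : G) k : expgz x (k + 1) = (expgz x k * x)%g.
Proof.
case: k => [k|[|k]]; first by rewrite -PoszD addn1 /= expgSr.
  by rewrite /= expg1 mulVg.
have -> : Negz k.+1 + 1 = Negz k by lia.
by rewrite /= [in RHS]expgS invgM -mulgA mulVg mulg1.
Qed.

Section Generators.
Variables (R : comNzRingType) (q qi : R) (u : nat -> R).
Hypothesis qqi : q * qi = 1.
Local Notation H n := (hecke q u Infinite n).
Local Notation br b := (hecke_br q u Infinite b).

HB.instance Definition _ n :=
  GRing.isMonoidMorphism.Build (gralg R (artinB n)) (H n) (@hecke_pi R q u Infinite n)
    (@qpi_monoid_morphism _ _ _).

HB.instance Definition _ n :=
  GRing.isLinear.Build R (gralg R (artinB n)) (H n) *:%R (@hecke_pi R q u Infinite n)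
    (@qpi_linear _ _ _).

(** Index 0 is t, as in [artinB_gen]. Indices out of range give 1, so in [H 0] all generators are
    1. *)
Definition hecke_gen n (i : nat) : H n :=
  if insub i is Some o then br (artinB_gen (o : 'I_n)) else 1.

Definition hecke_tpow n (k : int) : H n :=
  if insub 0%N is Some o then br (expgz (artinB_gen (o : 'I_n)) k) else 1.

Lemma hecke_genE n (i : 'I_n) : hecke_gen n i = br (artinB_gen i).
Proof. by rewrite /hecke_gen valK. Qed.

Lemma hecke_tpowE n (i : 'I_n) k :
  i = 0 :> nat -> hecke_tpow n k = br (expgz (artinB_gen i) k).
Proof.
case: i => i i_n /= i0; subst i; rewrite /hecke_tpow.
case: insubP => [o _ oE|]; last by rewrite i_n.
by congr (br (expgz (artinB_gen _) k)); apply: val_inj.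
Qed.

Lemma hecke_tpow1 n : hecke_tpow n 1 = hecke_gen n 0.
Proof. by rewrite /hecke_gen /hecke_tpow; case: insub. Qed.

Lemma br_rel n (r s : seq 'I_n) : artinB_rel r s ->
  \prod_(i <- r) hecke_gen n (nat_of_ord i) =
  \prod_(i <- s) hecke_gen n (nat_of_ord i).
Proof.
have brE w : \prod_(i <- w) hecke_gen n (nat_of_ord i) = br (cls (@artinB_rel
  n) (posw w)).
  elim: w => [|i w IHw]; first by rewrite big_nil.
  by rewrite big_cons IHw hecke_genE -hecke_brM -[(_ * _)%g]cls_cat.
by move=> rs; rewrite !brE; congr hecke_br; apply/clsP/pres_rel.
Qed.

Lemma br_expgz_pow n (b : artinB n) : int_powers (fun k => br (expgz b k)).
Proof.
have tS k : br (expgz b (k + 1)) = br (expgz b k) * br (expgz b 1).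
  by rewrite expgzS hecke_brM.
have tV : br (expgz b 1) * br (expgz b (-1)) = 1.
  by rewrite -hecke_brM [expgz b 1]expg1 [expgz b (-1)]/= expg1 mulgV.
have tSV j : br (expgz b (j - 1)) = br (expgz b j) * br (expgz b (-1)).
  by rewrite -[in RHS](subrK 1 j) tS -mulrA tV mulr1.
split=> [|k l]; first exact: hecke_br1.
elim: l => [|l IHl|l IHl]; first by rewrite addr0 [br (expgz b 0)]hecke_br1 mulr1.
  by rewrite -addn1 PoszD addrA !tS IHl mulrA.
by rewrite -addn1 PoszD opprD addrA !tSV IHl mulrA.
Qed.

Lemma hecke_tpow_pow n : int_powers (hecke_tpow n).
Proof.
rewrite /hecke_tpow; case: insub => [o|]; first exact: br_expgz_pow.
by split=> *; rewrite ?mulr1.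
Qed.

Lemma hecke_typeB n : typeB_hecke q n (hecke_gen n) (hecke_tpow n).
Proof.
have word2 i j (i_n : (i < n)%N) (j_n : (j < n)%N) : artinB_rel [:: Ordinal
  i_n; Ordinal j_n] [:: Ordinal j_n; Ordinal i_n] ->
    GRing.comm (hecke_gen n i) (hecke_gen n j).
  by move=> /br_rel; rewrite !(big_cons, big_nil) !mulr1.
split.
- move=> i /andP[i0 i_n]; have := ideal_in (hecke_quad q u Infinite (i :=
    Ordinal i_n) i0).
  move/(qpiP (@hecke_rel R q u Infinite n)).
  rewrite -[hecke_gen n i]/(hecke_gen n (Ordinal i_n)) hecke_genE.
  rewrite expr2 -hecke_brM.
  rewrite -gr_eltM.
  by move=> e; rewrite [LHS]e [LHS]qpi_add !qpi_scale.
- move=> i j i0 /andP[ij jn]; apply: (word2 i j (ltnW (ltn_trans ij jn)) jn).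
  exact: artinB_far.
- move=> i i0 Sin; have := br_rel (artinB_braid (i := Ordinal (ltnW Sin)) (j :=
    Ordinal Sin) i0 erefl).
  by rewrite !(big_cons, big_nil) !mulr1.
- exact: hecke_tpow_pow.
- move=> i k /andP[i1 i_n]; apply/commr_sym/comm_int_powers.
    exact: hecke_tpow_pow.
  have n0 : (0 < n)%N by lia.
  by rewrite hecke_tpow1; apply/commr_sym/(word2 0 i n0 i_n)/artinB_t_s.
- move=> n1; have n0 : (0 < n)%N by lia.
  have := br_rel (artinB_t_s1 (t := Ordinal n0) (s := Ordinal n1) erefl erefl).
  by rewrite !(big_cons, big_nil) !mulr1 !mulrA -!hecke_tpow1.
Qed.

Local Notation tconj n := (tconj qi (hecke_gen n) (hecke_tpow n)).
Local Notation gdown n := (gdown (hecke_gen n)).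
Local Notation ginvs n := (ginvs qi (hecke_gen n)).
Local Notation gi n i := (hecke_inv qi (hecke_gen n i)).

(** Inverses of the g_i need no case, being linear combinations of g_i and 1; t^-1 needs one because
    t satisfies no polynomial when d is infinite. *)
Lemma hecke_rind m (P : H m -> Prop) :
  P 1 -> (forall x y, P x -> P y -> P (x + y)) ->
  (forall c x, P x -> P (c *: x)) ->
  (forall x i, (0 < i < m)%N -> P x -> P (x * hecke_gen m i)) ->
  ((0 < m)%N -> forall x, P x -> P (x * hecke_tpow m 1)) ->
  ((0 < m)%N -> forall x, P x -> P (x * hecke_tpow m (-1))) ->
  forall x, P x.
Proof.
move=> P1 PD PZ Pg Pt PtV x; rewrite -[x](qpiK (S := @hecke_rel R q u Infinite m)).
elim/gr_ind: (repr x) => [|y z Py Pz|c b].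
- by have := PZ 0 1 P1; rewrite scale0r.
- by rewrite [qpi _ _]qpi_add; apply: PD.
have -> : << c *g b >> = c *: gr_elt R b by rewrite gr_scaleU mulr1.
rewrite [qpi _ _]qpi_scale; apply: (PZ); rewrite -[qpi _ _]/(br b) -[b]clsK.
elim/last_ind: (repr b) => [|w [i e] IHw]; first exact: P1.
rewrite -cats1 [cls _ _]cls_cat [hecke_br _ _ _ _]hecke_brM.
have n0 : (0 < m)%N by case: i => i /=; lia.
have [i0|i0] := posnP i.
  have tE : hecke_tpow m (if e then 1 else -1) = br (cls _ [:: (i, e)]).
    rewrite (hecke_tpowE _ i0) /artinB_gen /pgen; case: e => /=.
      by rewrite expg1.
    rewrite expg1; congr hecke_br; exact/esym/(cls_inv _ [:: (i, true)]).
  by rewrite -tE; case: e {tE}; [apply: Pt | apply: PtV].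
have i_m : (0 < i < m)%N by rewrite i0 /=.
case: e.
  by rewrite -[br (cls _ [:: _])]/(br (artinB_gen i)) -hecke_genE; apply: Pg.
have -> : br (cls _ [:: (i, false)]) = gi m i.
  have gg : br (cls _ [:: (i, false)]) * hecke_gen m i = 1.
    rewrite hecke_genE -hecke_brM -[(_ * _)%g]cls_cat -hecke_br1.
    by congr hecke_br; apply/clsP/(pres_cancel _ i false).
  rewrite -[LHS]mulr1 -(mul_gV qqi (hecke_typeB m) i_m) mulrA gg.
  by rewrite mul1r.
rewrite hecke_inv.unlock mulrBr -scalerAr -scaleN1r; apply: (PD); first exact/PZ/Pg.
by apply: (PZ); rewrite -scalerAr mulr1; apply: PZ.
Qed.

End Generators.

Section Inclusion.
Variables (R : comNzRingType) (q qi : R) (u : nat -> R).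
Hypothesis qqi : q * qi = 1.
Local Notation H n := (hecke q u Infinite n).
Local Notation br b := (hecke_br q u Infinite b).
Local Notation hg := (hecke_gen q u).
Local Notation ht := (hecke_tpow q u).
Local Notation tconj n := (tconj qi (hg n) (ht n)).
Local Notation gdown n := (gdown (hg n)).
Local Notation ginvs n := (ginvs qi (hg n)).
Local Notation gi n i := (hecke_inv qi (hg n i)).
Local Notation typeB n := (hecke_typeB q u n).

Definition hecke_up n : H n -> H n.+1 :=
  hecke_incl (leqnSn n).
HB.instance Definition _ n := GRing.Linear.on (@hecke_up n).

Fact hecke_up_monoid_morphism n : monoid_morphism (@hecke_up n).
Proof.
split; last exact: hecke_inclM.
by rewrite /hecke_up [LHS]hecke_incl_pi gr_incl1.
Qed.
HB.instance Definition _ n := GRing.isMonoidMorphism.Build (H n) (H n.+1)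
  (@hecke_up n) (@hecke_up_monoid_morphism n).

Lemma hecke_up_gen n i : (i < n)%N -> hecke_up (hg n i) = hg n.+1 i.
Proof.
move=> i_n; rewrite -[i]/(val (Ordinal i_n)) hecke_genE [LHS]hecke_incl_br.
rewrite [val _](_ : _ = val (widen_ord (leqnSn n) (Ordinal i_n))) // hecke_genE.
by congr hecke_br; apply: artinB_incl_cls.
Qed.

Lemma artinB_incl_expgz m n (h : (m <= n)%N) b k :
  artinB_incl h (expgz b k) = expgz (artinB_incl h b) k.
Proof.
have incl1 : artinB_incl h 1%g = 1%g by apply: artinB_incl_cls.
have inclX j : artinB_incl h (b ^+ j)%g = (artinB_incl h b ^+ j)%g.
  elim: j => [|j IHj]; first by rewrite !expg0.
  by rewrite !expgS artinB_inclM IHj.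
case: k => k /=; first exact: inclX.
have e : (artinB_incl h (b ^- k.+1) * artinB_incl h (b ^+ k.+1) = 1)%g.
  by rewrite -artinB_inclM mulVg.
by rewrite -[LHS]mulg1 -(mulgV (artinB_incl h (b ^+ k.+1)%g)) mulgA e mul1g inclX.
Qed.

Lemma hecke_up_tpow n k : (0 < n)%N -> hecke_up (ht n k) = ht n.+1 k.
Proof.
move=> n0; rewrite (hecke_tpowE q u (i := Ordinal n0)) //.
rewrite (hecke_tpowE q u (i := widen_ord (leqnSn n) (Ordinal n0))) //.
rewrite [LHS]hecke_incl_br artinB_incl_expgz; congr (br (expgz _ k)).
exact: artinB_incl_cls.
Qed.

End Inclusion.

(** * Spanning sets, uniqueness and the trace property in a tower *)

Section Tower.
Variables (R : comNzRingType) (q qi : R).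
Hypothesis qqi : q * qi = 1.
Variables (H : nat -> algType R) (up : forall n, {lrmorphism H n -> H n.+1}).
Variables (hg : forall n, nat -> H n) (ht : forall n, int -> H n).
Arguments up {n}.
Hypothesis typeB : forall n, typeB_hecke q n (hg n) (@ht n).
Hypothesis up_gen : forall n i, (i < n)%N -> up (hg n i) = hg n.+1 i.
Hypothesis up_tpow : forall n k, (0 < n)%N -> up (ht n k) = ht n.+1 k.
Hypothesis rind : forall m (P : H m -> Prop),
  P 1 -> (forall x y, P x -> P y -> P (x + y)) ->
  (forall c x, P x -> P (c *: x)) ->
  (forall x i, (0 < i < m)%N -> P x -> P (x * hg m i)) ->
  ((0 < m)%N -> forall x, P x -> P (x * ht m 1)) ->
  ((0 < m)%N -> forall x, P x -> P (x * ht m (-1))) ->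
  forall x, P x.
Local Notation tconj n := (tconj qi (hg n) (ht n)).
Local Notation gdown n := (gdown (hg n)).
Local Notation ginvs n := (ginvs qi (hg n)).
Local Notation gi n i := (hecke_inv qi (hg n i)).

Lemma up_inv n x : up (hecke_inv qi x) = hecke_inv qi (up x) :> H n.+1.
Proof. by rewrite !hecke_inv.unlock linearB !linearZ /= rmorph1. Qed.

Lemma up_tconj n j k : (j < n)%N -> up (tconj n j k) = tconj n.+1 j k.
Proof.
elim: j => [|j IHj] jn; first by rewrite !tconj0 up_tpow.
by rewrite !tconjE !rmorphM /= up_inv IHj ?up_gen ?(ltnW jn).
Qed.

Lemma up_gdown n i m : (m < n)%N -> up (gdown n i m) = gdown n.+1 i m.
Proof.
elim: m => [|m IHm] mn; first by rewrite !gdown0 rmorph1.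
rewrite !gdown_if; case: ifP => _; last exact: rmorph1.
by rewrite rmorphM /= up_gen // IHm // ltnW.
Qed.

Lemma up_ginvs n m : (m < n)%N -> up (ginvs n m) = ginvs n.+1 m.
Proof.
elim: m => [|m IHm] mn; first by rewrite !ginvs0 rmorph1.
by rewrite !ginvsS rmorphM /= up_inv up_gen // IHm // ltnW.
Qed.

(** The generators of [H n] are t and the g_i with i < n, all of which commute with g_(n+1). *)
Lemma up2_comm n (b : H n) :
  GRing.comm (hg n.+2 n.+1) (up (up b)).
Proof.
elim/rind: b => [|x y cx cy|c x cx|x i i_n cx|n0 x cx|n0 x cx].
- by rewrite !rmorph1; apply: commr1.
- by rewrite !rmorphD; apply: commrD.
- by rewrite !linearZ; apply: comm_scale.
- rewrite !rmorphM /=; apply: commrM => //.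
  by rewrite !up_gen; [apply: (comm_gg (typeB _))|..]; lia.
- rewrite !rmorphM /=; apply: commrM => //.
  by rewrite !up_tpow //; apply: (comm_gt (typeB _)); lia.
- rewrite !rmorphM /=; apply: commrM => //.
  by rewrite !up_tpow //; apply: (comm_gt (typeB _)); lia.
Qed.

(** Having [H n] on both sides of g_n matches the bilinearity of E_n. The guard excludes n = 0,
    where [hg 1 0] will be t. *)
Inductive tower_span n : H n.+1 -> Prop :=
| hspan0 : tower_span 0
| hspanD x y : tower_span x -> tower_span y -> tower_span (x + y)
| hspanT a k : tower_span (up a * tconj n.+1 n k)
| hspanG a b : (0 < n)%N ->
    tower_span (up a * (hg n.+1 n * up b)).

Lemma hspanZ n c (x : H n.+1) : tower_span x -> tower_span (c *: x).
Proof.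
elim=> {x} [|x y _ cx _ cy|a k|a b n0].
- by rewrite scaler0; apply: hspan0.
- by rewrite scalerDr; apply: hspanD.
- by rewrite scalerAl -linearZ; apply: hspanT.
- by rewrite scalerAl -linearZ; apply: hspanG.
Qed.

Lemma hspanN n (x : H n.+1) : tower_span x -> tower_span (- x).
Proof. by rewrite -scaleN1r; apply: hspanZ. Qed.

Lemma hspan_up n (a : H n) : tower_span (up a).
Proof.
rewrite -[up a]mulr1 -(tconj_pow qqi (typeB n.+1) (ltnSn n)).1.
exact: hspanT.
Qed.

Lemma span_mulr_up n x (c : H n) : (forall i, tower_span (tconj n.+1 n i * up c)) ->
  tower_span x -> tower_span (x * up c).
Proof.
move=> Tc; elim=> {x} [|x y _ cx _ cy|a k|a b n0].
- by rewrite mul0r; apply: hspan0.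
- by rewrite mulrDl; apply: hspanD.
- rewrite -mulrA; elim: (Tc k) => [|x y _ cx _ cy|a' k'|a' b' n0].
  + by rewrite mulr0; apply: hspan0.
  + by rewrite mulrDr; apply: hspanD.
  + by rewrite mulrA -rmorphM; apply: hspanT.
  + by rewrite mulrA -rmorphM; apply: hspanG.
- by rewrite -!mulrA -rmorphM; apply: hspanG.
Qed.

Lemma tconj_mulr_up_gen n i k : (0 < i < n)%N ->
  tower_span (tconj n.+1 n k * up (hg n i)).
Proof.
move=> i_n; rewrite up_gen; last by lia.
rewrite -(tconj_comm_low qqi (typeB n.+1)) // -up_gen; last by lia.
exact: hspanT.
Qed.

Lemma span_mull n x (c : H n) : tower_span x -> tower_span (up c * x).
Proof.
elim=> {x} [|x y _ cx _ cy|a k|a b n0].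
- by rewrite mulr0; apply: hspan0.
- by rewrite mulrDr; apply: hspanD.
- by rewrite mulrA -rmorphM; apply: hspanT.
- by rewrite mulrA -rmorphM; apply: hspanG.
Qed.

Lemma tconj_mulr_up_t n k : (0 < n)%N -> tower_span (tconj n.+1 n k * up (ht n 1)) /\
  tower_span (tconj n.+1 n k * up (ht n (-1))).
Proof.
case: n => // n _; have [t0 tD] := tb_pow (typeB n.+2).
have e := tconj_mulr_t qqi (typeB n.+2) k (ltnSn n.+1).
(* The correction term of [tconj_mulr_t], times [x]. Since [gdown] begins with the top generator and
   its other factors come from below, [r (up y)] is a difference of elements of the second kind. *)
pose r x := (1 - qi) *: (ht n.+2 k * (ginvs n.+2 n * (gdown n.+2 0 n.+1 * (ht
  n.+2 1 * x)))
                 - ginvs n.+2 n * (gdown n.+2 0 n.+1 * (ht n.+2 (k + 1) * x))).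
have rspan (y : H n.+1) : tower_span (r (up y)).
  rewrite /r gdownS // -!(@up_tpow n.+1) // -!(@up_ginvs n.+1) //.
  rewrite -!(@up_gdown n.+1) // -!mulrA -!rmorphM.
  rewrite mulrA -rmorphM; apply/hspanZ/hspanD; first exact: hspanG.
  by apply: hspanN; apply: hspanG.
have e' x : tconj n.+2 n.+1 k * (ht n.+2 1 * x) =
            ht n.+2 1 * (tconj n.+2 n.+1 k * x) + r x.
  by rewrite mulrA e mulrDl -scalerAl mulrBl -!mulrA.
split.
  rewrite -[up _]mulr1 up_tpow // e'; apply: hspanD; last first.
    by have := rspan 1; rewrite rmorph1.
  by rewrite mulr1 -(@up_tpow n.+1) //; apply: hspanT.
have tVt x : ht n.+2 (-1) * (ht n.+2 1 * x) = x by rewrite mulrA -tD addNr t0 mul1r.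
have ttV : ht n.+2 1 * ht n.+2 (-1) = 1 by rewrite -tD subrr t0.
(* The relation [e'] at t^-1, multiplied on the left by t^-1. *)
have -> : tconj n.+2 n.+1 k * up (ht n.+1 (-1)) =
    ht n.+2 (-1) * tconj n.+2 n.+1 k - ht n.+2 (-1) * r (ht n.+2 (-1)).
  rewrite -[LHS]tVt up_tpow //.
  have /eqP := e' (ht n.+2 (-1)); rewrite ttV mulr1 -subr_eq => /eqP <-.
  by rewrite mulrBr.
rewrite -(@up_tpow n.+1) //; apply: hspanD; first exact: hspanT.
by apply/hspanN/span_mull.
Qed.

Lemma tconj_mulr_up n k (c : H n) : tower_span (tconj n.+1 n k * up c).
Proof.
elim/rind: c k => [|x y cx cy|a x cx|x i i_n cx|n0 x cx|n0 x cx] k.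
- by rewrite rmorph1 mulr1 -[X in tower_span X]mul1r -(rmorph1 up); apply: hspanT.
- by rewrite rmorphD mulrDr; apply: hspanD.
- by rewrite linearZ -scalerAr; apply: hspanZ.
- rewrite rmorphM mulrA; apply: span_mulr_up => // j.
  exact: tconj_mulr_up_gen.
- rewrite rmorphM mulrA; apply: span_mulr_up => // j.
  by have [] := tconj_mulr_up_t j n0.
- rewrite rmorphM mulrA; apply: span_mulr_up => // j.
  by have [] := tconj_mulr_up_t j n0.
Qed.

Lemma span_mulr n x (c : H n) : tower_span x -> tower_span (x * up c).
Proof. by apply: span_mulr_up => i; apply: tconj_mulr_up. Qed.

Lemma tower_spanP n (x : H n.+1) : tower_span x.
Proof.
elim: n x => [|n IHn]; elim/rind => [|x y cx cy|a x cx|x i i_n cx|n0 x cx|n0 x cx];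
  try (by [rewrite -(rmorph1 up); apply: hspan_up | apply: hspanD | apply: hspanZ]).
- by lia.
- elim: cx => {x} [|x y _ cx _ cy|a k|a b //].
  + by rewrite mul0r; apply: hspan0.
  + by rewrite mulrDl; apply: hspanD.
  + rewrite -mulrA -[ht _ _](tconj0 qi (hg 1)) -(tconj_pow qqi (typeB 1) _).2 //.
    exact: hspanT.
- elim: cx => {x} [|x y _ cx _ cy|a k|a b //].
  + by rewrite mul0r; apply: hspan0.
  + by rewrite mulrDl; apply: hspanD.
  + rewrite -mulrA -[ht _ _](tconj0 qi (hg 1)) -(tconj_pow qqi (typeB 1) _).2 //.
    exact: hspanT.
- have [i_n'|ni] := ltnP i n.+1.
    by rewrite -(@up_gen n.+1) //; apply: span_mulr.
  have -> : i = n.+1 by lia.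
  elim: cx => {x} [|x y _ cx _ cy|a k|a b _].
  + by rewrite mul0r; apply: hspan0.
  + by rewrite mulrDl; apply: hspanD.
  + rewrite -mulrA -(tconjS qqi (typeB n.+2)) // -(@up_tconj n.+1) //.
    exact: hspanG.
  (* Two top generators enclose [b]. On a power of t'_n they give t'_(n+1)^k times a square, reduced
     by the quadratic relation; around g_n the braid relation leaves a single top generator. *)
  + elim: (IHn b) => [|x y _ cx _ cy|b1 k|b1 b2 n0].
    * by rewrite rmorph0 !mulr0 mul0r; apply: hspan0.
    * by rewrite rmorphD !mulrDr mulrDl; apply: hspanD.
    * rewrite rmorphM /= up_tconj // -!mulrA (mulrA2 (up2_comm b1)) -!mulrA.
      rewrite (mulrA2 (tconjS qqi (typeB n.+2) k (ltnSn n.+1))) -!mulrA.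
      rewrite (tb_quad (typeB n.+2)) ?ltnSn // !mulrDr -!scalerAr mulr1.
      rewrite -(tconjS qqi (typeB n.+2)) // -(@up_tconj n.+1) //.
      apply: hspanD; apply: hspanZ; rewrite mulrA -rmorphM.
        exact: hspanG.
      exact: hspanT.
    * rewrite !rmorphM /= (@up_gen n.+1) // -!mulrA (mulrA2 (up2_comm b1)) -!mulrA.
      rewrite -(up2_comm b2) (mulrA3 (esym (tb_braid (typeB n.+2) n0 (ltnSn _)))).
      rewrite -!mulrA -(@up_gen n.+1) // -(rmorphM up _ (up b2)) 2!mulrA -!rmorphM.
      exact: hspanG.
- by rewrite -(@up_tpow n.+1) //; apply: span_mulr.
- by rewrite -(@up_tpow n.+1) //; apply: span_mulr.
Qed.

Lemma tower_rect n (P : H n.+1 -> Prop) :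
  (forall x y, P x -> P y -> P (x + y)) ->
  (forall a k, P (up a * tconj n.+1 n k)) ->
  ((0 < n)%N -> forall a b, P (up a * (hg n.+1 n * up b))) ->
  forall x, P x.
Proof.
move=> PD PT PG x; elim: (tower_spanP x) => //.
- by have := PT 0 0; rewrite rmorph0 mul0r.
- by move=> ? ? _ ? _ ?; apply: PD.
- by move=> ? ? ?; apply: PG.
Qed.

(** * Uniqueness of Markov families *)

Section Uniqueness.
Variables (L : level) (u v : nat -> R) (z : R) (s : int -> R).
Hypothesis uv : forall j, u j * v j = 1.

(** A trace on the level [L] algebras seen on the generic ones. [f n] lives on [H n.+1] because the
    union starts at [H 1]; the last clause, with cyclicity, makes it vanish on the cyclotomic
    ideal. *)
Definition is_markov (f : forall n, {scalar H n.+1}) :=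
  [/\ forall n x y, f n (x * y) = f n (y * x),
      forall n, f n 1 = 1,
      forall n x, f n.+1 (up x) = f n x,
      forall n x, f n.+1 (up x * hg n.+2 n.+1) = z * f n x
    & (forall n x k, k \in level_exponent L -> k != 0 ->
        f n.+1 (up x * tconj n.+2 n.+1 k) = s k * f n x) /\
      (forall d, L = Level d -> forall n x,
        f n (x * \prod_(j < d) (ht n.+1 1 - (u j)%:A)) = 0)].

(** As t'_(n+1) is conjugate to t, its cyclotomic polynomial is a conjugate of that of t, and
    cyclicity moves the last conjugating factor to the front. *)
Lemma markov_shiftop f n x k d : is_markov f -> L = Level d ->
  shiftop d u (fun k => f n.+1 (up x * tconj n.+2 n.+1 k)) k = 0.
Proof.
move=> [fC _ _ _ [_ f0]] Ld.
rewrite -scalar_mull_shiftop; last exact: (tconj_pow qqi (typeB n.+2)).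
by rewrite (tconj_prod qqi (typeB n.+2)) // !mulrA fC mulrA f0.
Qed.

(** Rule 4 settles the nonzero exponents of the level and compatibility with [up] the exponent 0.
    For finite d these are the d initial values of a recurrence, which determine all the others. *)
Lemma markov_tconj_eq f f' n x : is_markov f -> is_markov f' ->
  f n x = f' n x -> forall k,
  f n.+1 (up x * tconj n.+2 n.+1 k) = f' n.+1 (up x * tconj n.+2 n.+1 k).
Proof.
move=> fM f'M ff' k.
have eqK j : j \in level_exponent L ->
    f n.+1 (up x * tconj n.+2 n.+1 j) = f' n.+1 (up x * tconj n.+2 n.+1 j).
  case: fM f'M => [_ _ fU _ [fT _]] [_ _ f'U _ [f'T _]] jK.
  have [->|j0] := eqVneq j 0; last by rewrite fT ?f'T ?ff'.
  by rewrite (tconj_pow qqi (typeB n.+2) _).1 ?mulr1 ?fU ?f'U.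
have [LE|[d Ld]] : L = Infinite \/ exists d, L = Level d.
- by case: L; [left | move=> d; right; exists d].
- by apply: eqK; rewrite LE.
apply: (shiftop_unique uv (d := d) (f := fun k => f n.+1 (up x * tconj n.+2 n.+1 k))
  (f' := fun k => f' n.+1 (up x * tconj n.+2 n.+1 k))) => [j jd|j|j].
- by apply: eqK; rewrite Ld unfold_in /= ltz_nat.
- exact: markov_shiftop.
- exact: markov_shiftop.
Qed.

Lemma tower0_scalar (a : H 0) : exists c, a = c%:A.
Proof.
elim/rind: a => [|_ _ [c ->] [c' ->]|c _ [c' ->]|x i|//|//].
- by exists 1; rewrite scale1r.
- by exists (c + c'); rewrite scalerDl.
- by exists (c * c'); rewrite scalerA.
- by rewrite ltn0 andbF.
Qed.

Lemma markov_unique f f' n x : is_markov f -> is_markov f' -> f n x = f' n x.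
Proof.
move=> fM f'M; have [fC f1 fU fG _] := fM; have [f'C f'1 f'U f'G _] := f'M.
elim: n x => [|n IHn]; elim/tower_rect=> [x y ex ey|a k|n0 a b].
- by rewrite !linearD /= ex ey.
(* Rule 4 speaks of t'_n for n >= 1 only: conjugation by g_1, invisible to a trace, replaces t by
   t'_1. *)
- have conjE h : is_markov h ->
      h 0%N (up a * tconj 1 0 k) = h 1%N (up (up a) * tconj 2 1 k).
    move=> [hC _ hU _ _]; rewrite -hU rmorphM /= up_tconj // tconjE.
    rewrite (mulrA2 (esym (up2_comm a))) -mulrA [RHS]hC -!mulrA.
    by rewrite (mul_Vg qqi (typeB 2)) // mulr1.
  rewrite !conjE //; apply: markov_tconj_eq => //.
  have [c ->] := tower0_scalar a.
  by rewrite !linearZ /= rmorph1 f1 f'1.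
- by [].
- by rewrite !linearD /= ex ey.
- exact: markov_tconj_eq.
(* Cyclicity brings both outer factors together, so the value is [z] times that of a product in the
   previous algebra. *)
- by rewrite fC f'C -!mulrA -!rmorphM fC f'C fG f'G IHn.
Qed.

End Uniqueness.

(** * Traces from bilinear maps to the previous algebra *)

Variables (z : R) (s : int -> R) (E : forall n, {linear H n.+1 -> H n}).
Hypothesis s0 : s 0 = 1.
Arguments E {n}.
Hypothesis E_mull : forall n (a : H n) (x : H n.+1), E (up a * x) = a * E x.
Hypothesis E_mulr : forall n (a : H n) (x : H n.+1), E (x * up a) = E x * a.
Hypothesis E_tconj : forall n k, E (tconj n.+1 n k) = (s k)%:A.
Hypothesis E_gen : forall n, (0 < n)%N -> E (hg n.+1 n) = z%:A.

Lemma E1 n : E (1 : H n.+1) = 1.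
Proof.
by rewrite -(tconj_pow qqi (typeB n.+1) (ltnSn n)).1 E_tconj s0 scale1r.
Qed.

Lemma E_up n (a : H n) : E (up a) = a.
Proof. by rewrite -[up a]mulr1 E_mull E1 mulr1. Qed.

(** Compared on the spanning set: conjugation turns t'_n^k into t'_(n+1)^k, which has the same
    weight, and by the braid relation g_n becomes a conjugate of g_(n+1) by g_n, again of value
    [z]. *)
Lemma E_conj n (x : H n.+1) :
  E (hg n.+2 n.+1 * (up x * gi n.+2 n.+1)) = up (E x).
Proof.
have gC a : GRing.comm (gi n.+2 n.+1) (up (up a)).
  by apply/commr_sym/comm_hecke_inv/commr_sym/up2_comm.
elim/tower_rect: x => [x y ex ey|a k|n0 a b].
- by rewrite rmorphD mulrDl mulrDr !linearD /= ex ey.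
- rewrite !rmorphM /= up_tconj // -mulrA (mulrA2 (up2_comm a)) -mulrA -tconjE.
  by rewrite !E_mull !E_tconj rmorphM /= linearZ /= rmorph1.
- rewrite !rmorphM /= up_gen // -!mulrA (mulrA2 (up2_comm a)) -!mulrA.
  rewrite -(gC b) (mulrA3 (braidV2 qqi (typeB n.+2) n0 (ltnSn _))) -!mulrA.
  rewrite -(@up_gen n.+1) // -up_inv E_mull E_mull.
  rewrite -(rmorphM up _ (up b)) E_mulr E_gen //.
  rewrite -scalerAl mul1r -scalerAr (mulrA2 (mul_Vg qqi (typeB n.+1) _)) ?n0 //=.
  by rewrite E_mull E_mulr E_gen // -scalerAl !mul1r -!scalerAr linearZ /= rmorphM.
Qed.

(** * The top generator under two successive maps *)

Section MarkovStep.
Variable n : nat.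
Local Notation G := (hg n.+2 n.+1).
Local Notation Gi := (gi n.+2 n.+1).
Local Notation T := (tconj n.+2 n).
Local Notation T' := (tconj n.+2 n.+1).
Local Notation h := (hg n.+2 n).

Definition E2 (y : H n.+2) : H n := E (E y).
Local Notation central y := (E2 (G * y) = E2 (y * G)).

Lemma E2_mull a y : E2 (up (up a) * y) = a * E2 y.
Proof. by rewrite /E2 !E_mull. Qed.

Lemma E2_mulr a y : E2 (y * up (up a)) = E2 y * a.
Proof. by rewrite /E2 !E_mulr. Qed.

Lemma E2D x y : E2 (x + y) = E2 x + E2 y.
Proof. by rewrite /E2 !linearD. Qed.

Lemma E2Z c y : E2 (c *: y) = c *: E2 y.
Proof. by rewrite /E2 !linearZ. Qed.

Lemma GG : G * G = (q - 1) *: G + q%:A.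
Proof. by apply: (tb_quad (typeB n.+2)); rewrite /= ltnSn. Qed.

Lemma GT k : G * T k = T' k * G.
Proof. exact: (tconjS qqi (typeB n.+2)). Qed.

Lemma upT k : up (tconj n.+1 n k) = T k.
Proof. exact: up_tconj. Qed.

Lemma TD k l : T (k + l) = T k * T l.
Proof. exact: (tconj_pow qqi (typeB n.+2) (leqnSn n.+1)).2. Qed.

Lemma E_T' k : E (T' k) = (s k)%:A.
Proof. exact: E_tconj. Qed.

Lemma E2_TGT k l : E2 (T k * (G * T l)) = (z * s (k + l))%:A.
Proof.
rewrite /E2 -!upT E_mull E_mulr E_gen // -scalerAl mul1r -scalerAr.
rewrite -(tconj_pow qqi (typeB n.+1) (ltnSn n)).2.
by rewrite linearZ /= E_tconj scalerA.
Qed.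

Lemma T0 : T 0 = 1.
Proof. exact: (tconj_pow qqi (typeB n.+2) (leqnSn n.+1)).1. Qed.

Lemma E2_GT k : E2 (G * T k) = (z * s k)%:A.
Proof. by rewrite -[X in E2 X]mul1r -T0 E2_TGT add0r. Qed.

Lemma E2_TT' k l : E2 (T k * T' l) = (s k * s l)%:A.
Proof.
rewrite /E2 -!upT E_mull E_T' -scalerAr mulr1 linearZ /= E_tconj scalerA.
by rewrite mulrC.
Qed.

Lemma E2_T'T k l : E2 (T' k * T l) = (s k * s l)%:A.
Proof.
rewrite /E2 -!upT E_mulr E_T' -scalerAl mul1r linearZ /= E_tconj scalerA.
by [].
Qed.

Lemma E2_TGTG k l :
  E2 (T k * (G * (T l * G))) = ((q - 1) * (z * s (k + l)) + q * (s k * s l))%:A.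
Proof.
rewrite (mulrA2 (GT l)) -mulrA GG !mulrDr -!scalerAr mulr1 E2D !E2Z.
by rewrite E2_TT' -GT E2_TGT !scalerA scalerDl.
Qed.

(* Moving the factors of T N one by one across T' l changes the value by
   al (b + 1) - al (N - b - 1), which telescopes. *)
Lemma E2_T'TG l N :
  E2 (T' l * (T N * G)) = (z * s (l + N) + (q - 1) * (s N * s l - s (l + N)))%:A.
Proof.
pose al b := s (N + l - b) * s b.
(* [S] is a discrete antiderivative of [al], defined on all integers, so [N] may be negative. The
   two sums met along the way are [S b] and, by the symmetry of [al], [S (N - b - 1)]. *)
have [S _ SS] := int_recurrence (fun b => al (b + 1)) 0 (mulr1 (1 : R)).
pose f b := E2 (T (N - b) * (T' l * (T b * G)))
            - ((q - 1) * (S b + S (N - b - 1)))%:A.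
have fS b : f (b + 1) = f b.
  set m := N - (b + 1); have mE : N - b = m + 1 by rewrite /m; lia.
  have T'T1 : T' l * T 1 = T 1 * T' l + (1 - qi) *: (T l * (G * T 1) - G * T (l + 1)).
    exact: (tconj_mulr_prev qqi (typeB n.+2)).
  have eS1 : S (b + 1) = S b + al (b + 1) by rewrite SS mul1r.
  have eS2 : S (N - b - 1) = S (m - 1) + s (b + 1 + l) * s m.
    have -> : N - b - 1 = m - 1 + 1 by rewrite /m; lia.
    rewrite SS mul1r /al; congr (_ + s _ * s _); rewrite /m; lia.
  have eal : al (b + 1) = s (m + l) * s (b + 1).
    by congr (s _ * s _); rewrite /m; lia.
  have mD : N - (b + 1) = m by [].
  clearbody m; have eT : T m * (T' l * (T (b + 1) * G)) = T (m + 1) * (T' l *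
    (T b * G)) +
      (1 - qi) *: (T (m + l) * (G * (T (b + 1) * G))
                   - T m * (G * (T (l + 1 + b) * G))).
    rewrite (addrC b) !TD -!mulrA (mulrA2 T'T1) mulrDl -scalerAl mulrBl -!mulrA.
    by rewrite mulrDr -scalerAr mulrBr !TD -!mulrA.
  rewrite /f mD eS2 mE eT eS1 eal E2D E2Z -scaleN1r E2D E2Z !E2_TGTG.
  have -> : m + (l + 1 + b) = m + l + (b + 1) by lia.
  have -> : l + 1 + b = b + 1 + l by lia.
  by lin R (H n); ring: qqi.
have fN := int_shift_const fS N; have f0 : f 0 = f N := esym fN.
move: f0; rewrite /f subrr !subr0 T0 !mul1r -GT E2_TGT => /eqP.
rewrite eq_sym subr_eq => /eqP ->.
have eS1 : S 0 = S (-1) + s 0 * s (N + l).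
  by rewrite -[0 in LHS](addNr 1) SS mul1r /al addNr subr0 mulrC.
have eS2 : S N = S (N - 1) + s l * s N.
  by rewrite -[in LHS](subrK 1 N) SS mul1r /al subrK addrAC subrr add0r.
rewrite eS1 eS2 s0 add0r (addrC l N); lin R (H n); ring.
Qed.

(** [G] commutes with the elements of [H n], so by bilinearity these leave both sides alike. *)
Lemma central_mull a y : central y -> central (up (up a) * y).
Proof.
by move=> cy; rewrite mulrA up2_comm -!mulrA !E2_mull cy.
Qed.

Lemma central_mulr b y : central y -> central (y * up (up b)).
Proof.
by move=> cy; rewrite mulrA E2_mulr cy -mulrA -up2_comm mulrA E2_mulr.
Qed.

Lemma centralD x y : central x -> central y -> central (x + y).
Proof. by move=> cx cy; rewrite mulrDr mulrDl !E2D cx cy. Qed.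

Lemma GT'E k : T' k = G * (T k * Gi). Proof. exact: tconjE. Qed.

(** On the right G meets t'_(n+1)^k and one gets [E2_TGT]. On the left a square of G appears and
    leaves a term with [Gi], whose expansion calls for [E2_T'TG]. *)
Lemma central_TT' l k : central (T l * T' k).
Proof.
have T'D i j : T' (i + j) = T' i * T' j.
  by rewrite (tconj_pow qqi (typeB n.+2) (ltnSn n.+1)).2.
rewrite -[in RHS]mulrA -GT E2_TGT {1}GT'E (mulrA2 (GT l)) -mulrA (mulrA2 GG).
rewrite mulrDl -!scalerAl mul1r -GT'E mulrDr -!scalerAr -T'D E2D !E2Z.
have -> : E2 (T' l * (T k * Gi)) = qi *: E2 (T' l * (T k * G))
                                  - (1 - qi) *: E2 (T' l * T k).
  rewrite hecke_inv.unlock !mulrBr -!scalerAr mulr1.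
  by rewrite -!scaleN1r E2D !E2Z.
rewrite E2_T'TG E2_T'T {1}/E2 E_T' linearZ /= E1.
by lin R (H n); ring: qqi.
Qed.

Lemma central_TGT l k : central (T l * (G * T k)).
Proof.
rewrite -2!mulrA E2_TGTG (mulrA2 (GT l)) -mulrA (mulrA2 GG).
rewrite mulrDl -!scalerAl mul1r mulrDr -!scalerAr E2D !E2Z E2_T'T.
by rewrite (mulrA2 (esym (GT l))) -(mulrA G) -TD E2_GT !scalerA -scalerDl.
Qed.

Hypothesis n0 : (0 < n)%N.
Local Notation e := (hg n.+1 n).

Lemma up_e : up e = h. Proof. exact: up_gen. Qed.

Lemma GhG : G * (h * G) = h * (G * h).
Proof. by rewrite (tb_braid (typeB n.+2)). Qed.

(** The braid relation leaves a conjugate [G * (up x * Gi)] behind an element of [H n.+1], and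
    [E_conj] evaluates it. *)
Lemma central_hT' b k : central (h * (up (up b) * T' k)).
Proof.
rewrite -2!mulrA -GT GT'E !(mulrA2 (esym (up2_comm b))) -!mulrA (mulrA3 GhG).
set t0 := tconj n.+1 n k.
have -> : h * (G * h) * (up (up b) * (T k * Gi)) =
          up e * (G * (up (e * (up b * t0)) * Gi)).
  by rewrite !rmorphM /= up_e upT !mulrA.
have -> : h * (G * (up (up b) * T k)) = up e * (G * up (up b * t0)).
  by rewrite !rmorphM /= up_e upT !mulrA.
rewrite /E2 !E_mull E_conj !E_mulr !E_gen // -!scalerAl !mul1r -scalerAr.
by rewrite linearZ.
Qed.

(** The quadratic relation is applied to [e] on one side and to [G] on the other; the resulting
    terms match one by one. *)
Lemma central_hGT b k : central (h * (up (up b) * (G * T k))).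
Proof.
set t0 := tconj n.+1 n k.
have hE : E2 (h * (up (up b) * T' k)) = (z * s k) *: b.
  rewrite /E2 -up_e mulrA -rmorphM E_mull E_T' -scalerAr mulr1 linearZ /=.
  by rewrite E_mulr E_gen // -scalerAl mul1r scalerA mulrC.
have hGE : E2 (h * (up (up b) * (G * T k))) = z *: E (e * (up b * t0)).
  rewrite (mulrA2 (esym (up2_comm b))).
  have -> : h * (G * up (up b) * T k) = up e * (G * up (up b * t0)).
    by rewrite !rmorphM /= up_e upT !mulrA.
  by rewrite /E2 E_mull E_mulr E_gen // -scalerAl mul1r -scalerAr linearZ.
have -> : h * (up (up b) * (G * T k)) * G =
    (q - 1) *: (h * (up (up b) * (G * T k))) + q *: (h * (up (up b) * T' k)).
  rewrite -!mulrA (mulrA2 (GT k)) -mulrA GG !mulrDr -!scalerAr mulr1.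
  by rewrite -GT.
rewrite E2D !E2Z hE hGE (mulrA2 (esym (up2_comm b))) -!mulrA (mulrA3 GhG).
have -> : h * (G * h) * (up (up b) * T k) =
          up e * (G * up (e * (up b * t0))).
  by rewrite !rmorphM /= up_e upT !mulrA.
rewrite /E2 E_mull E_mulr E_gen // -scalerAl mul1r -scalerAr linearZ /=.
rewrite (mulrA e e) (tb_quad (typeB n.+1)) ?n0 ?ltnSn // mulrDl -!scalerAl mul1r.
rewrite linearD !linearZ /= E_mull E_tconj -scalerAr mulr1.
by lin R (H n); ring.
Qed.

Lemma central_TGh l : central (T l * (G * h)).
Proof.
have E2TGh : E2 (T l * (G * h)) = z *: E (tconj n.+1 n l * e).
  rewrite /E2 -upT -up_e E_mull E_mulr E_gen // -scalerAl mul1r -scalerAr.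
  by rewrite linearZ.
rewrite -!mulrA GhG (mulrA2 (GT l)) -mulrA (mulrA2 GG) mulrDl -!scalerAl mul1r.
rewrite mulrDr -!scalerAr E2D !E2Z (mulrA2 (esym (GT l))).
set t0 := tconj n.+1 n l.
have -> : G * T l * h = G * up (t0 * e) by rewrite rmorphM /= up_e upT mulrA.
have -> : T l * (h * (G * h)) = up (t0 * e) * (G * up e).
  by rewrite rmorphM /= up_e upT !mulrA.
rewrite -up_e /E2 E_mull !E_mulr !E_gen // E_T' -!scalerAl !mul1r -!scalerAr.
rewrite -mulrA (tb_quad (typeB n.+1)) ?n0 ?ltnSn // mulrDr -!scalerAr mulr1.
by rewrite !(linearD, linearZ) /= E_tconj E_gen //; lin R (H n); ring.
Qed.

Lemma central_hGh b : central (h * (up (up b) * (G * h))).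
Proof.
rewrite [in LHS](mulrA2 (esym (up2_comm b))) -!mulrA GhG (mulrA3 GhG).
have -> : h * (G * h) * (up (up b) * h) = up e * (G * up (e * (up b * e))).
  by rewrite !rmorphM /= up_e !mulrA.
have -> : h * (up (up b) * (h * (G * h))) = up (e * (up b * e)) * (G * up e).
  by rewrite !rmorphM /= up_e !mulrA.
rewrite /E2 !E_mull !E_mulr !E_gen // -!scalerAl !mul1r -!scalerAr !linearZ /=.
have ee x : e * (e * x) = (q - 1) *: (e * x) + q *: x.
  rewrite mulrA (tb_quad (typeB n.+1)) ?n0 ?ltnSn // mulrDl -!scalerAl mul1r //.
have ee' : e * (up b * e) * e = (q - 1) *: (e * (up b * e)) + q *: (e * up b).
  rewrite -!mulrA (tb_quad (typeB n.+1)) ?n0 ?ltnSn //.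
  by rewrite !mulrDr -!scalerAr mulr1.
rewrite ee ee' !linearD !linearZ /= E_mull E_mulr E_gen //.
by rewrite -scalerAl -scalerAr mul1r mulr1.
Qed.

End MarkovStep.

Lemma E2_gen_comm n y : E2 (hg n.+2 n.+1 * y) = E2 (y * hg n.+2 n.+1).
Proof.
elim/tower_rect: y => [x y|x k|_ x y]; first exact: centralD.
  elim/tower_rect: x => [x y|a l|n0 a b].
  - by rewrite rmorphD mulrDl; apply: centralD.
  - by rewrite rmorphM -(mulrA (up _)) /= upT; apply/central_mull/central_TT'.
  - set w := up _ * _; have -> : w = up (up a) * (hg n.+2 n * (up (up b) *
      tconj n.+2 n.+1 k)).
      by rewrite /w !rmorphM /= up_gen // !mulrA.
    exact/central_mull/central_hT'.
elim/tower_rect: y => [y y'|b k|n0 b b'].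
- by rewrite rmorphD (mulrDr (hg _ _)) (mulrDr (up x)); apply: centralD.
- set w := up _ * _.
  (* [b] commutes with the top generator, so it joins the left factor, which is then expanded in its
     turn. *)
  have -> : w = up (x * up b) * (hg n.+2 n.+1 * tconj n.+2 n k).
    by rewrite /w !rmorphM /= upT (mulrA2 (up2_comm b)) !mulrA.
  elim/tower_rect: (x * up b) => [x' y'|a l|n0 a b'].
  + by rewrite rmorphD mulrDl; apply: centralD.
  + by rewrite rmorphM -(mulrA (up _)) /= upT; apply/central_mull/central_TGT.
  + set w' := up _ * _.
    have -> : w' = up (up a) * (hg n.+2 n * (up (up b') * (hg n.+2 n.+1 * tconj
      n.+2 n k))).
      by rewrite /w' !rmorphM /= up_gen // !mulrA.
    exact/central_mull/central_hGT.
- set w := up _ * _.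
  have -> : w = up (x * up b) * (hg n.+2 n.+1 * hg n.+2 n) * up (up b').
    by rewrite /w !rmorphM /= up_gen // (mulrA2 (up2_comm b)) !mulrA.
  apply: central_mulr; elim/tower_rect: (x * up b) => [x' y'|a l|_ a b''].
  + by rewrite rmorphD mulrDl; apply: centralD.
  + by rewrite rmorphM -(mulrA (up _)) /= upT; apply/central_mull/central_TGh.
  + set w' := up _ * _.
    have -> : w' = up (up a) * (hg n.+2 n * (up (up b'') * (hg n.+2 n.+1 * hg
      n.+2 n))).
      by rewrite /w' !rmorphM /= up_gen // !mulrA.
    exact/central_mull/central_hGh.
Qed.

Variable tr0 : H 0 -> R.
Hypothesis tr0_linear : scalar tr0.
Hypothesis tr0C : forall x y, tr0 (x * y) = tr0 (y * x).

Fixpoint tower_trace n : H n -> R :=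
  if n is n'.+1 then fun x => tower_trace (E x) else tr0.

Arguments tower_trace : simpl never.

Lemma tower_traceS n (x : H n.+1) : tower_trace x = tower_trace (E x).
Proof. by []. Qed.

Fact tower_trace_linear n : scalar (@tower_trace n).
Proof.
elim: n => [|n IHn] c x y; first exact: tr0_linear.
by rewrite !tower_traceS linearP IHn.
Qed.
HB.instance Definition _ n :=
  GRing.isLinear.Build R (H n) R *%R (@tower_trace n) (@tower_trace_linear n).

Lemma comm_tpow_H1 k (x : H 1) : GRing.comm (ht 1 k) x.
Proof.
elim/rind: x => [|x y cx cy|c x cx|x i|_ x cx|_ x cx]; first exact: commr1.
- exact: commrD.
- exact: comm_scale.
- by lia.
- by apply: commrM => //; apply/int_powers_comm/(tb_pow (typeB 1)).
- by apply: commrM => //; apply/int_powers_comm/(tb_pow (typeB 1)).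
Qed.

(** It suffices to move generators around. Those coming from [H n] move by bilinearity and
    induction, the top g_n by [E2_gen_comm]; t is new only in [H 1], which is commutative. *)
Lemma tower_traceC n (x y : H n) : tower_trace (x * y) = tower_trace (y * x).
Proof.
elim: n x y => [|n IHn] x y; first exact: tr0C.
have upC (c : H n) v : tower_trace (up c * v) = tower_trace (v * up c).
  by rewrite !tower_traceS E_mull E_mulr IHn.
have tC k v : tower_trace (ht n.+1 k * v) = tower_trace (v * ht n.+1 k).
  case: n {IHn x y} upC v => [|n] upC v; first by rewrite comm_tpow_H1.
  by rewrite -(@up_tpow n.+1).
elim/rind: x y => [|x x' cx cx'|c x cx|x i i_n cx|_ x cx|_ x cx] y.
- by rewrite mul1r mulr1.
- by rewrite mulrDl mulrDr !linearD /= cx cx'.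
- by rewrite -scalerAl -scalerAr !linearZ /= cx.
- rewrite -mulrA cx -mulrA.
  have gC v : tower_trace (hg n.+1 i * v) = tower_trace (v * hg n.+1 i).
    have [i_n'|ni] := ltnP i n; first by rewrite -up_gen.
    case: n {IHn x y cx upC tC} i_n ni v => [|n] i_n ni v; first by lia.
    have -> : i = n.+1 by lia.
    by rewrite !tower_traceS -!/(E2 _) E2_gen_comm.
  by rewrite gC -mulrA.
- by rewrite -mulrA cx -mulrA tC -mulrA.
- by rewrite -mulrA cx -mulrA tC -mulrA.
Qed.

Lemma tower_trace_up n (a : H n) : tower_trace (up a) = tower_trace a.
Proof. by rewrite tower_traceS E_up. Qed.

Lemma tower_trace_gen n (a : H n) : (0 < n)%N ->
  tower_trace (up a * hg n.+1 n) = z * tower_trace a.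
Proof.
by move=> n0; rewrite tower_traceS E_mull E_gen // -scalerAr mulr1 linearZ.
Qed.

Lemma tower_trace_tconj n (a : H n) k :
  tower_trace (up a * tconj n.+1 n k) = s k * tower_trace a.
Proof. by rewrite tower_traceS E_mull E_tconj -scalerAr mulr1 linearZ. Qed.

End Tower.

(** * The maps from each algebra to the previous one *)

Section ConditionalExpectation.
Variables (R : comNzRingType) (q qi : R).
Hypothesis qqi : q * qi = 1.
Variables (A B : algType R) (up : {lrmorphism A -> B}) (n : nat).
Variables (g : nat -> A) (t : int -> A) (g' : nat -> B) (t' : int -> B).
Hypothesis gtP : typeB_hecke q n g t.
Hypothesis gtP' : typeB_hecke q n.+1 g' t'.
Hypothesis up_g : forall i, (i < n)%N -> up (g i) = g' i.
Hypothesis up_t : forall k, (0 < n)%N -> up (t k) = t' k.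
Hypothesis rindA : forall P : A -> Prop,
  P 1 -> (forall x y, P x -> P y -> P (x + y)) ->
  (forall c x, P x -> P (c *: x)) ->
  (forall x i, (0 < i < n)%N -> P x -> P (x * g i)) ->
  ((0 < n)%N -> forall x, P x -> P (x * t 1)) ->
  ((0 < n)%N -> forall x, P x -> P (x * t (-1))) ->
  forall x, P x.
Hypothesis rindB : forall P : B -> Prop,
  P 1 -> (forall x y, P x -> P y -> P (x + y)) ->
  (forall c x, P x -> P (c *: x)) ->
  (forall x i, (0 < i < n.+1)%N -> P x -> P (x * g' i)) ->
  ((0 < n.+1)%N -> forall x, P x -> P (x * t' 1)) ->
  ((0 < n.+1)%N -> forall x, P x -> P (x * t' (-1))) ->
  forall x, P x.
Local Notation V := (nat -> int -> A).
Local Notation gopA := (gop q n g).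
Local Notation topA := (top qi n g t).
Local Notation topVA := (topV qi n g t).
Variable act : B -> V -> V.
Hypothesis actP : forall c x y phi,
  act (c *: x + y) phi = c *: act x phi + act y phi.
Hypothesis actM : forall x y phi, act (x * y) phi = act x (act y phi).
Hypothesis act1 : forall phi, act 1 phi = phi.
Hypothesis act_g : forall i phi, (0 < i <= n)%N -> act (g' i) phi = gopA i phi.
Hypothesis act_t : forall phi, act (t' 1) phi = topA phi.
Hypothesis act_tV : forall phi, act (t' (-1)) phi = topVA phi.
Variables (z : R) (s : int -> R).
Local Notation eps := (markov_vec qi n g t z s).

(** The entry (n, 0) is read because its label is the empty chain times t'_n^0, that is 1. *)
Definition cond_exp (x : B) : A := act x eps n 0.

Fact cond_exp_linear : linear cond_exp.
Proof. by move=> c x y; rewrite /cond_exp actP. Qed.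

Lemma actD x y phi : act (x + y) phi = act x phi + act y phi.
Proof. by rewrite -[x in LHS]scale1r actP scale1r. Qed.

Lemma act0 phi : act 0 phi = 0.
Proof. by apply: (addrI (act 0 phi)); rewrite -actD !addr0. Qed.

Lemma actZ c x phi : act (c *: x) phi = c *: act x phi.
Proof. by rewrite -[_ *: x]addr0 actP act0 addr0. Qed.

(** In row [n] each g_i with i < n is a left multiplication by construction. For t and t^-1 this
    holds in column 0, where the two correction terms coincide. *)
Lemma act_up_n0 a phi : act (up a) phi n 0 = a * phi n 0.
Proof.
have [t0 tD] := tb_pow gtP.
elim/rindA: a phi => [|x y ex ey|c x ex|x i i_n ex|n0 x ex|n0 x ex] phi.
- by rewrite rmorph1 act1 mul1r.
- by rewrite rmorphD actD mulrDl -ex -ey.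
- by rewrite linearZ /= actZ -scalerAl -ex.
- rewrite rmorphM /= actM ex up_g ?act_g ?gop_lt ?mulrA //; lia.
- rewrite rmorphM /= actM ex up_t // act_t -mulrA; congr (_ * _).
  case: n n0 => // m _; rewrite topS //.
  by rewrite t0 add0r mul1r subrr scaler0 addr0.
- rewrite rmorphM /= actM ex up_t // act_tV -mulrA; congr (_ * _).
  case: n n0 => // m _; rewrite /topV ltnn.
  by rewrite t0 mul1r subrr scaler0 subr0.
Qed.

Lemma cond_exp_mull a x : cond_exp (up a * x) = a * cond_exp x.
Proof. by rewrite /cond_exp actM act_up_n0. Qed.

Definition mulr_fun phi (a : A) : V := fun j k => phi j k * a.

Lemma gop_mulr i phi a : gopA i (mulr_fun phi a) = mulr_fun (gopA i phi) a.
Proof.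
apply/funext => j; apply/funext => k; rewrite /mulr_fun /gop.
do !case: ifP => _; by rewrite ?mulrDl -?scalerAl ?mulrA.
Qed.

Lemma top_mulr phi a : topA (mulr_fun phi a) = mulr_fun (topA phi) a.
Proof.
apply/funext => j; apply/funext => k; rewrite /mulr_fun /top.
case: ifP => // _; case: j => // j.
by rewrite mulrDl -scalerAl mulrBl !mulrA.
Qed.

Lemma topV_mulr phi a : topVA (mulr_fun phi a) = mulr_fun (topVA phi) a.
Proof.
apply/funext => j; apply/funext => k; rewrite /mulr_fun /topV.
case: ifP => // _; case: j => // j.
by rewrite -mulrA mulrBl -scalerAl mulrBl !mulrA.
Qed.

Lemma act_mulr x phi a : act x (mulr_fun phi a) = mulr_fun (act x phi) a.
Proof.
elim/rindB: x phi => [|x y ex ey|c x ex|x i i_n ex|_ x ex|_ x ex] phi.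
- by rewrite !act1.
- rewrite !actD ex ey; apply/funext => j; apply/funext => k.
  exact/esym/mulrDl.
- rewrite !actZ ex; apply/funext => j; apply/funext => k.
  exact/scalerAl.
- by rewrite !actM !act_g // gop_mulr ex.
- by rewrite !actM !act_t // top_mulr ex.
- by rewrite !actM !act_tV // topV_mulr ex.
Qed.

Lemma topV_eps : (0 < n)%N -> topVA eps = mulr_fun eps (t (-1)).
Proof.
move=> n0; have [t0 tD] := tb_pow gtP.
have epsT : topA (mulr_fun eps (t (-1))) = eps.
  rewrite top_mulr; apply/funext => j; apply/funext => k.
  by rewrite /mulr_fun (top_markov_vec qqi gtP) // -mulrA -tD subrr t0 mulr1.
rewrite -{1}epsT; apply/funext => j; apply/funext => k.
exact: (topK qi gtP).
Qed.

(** This is the purpose of the values prescribed outside row [n]: with [act_mulr] it yields the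
    right linearity. *)
Lemma act_up_eps a : act (up a) eps = mulr_fun eps a.
Proof.
elim/rindA: a => [|x y ex ey|c x ex|x i i_n ex|n0 x ex|n0 x ex].
- rewrite rmorph1 act1; apply/funext => j; apply/funext => k.
  by rewrite /mulr_fun mulr1.
- rewrite rmorphD actD ex ey; apply/funext => j; apply/funext => k.
  exact/esym/mulrDr.
- rewrite linearZ /= actZ ex; apply/funext => j; apply/funext => k.
  exact/scalerAr.
- have -> : act (up (x * g i)) eps = mulr_fun (act (up x) eps) (g i).
    rewrite rmorphM /= actM up_g ?act_g -?act_mulr; try by lia.
    congr act; apply/funext => j; apply/funext => k.
    exact: (gop_markov_vec qqi gtP).
  by rewrite ex; apply/funext => j; apply/funext => k; apply/esym/mulrA.
- have -> : act (up (x * t 1)) eps = mulr_fun (act (up x) eps) (t 1).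
    rewrite rmorphM /= actM up_t // act_t -act_mulr.
    congr act; apply/funext => j; apply/funext => k.
    exact: (top_markov_vec qqi gtP).
  by rewrite ex; apply/funext => j; apply/funext => k; apply/esym/mulrA.
- have -> : act (up (x * t (-1))) eps = mulr_fun (act (up x) eps) (t (-1)).
    by rewrite rmorphM /= actM up_t // act_tV -act_mulr topV_eps.
  by rewrite ex; apply/funext => j; apply/funext => k; apply/esym/mulrA.
Qed.

Lemma cond_exp_mulr a x : cond_exp (x * up a) = cond_exp x * a.
Proof. by rewrite /cond_exp actM act_up_eps act_mulr. Qed.

Lemma act_tpow phi k l : act (t' k) phi 0%N l = phi 0%N (l + k).
Proof.
have [t0 tD] := tb_pow gtP'.
elim: k phi l => [|k IHk|k IHk] phi l; first by rewrite t0 act1 addr0.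
  by rewrite -addn1 PoszD tD actM IHk act_t /top /= addrA.
rewrite -addn1 PoszD opprD tD actM IHk act_tV /topV /=.
by rewrite addrA.
Qed.

(** Checks that the labels are consistent: the entry (j, 0), multiplied by t'_j^k, becomes the entry
    (j, k). The induction follows the conjugation by [g' j.+1], which exchanges rows j and j + 1. *)
Lemma act_tconj phi j k : (j <= n)%N -> act (tconj qi g' t' j k) phi j 0 = phi j k.
Proof.
elim: j phi => [|j IHj] phi jn; first by rewrite tconj0 act_tpow add0r.
set psi := act (hecke_inv qi (g' j.+1)) phi.
have phiE : phi = gopA j.+1 psi.
  by rewrite -act_g // -actM (mul_gV qqi gtP') ?act1.
rewrite tconjE actM act_g // gop_eq // actM IHj -/psi; last exact: ltnW.
by rewrite {1}phiE gop_eq.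
Qed.

Lemma cond_exp_tconj k : cond_exp (tconj qi g' t' n k) = (s k)%:A.
Proof. by rewrite /cond_exp act_tconj // markov_vec_n. Qed.

Lemma cond_exp_gen : (0 < n)%N -> cond_exp (g' n) = z%:A.
Proof.
move=> n0; rewrite /cond_exp act_g ?n0 ?leqnn //.
have -> : gopA n eps n 0 = eps n.-1 0.
  have := gop_eq q g (i := n.-1) eps 0; rewrite prednK //.
  by apply; lia.
rewrite markov_vec_lt ?prednK // gdown_id mul1r.
by rewrite (tconj_pow qqi gtP _).1 // prednK.
Qed.

End ConditionalExpectation.

(** * The coset operators satisfy the defining relations *)

Section CosetAction.
Variables (R : comNzRingType) (A : algType R) (q qi : R).
Hypothesis qqi : q * qi = 1.
Variables (n : nat) (g : nat -> A) (t : int -> A).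
Hypothesis gtP : typeB_hecke q n g t.
Local Notation V := (nat -> int -> A).

Definition coset_op (i : 'I_n.+1) (phi : V) : V :=
  if i == 0 :> nat then top qi n g t phi else gop q n g i phi.

Definition coset_opV (i : 'I_n.+1) (phi : V) : V :=
  if i == 0 :> nat then topV qi n g t phi
  else qi *: gop q n g i phi - (1 - qi) *: phi.

Lemma gop_linear i : linear (gop q n g i).
Proof.
move=> c phi psi; apply/funext => j; apply/funext => k; rewrite /gop.
have fE j' k' : (c *: phi + psi) j' k' = c *: phi j' k' + psi j' k' by [].
rewrite [RHS](_ : _ = c *: gop q n g i phi j k + gop q n g i psi j k) //.
rewrite /gop !fE; do !case: ifP => _; rewrite ?mulrDr -?scalerAr //.
- by lin R A; ring.
- by lin R A; ring.
Qed.

Lemma top_linear : linear (top qi n g t).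
Proof.
move=> c phi psi; apply/funext => j; apply/funext => k.
have fE j' k' : (c *: phi + psi) j' k' = c *: phi j' k' + psi j' k' by [].
rewrite [RHS](_ : _ = c *: top qi n g t phi j k + top qi n g t psi j k) //.
rewrite /top !fE; case: ifP => // _; case: j => // j.
rewrite ?mulrDr -?scalerAr ?mulrDr -?scalerAr.
by lin R A; ring.
Qed.

Lemma topV_linear : linear (topV qi n g t).
Proof.
move=> c phi psi; apply/funext => j; apply/funext => k.
have fE j' k' : (c *: phi + psi) j' k' = c *: phi j' k' + psi j' k' by [].
rewrite [RHS](_ : _ = c *: topV qi n g t phi j k + topV qi n g t psi j k) //.
rewrite /topV !fE; case: ifP => // _; case: j => // j.
by rewrite !(mulrDr, mulrN, =^~ scalerAr); lin R A; ring.
Qed.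

Lemma coset_op_linear i : linear (coset_op i).
Proof.
move=> c phi psi; rewrite /coset_op; case: ifP => _; first exact: top_linear.
exact: gop_linear.
Qed.

Lemma coset_opV_linear i : linear (coset_opV i).
Proof.
move=> c phi psi; rewrite /coset_opV; case: ifP => _; first exact: topV_linear.
by rewrite gop_linear; lin R (V : lmodType R); ring.
Qed.

Lemma gop_quad_fun i phi : (0 < i <= n)%N ->
  gop q n g i (gop q n g i phi) = (q - 1) *: gop q n g i phi + q *: phi.
Proof.
by move=> i_n; apply/funext => j; apply/funext => k; apply: (gop_quad gtP).
Qed.

Lemma coset_opK i : cancel (coset_op i) (coset_opV i).
Proof.
move=> phi; rewrite /coset_op /coset_opV; have [i0|i0] := boolP (i == 0 :> nat).
  by apply/funext => j; apply/funext => k; apply: (topK qi gtP).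
rewrite gop_quad_fun; last by case: i i0 => i /=; lia.
by lin R (V : lmodType R); ring: qqi.
Qed.

Lemma coset_opVK i : cancel (coset_opV i) (coset_op i).
Proof.
move=> phi; rewrite /coset_op /coset_opV; have [i0|i0] := boolP (i == 0 :> nat).
  by apply/funext => j; apply/funext => k; apply: (topVK qi gtP).
have -> : qi *: gop q n g i phi - (1 - qi) *: phi =
          qi *: gop q n g i phi + (- (1 - qi)) *: phi by rewrite scaleNr.
rewrite gop_linear -[_ *: phi]addr0 gop_linear.
have -> : gop q n g i 0 = 0.
  have := gop_linear i (-1) 0 0.
  by rewrite scaler0 addr0 scaleN1r addNr.
rewrite gop_quad_fun; last by case: i i0 => i /=; lia.
by lin R (V : lmodType R); ring: qqi.
Qed.

Lemma coset_op_rel r s phi :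
  artinB_rel r s -> foldr coset_op phi r = foldr coset_op phi s.
Proof.
case=> [i j i0 j1|i j i0 j1|i j i0 ij|i j i0 ij] /=.
- have n0 : (0 < n)%N by have := ltn_ord j; rewrite j1; lia.
  rewrite /coset_op i0 j1 /=; apply/funext => k; apply/funext => l.
  exact/esym/(top_gop4 qqi gtP).
- rewrite /coset_op i0 (gtn_eqF (ltnW j1)) /=; apply/funext => k; apply/funext => l.
  by apply: (top_gop qqi gtP); have := ltn_ord j; lia.
- have j0 : (0 < j)%N by lia.
  rewrite /coset_op (gtn_eqF i0) (gtn_eqF j0); apply/funext => k; apply/funext => l.
  by apply: (gop_far gtP); have := ltn_ord j; lia.
- have j0 : (0 < j)%N by lia.
  rewrite /coset_op (gtn_eqF i0) (gtn_eqF j0) ij.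
  apply/funext => k; apply/funext => l.
  by apply: (gop_braid gtP) => //; have := ltn_ord j; lia.
Qed.

Lemma coset_op_quad (i : 'I_n.+1) phi : (0 < i)%N ->
  coset_op i (coset_op i phi) = (q - 1) *: coset_op i phi + q *: phi.
Proof.
move=> i0; rewrite /coset_op (gtn_eqF i0) gop_quad_fun //.
by case: i i0 => i /=; lia.
Qed.

End CosetAction.

(** * The trace for d = infinity *)

Section AffineTrace.
Variables (R : comNzRingType) (q qi : R) (u : nat -> R).
Hypothesis qqi : q * qi = 1.
Local Notation H n := (hecke q u Infinite n).
Local Notation hg := (hecke_gen q u).
Local Notation ht := (hecke_tpow q u).
Local Notation tconj n := (tconj qi (hg n) (ht n)).
Local Notation V n := (nat -> int -> H n).
Local Notation cop n := (@coset_op R (H n) q qi n (hg n) (ht n)).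
Local Notation copV n := (@coset_opV R (H n) q qi n (hg n) (ht n)).

Definition affine_act n (x : H n.+1) (phi : V n) : V n :=
  hecke_act (cop n) (copV n) x phi.

Let typeB n := hecke_typeB q u n.
Let opl n i : linear (cop n i) := @coset_op_linear _ _ _ _ n _ _ i.
Let opVl n i : linear (copV n i) := @coset_opV_linear _ _ _ _ n _ _ i.
Let opK n i : cancel (cop n i) (copV n i) := coset_opK qqi (typeB n) i.
Let opVK n i : cancel (copV n i) (cop n i) := coset_opVK qqi (typeB n) i.
Let oprel n r s phi := coset_op_rel qqi (typeB n) (r := r) (s := s) phi.
Let rel0 n := affine_rel_act0 (u := u) (@opl n) (@opVl n) (@opK n) (@opVK n)
  (@oprel n) (coset_op_quad qi (typeB n)).

Lemma affine_actP n c x y (phi : V n) :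
  affine_act (c *: x + y) phi = c *: affine_act x phi + affine_act y phi.
Proof. exact: (hecke_actP (@opl n) (@opVl n) (@opK n) (@opVK n) (@oprel n)
  (@rel0 n)). Qed.

Lemma affine_actM n x y (phi : V n) :
  affine_act (x * y) phi = affine_act x (affine_act y phi).
Proof. exact: (hecke_actM (@opl n) (@opVl n) (@opK n) (@opVK n) (@oprel n)
  (@rel0 n)). Qed.

Lemma affine_act1 n (phi : V n) : affine_act 1 phi = phi.
Proof. exact: (hecke_act1 (@opl n) (@opVl n) (@opK n) (@opVK n) (@oprel n)
  (@rel0 n)). Qed.

Lemma affine_act_gen n (i : 'I_n.+1) (phi : V n) :
  affine_act (hg n.+1 i) phi = cop n i phi.
Proof.
rewrite hecke_genE.
exact: (hecke_act_gen (@opl n) (@opVl n) (@opK n) (@opVK n) (@oprel n) (@rel0 n)).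
Qed.

Lemma affine_act_g n i (phi : V n) : (0 < i <= n)%N ->
  affine_act (hg n.+1 i) phi = gop q n (hg n) i phi.
Proof.
case/andP=> i0 i_n; rewrite (affine_act_gen (Ordinal (i_n : (i < n.+1)%N))).
by rewrite /coset_op (gtn_eqF i0).
Qed.

Lemma affine_act_t n (phi : V n) :
  affine_act (ht n.+1 1) phi = top qi n (hg n) (ht n) phi.
Proof. by rewrite hecke_tpow1 (affine_act_gen ord0). Qed.

Lemma affine_act_tV n (phi : V n) :
  affine_act (ht n.+1 (-1)) phi = topV qi n (hg n) (ht n) phi.
Proof.
have [t0 tD] := hecke_tpow_pow q u n.+1.
have tE : phi = affine_act (ht n.+1 1) (affine_act (ht n.+1 (-1)) phi).
  by rewrite -affine_actM -tD subrr t0 affine_act1.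
rewrite {2}tE affine_act_t; apply/funext => j; apply/funext => k.
exact/esym/(topK qi (typeB n)).
Qed.

Variables (z : R) (s : int -> R).
Hypothesis s0 : s 0 = 1.

Definition hecke_exp n : H n.+1 -> H n :=
  cond_exp qi n (hg n) (ht n) (@affine_act n) z s.

Fact hecke_exp_linear n : linear (@hecke_exp n).
Proof. exact: (@cond_exp_linear _ qi _ _ n (hg n) (ht n) _ (@affine_actP n) z s). Qed.
HB.instance Definition _ n := GRing.isLinear.Build R (H n.+1) (H n) *:%R
  (@hecke_exp n) (@hecke_exp_linear n).

(** There are no generators at rank 0, so [H 0] consists of scalars and its action on 1 reads off
    the scalar; this starts the tower of traces. *)
Definition hecke0_op (i : 'I_0) (x : R^o) : R^o := x.

Definition hecke0_trace (x : H 0) : R := hecke_act hecke0_op hecke0_op x 1.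

Let op0l i : linear (hecke0_op i). Proof. by []. Qed.
Let op0K i : cancel (hecke0_op i) (hecke0_op i). Proof. by []. Qed.
Let op0rel r r' v : artinB_rel r r' -> foldr hecke0_op v r = foldr hecke0_op v r'.
Proof. by case=> [[]|[]|[]|[]]. Qed.
Let op0quad (i : 'I_0) v : (0 < i)%N ->
  hecke0_op i (hecke0_op i v) = (q - 1) *: hecke0_op i v + q *: v.
Proof. by case: i. Qed.
Let rel00 := affine_rel_act0 (u := u) op0l op0l op0K op0K op0rel op0quad.

Fact hecke0_trace_linear : scalar hecke0_trace.
Proof. by move=> c x y; exact: (hecke_actP op0l op0l op0K op0K op0rel rel00). Qed.

Lemma hecke0_trace1 : hecke0_trace 1 = 1.
Proof. exact: (hecke_act1 op0l op0l op0K op0K op0rel rel00). Qed.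

Lemma hecke0_traceC x y : hecke0_trace (x * y) = hecke0_trace (y * x).
Proof.
congr hecke0_trace; elim/(@hecke_rind _ _ _ u qqi): x => [|x x' cx cx'|c x cx|x
  i|//|//].
- by rewrite mul1r mulr1.
- by rewrite mulrDl mulrDr cx cx'.
- by rewrite -scalerAl -scalerAr cx.
- by rewrite ltn0 andbF.
Qed.

Definition affine_trace n : H n -> R :=
  tower_trace hecke_exp hecke0_trace (n := n).

Let upT n : {lrmorphism H n -> H n.+1} := @hecke_up R q u n.
Let upg n i := @hecke_up_gen R q u n i.
Let upt n k := @hecke_up_tpow R q u n k.
Let rind n := @hecke_rind R q qi u qqi n.

Lemma hecke_exp_mull n a x :
  hecke_exp (hecke_up a * x) = a * hecke_exp x :> H n.
Proof.
exact: (@cond_exp_mull _ q qi _ _ (upT n) n _ _ _ _ (typeB n) (@upg n) (@upt n)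
  (@rind n) _ (@affine_actP n) (@affine_actM n) (@affine_act1 n)
  (@affine_act_g n) (@affine_act_t n) (@affine_act_tV n) z s a x).
Qed.

Lemma hecke_exp_mulr n a x :
  hecke_exp (x * hecke_up a) = hecke_exp x * a :> H n.
Proof.
exact: (@cond_exp_mulr _ q qi qqi _ _ (upT n) n _ _ _ _ (typeB n) (@upg n)
  (@upt n) (@rind n) (@rind n.+1) _ (@affine_actP n) (@affine_actM n)
  (@affine_act1 n) (@affine_act_g n) (@affine_act_t n) (@affine_act_tV n) z s a x).
Qed.

Lemma hecke_exp_tconj n k : hecke_exp (tconj n.+1 n k) = (s k)%:A.
Proof.
exact: (@cond_exp_tconj _ q qi qqi _ _ n _ _ _ _ (typeB n.+1) _ (@affine_actM n)
  (@affine_act1 n) (@affine_act_g n) (@affine_act_t n) (@affine_act_tV n) z s k).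
Qed.

Lemma hecke_exp_gen n : (0 < n)%N -> hecke_exp (hg n.+1 n) = z%:A.
Proof.
exact: (@cond_exp_gen _ q qi qqi _ _ n _ _ _ (typeB n) _ (@affine_act_g n) z s).
Qed.

Fact affine_trace_linear n : scalar (@affine_trace n).
Proof. exact: (@tower_trace_linear _ _ hecke_exp _ hecke0_trace_linear). Qed.
HB.instance Definition _ n :=
  GRing.isLinear.Build R (H n) R *%R (@affine_trace n) (@affine_trace_linear n).

Lemma affine_traceC n (x y : H n) : affine_trace (x * y) = affine_trace (y * x).
Proof.
exact: (@tower_traceC _ q qi qqi _ upT hg ht typeB upg upt rind z s hecke_exp s0
  hecke_exp_mull hecke_exp_mulr hecke_exp_tconj hecke_exp_gen _
  hecke0_trace_linear hecke0_traceC n x y).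
Qed.

Lemma affine_trace_up n (a : H n) : affine_trace (hecke_up a) = affine_trace a.
Proof.
exact: (@tower_trace_up _ q qi qqi _ upT hg ht typeB s hecke_exp s0
  hecke_exp_mull hecke_exp_tconj hecke0_trace n a).
Qed.

Lemma affine_trace1 n : affine_trace (1 : H n) = 1.
Proof.
elim: n => [|n IHn]; first exact: hecke0_trace1.
by rewrite -(rmorph1 (@hecke_up R q u n)) affine_trace_up.
Qed.

Lemma affine_trace_gen n (a : H n) : (0 < n)%N ->
  affine_trace (hecke_up a * hg n.+1 n) = z * affine_trace a.
Proof.
exact: (@tower_trace_gen _ _ upT hg z hecke_exp hecke_exp_mull hecke_exp_gen _
  hecke0_trace_linear n a).
Qed.

Lemma affine_trace_tconj n (a : H n) k :
  affine_trace (hecke_up a * tconj n.+1 n k) = s k * affine_trace a.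
Proof.
exact: (@tower_trace_tconj _ qi _ upT hg ht s hecke_exp hecke_exp_mull
  hecke_exp_tconj _ hecke0_trace_linear n a k).
Qed.

End AffineTrace.

(** * The algebras of the statement *)

Section BraidPowers.
Variables (R : comNzRingType) (q qi : R) (u : nat -> R).
Hypothesis qqi : q * qi = 1.
Local Notation H n := (hecke q u Infinite n).
Local Notation br b := (hecke_br q u Infinite b).
Local Notation hg := (hecke_gen q u).
Local Notation ht := (hecke_tpow q u).
Local Notation tconj n := (tconj qi (hg n) (ht n)).
Local Notation gi n i := (hecke_inv qi (hg n i)).

Lemma br_inv n (b : artinB n) : br b^-1%g * br b = 1.
Proof. by rewrite -hecke_brM mulVg. Qed.

Lemma hecke_gen_max n : hg n.+1 n = br (artinB_gen ord_max).
Proof. by rewrite -[n in LHS]/(val (@ord_max n)) hecke_genE. Qed.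

Lemma artinB_t'0 : artinB_t' 0 = artinB_gen ord0.
Proof. by rewrite /artinB_t' big_geq // mul1g invg1 mulg1. Qed.

Lemma artinB_t'S n : artinB_t' n.+1 =
  (artinB_gen ord_max * artinB_incl (leqnSn n.+1) (artinB_t' n)
   * (artinB_gen ord_max)^-1)%g.
Proof.
have incl1 : artinB_incl (leqnSn n.+1) 1%g = 1%g by apply: artinB_incl_cls.
have inclV b : artinB_incl (leqnSn n.+1) b^-1%g = (artinB_incl (leqnSn n.+1) b)^-1%g.
  rewrite -[LHS]mulg1 -(mulgV (artinB_incl (leqnSn n.+1) b)) mulgA.
  by rewrite -artinB_inclM mulVg incl1 mul1g.
have incl_gen i : artinB_incl (leqnSn n.+1) (artinB_gen i) =
    artinB_gen (widen_ord (leqnSn n.+1) i) by apply: artinB_incl_cls.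
rewrite /artinB_t'; set x := (\prod_(0 <= j < n) _)%g.
have -> : (\prod_(0 <= j < n.+1) artinB_gen (inord (n.+1 - j) : 'I_n.+2) =
          artinB_gen ord_max * artinB_incl (leqnSn n.+1) x)%g.
  rewrite big_nat_recl // subn0; congr (_ * _)%g.
    by congr artinB_gen; apply: val_inj; rewrite /= inordK.
  rewrite (big_morph _ (artinB_inclM (leqnSn n.+1)) incl1).
  rewrite big_nat [RHS]big_nat; apply: eq_bigr => j jn.
  rewrite incl_gen; congr artinB_gen; apply: val_inj.
  by rewrite subSS /= !inordK //; lia.
rewrite !artinB_inclM inclV incl_gen invgM !mulgA.
by congr (_ * _ * artinB_gen _ * _ * _)%g; apply: val_inj.
Qed.

(** Both sides are families of integer powers, so comparing them at 1 is enough, even though one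
    inverse is linear in g_i and the other comes from the braid group. *)
Lemma tconj_br n k : tconj n.+1 n k = br (expgz (artinB_t' n) k).
Proof.
apply: (int_powers_eq (tconj_pow qqi (hecke_typeB q u n.+1) (ltnSn n))
  (br_expgz_pow q u (artinB_t' n))).
rewrite [expgz _ 1]expg1.
elim: n {k} => [|n IHn].
  by rewrite tconj0 hecke_tpow1 artinB_t'0 -hecke_genE.
pose up m : {lrmorphism H m -> H m.+1} := @hecke_up R q u m.
have upE : hecke_up (tconj n.+1 n 1) = tconj n.+2 n 1.
  exact: (@up_tconj _ qi _ up hg ht (@hecke_up_gen R q u) (@hecke_up_tpow R q u)).
rewrite tconjE -upE IHn [hecke_up _]hecke_incl_br artinB_t'S !hecke_brM
  hecke_gen_max mulrA.
congr (_ * _).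
have gV : br (artinB_gen ord_max)^-1%g * hg n.+2 n.+1 = 1.
  by rewrite hecke_gen_max br_inv.
have i_n : (0 < n.+1 < n.+2)%N by rewrite /= ltnSn.
rewrite -hecke_gen_max -[RHS]mulr1 -(mul_gV qqi (hecke_typeB q u n.+2) i_n).
by rewrite mulrA gV mul1r.
Qed.

End BraidPowers.

(** * Quotient maps to the algebras of a given level *)

Section Level.
Variables (R : comNzRingType) (q qi : R) (u v : nat -> R) (L : level).
Hypothesis qqi : q * qi = 1.
Hypothesis uv : forall j, u j * v j = 1.
Local Notation H n := (hecke q u Infinite n).
Local Notation HL n := (hecke q u L n).
Local Notation hg := (hecke_gen q u).
Local Notation ht := (hecke_tpow q u).
Local Notation tconj n := (tconj qi (hg n) (ht n)).

Fact level_rel n (x : gralg R (artinB n)) :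
  hecke_rel q u Infinite x -> ideal_gen (@hecke_rel R q u L n) (idfun x).
Proof. by case=> // i s i0; apply/ideal_in/hecke_quad. Qed.

Fact idfunM n : {morph (idfun : gralg R (artinB n) -> _) : x y / x * y}.
Proof. by []. Qed.

(* The quotient map H_n(q,infinity) -> H_n(q,d). *)
Definition hecke_level n : H n -> HL n :=
  @quotalg_map R _ _ (@hecke_rel R q u Infinite n) (@hecke_rel R q u L n) idfun.

Lemma hecke_level_pi n x : hecke_level (@hecke_pi R q u Infinite n x) =
  hecke_pi q u L x.
Proof. exact: (quotalg_map_pi (@idfunM n) (@level_rel n)). Qed.

Fact hecke_level_linear n : linear (@hecke_level n).
Proof. exact: (quotalg_map_linear (@idfunM n) (@level_rel n)). Qed.
HB.instance Definition _ n :=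
  GRing.isLinear.Build R (H n) (HL n) *:%R (@hecke_level n) (@hecke_level_linear n).

Lemma hecke_levelM n : {morph @hecke_level n : x y / x * y}.
Proof. exact: (quotalg_mapM (@idfunM n) (@level_rel n)). Qed.

Lemma hecke_level1 n : hecke_level (1 : H n) = 1.
Proof. exact: hecke_level_pi. Qed.

Lemma hecke_level_surj n (x : HL n) : exists y, x = hecke_level y.
Proof.
exists (hecke_pi q u Infinite (repr x)); rewrite hecke_level_pi.
by rewrite -[LHS](qpiK (S := @hecke_rel R q u L n)).
Qed.

Lemma hecke_level_up n (x : H n) :
  hecke_level (hecke_up x) = hecke_incl (leqnSn n) (hecke_level x).
Proof.
rewrite -[x](qpiK (S := @hecke_rel R q u Infinite n)) /hecke_up.
rewrite [hecke_incl _ _]hecke_incl_pi hecke_level_pi.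
by rewrite [hecke_level (qpi _ _)]hecke_level_pi hecke_incl_pi.
Qed.

Lemma hecke_level_gen n : hecke_level (hg n.+2 n.+1) = hecke_g q u L n.+1.
Proof. by rewrite hecke_gen_max [LHS]hecke_level_pi. Qed.

Lemma hecke_level_tconj n k : hecke_level (tconj n.+1 n k) = hecke_t'z q u L n k.
Proof. by rewrite (tconj_br u qqi) [LHS]hecke_level_pi. Qed.

Lemma hecke_level_cycl n d : L = Level d ->
  hecke_level (\prod_(j < d) (ht n.+1 1 - (u j)%:A)) = 0.
Proof.
move=> Ld; rewrite (big_morph _ (@hecke_levelM n.+1) (@hecke_level1 n.+1)).
have := ideal_in (hecke_cycl q u (i := (ord0 : 'I_n.+1)) Ld erefl).
rewrite -[X in ideal_gen _ X]subr0 => /qpiP; rewrite rmorph0 => <-.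
rewrite rmorph_prod; apply: eq_bigr => j _ /=.
have tE : ht n.+1 1 = hecke_br q u Infinite (artinB_gen (@ord0 n)).
  by rewrite hecke_tpow1; exact: (hecke_genE q u ord0).
have lE : hecke_level (ht n.+1 1) = qpi (@hecke_rel R q u L n.+1) (gr_elt R
  (artinB_gen ord0)).
  by rewrite tE; exact: hecke_level_pi.
rewrite linearB [RHS]linearB /= lE; congr (_ - _).
by rewrite !linearZ /= hecke_level1.
Qed.

End Level.

Lemma shiftop_mulr (R : comNzRingType) d (u : nat -> R) f c k :
  shiftop d u (fun k => f k * c) k = shiftop d u f k * c.
Proof.
elim: d u f => //= d IHd u f; rewrite -IHd; congr (shiftop _ _ _ _).
by apply/funext => l; rewrite mulrBl mulrA.
Qed.

(** * Existence and uniqueness at a given level *)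

Section MarkovTrace.
Variables (R : comNzRingType) (q qi : R) (u v : nat -> R) (L : level).
Hypothesis qqi : q * qi = 1.
Hypothesis uv : forall j, u j * v j = 1.
Hypothesis hL : level_proper L.
Variables (z : R) (s : int -> R).
Local Notation H n := (hecke q u Infinite n).
Local Notation HL n := (hecke q u L n).
Local Notation hg := (hecke_gen q u).
Local Notation ht := (hecke_tpow q u).
Local Notation tconj n := (tconj qi (hg n) (ht n)).
Local Notation level x := (hecke_level L x).

Let up n : {lrmorphism H n -> H n.+1} := @hecke_up R q u n.
Let typeB n := hecke_typeB q u n.
Let upg n i := @hecke_up_gen R q u n i.
Let upt n k := @hecke_up_tpow R q u n k.
Let rind n := @hecke_rind R q qi u qqi n.

Fact hecke_in_linear n : linear (@hecke_in R q u L n).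
Proof. exact: (@dl_in_linear R (hecke_sys q u L) n). Qed.
HB.instance Definition _ n := GRing.isLinear.Build R (HL n.+1) (heckeU q u L) *:%R
  (@hecke_in R q u L n) (@hecke_in_linear n).

Lemma hecke_in_incl n (a : HL n.+1) :
  hecke_in (hecke_incl (leqnSn n.+1) a) = hecke_in a.
Proof. exact: (@dl_in_map _ (hecke_sys q u L) n n.+1 (leqnSn n.+1)). Qed.

Section Unique.
Variable tr : heckeU q u L -> R.
Hypothesis tr_linear : scalar tr.
Hypothesis trP : markov_rules z s tr.

Definition pull_trace n (x : H n.+1) : R := tr (hecke_in (level x)).

Fact pull_trace_linear n : scalar (@pull_trace n).
Proof. by move=> c x y; rewrite /pull_trace !linearP tr_linear. Qed.
HB.instance Definition _ n :=
  GRing.isLinear.Build R (H n.+1) R *%R (@pull_trace n) (@pull_trace_linear n).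

Lemma pull_trace_markov :
  @is_markov R qi (fun n => H n) up hg ht L u z s (fun n => @pull_trace n).
Proof.
case: trP => trC tr1 trG trT; rewrite /is_markov.
have trU n (x : H n.+1) : pull_trace (hecke_up x) = pull_trace x.
  by rewrite /pull_trace hecke_level_up hecke_in_incl.
split=> [n x y|n|n x|n x|]; first by rewrite /= /pull_trace !hecke_levelM trC.
- by rewrite /= /pull_trace hecke_level1 tr1.
- exact: trU.
- by rewrite /= /pull_trace hecke_levelM hecke_level_up hecke_level_gen trG.
split=> [n x k kL k0|d Ld n x] /=.
  by rewrite /pull_trace hecke_levelM hecke_level_up (hecke_level_tconj u L qqi) trT.
rewrite /pull_trace hecke_levelM hecke_level_cycl // mulr0 linear0.
by have := tr_linear (-1) 0 0; rewrite scaler0 addr0 mulN1r addNr.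
Qed.

End Unique.

Lemma markov_trace_unique (tr tr' : heckeU q u L -> R) : scalar tr -> scalar tr' ->
  markov_rules z s tr -> markov_rules z s tr' -> tr = tr'.
Proof.
move=> trl trl' trP trP'; apply/funext; apply: dl_ind => n a.
have [y ->] := hecke_level_surj a.
exact: (@markov_unique R q qi qqi _ up hg ht typeB upg upt rind L u v z s uv _ _ n y
  (pull_trace_markov trl trP) (pull_trace_markov trl' trP')).
Qed.

Lemma level_weights : exists S : int -> R, [/\ S 0 = 1,
  forall k, k \in level_exponent L -> k != 0 -> S k = s k &
  forall d, L = Level d -> forall k, shiftop d u S k = 0].
Proof.
(* Rule 2 forces the weight 1 at exponent 0, which for finite d is among the initial values because
   d >= 1. *)
pose s' (k : int) := if k == 0 then 1 else s k.
case: L hL => [_|d d0]; first by exists s'; split=> // k _ k0; rewrite /s' ifN.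
have [f fs' f0] := shiftop_exists d s' uv.
exists f; split=> [|k|_ [<-] //]; first exact: (fs' 0%N).
rewrite unfold_in /=; case: k => // k kd k0.
by rewrite fs' /s' ?ifN.
Qed.

Section Exist.
Variable S : int -> R.
Hypothesis S0 : S 0 = 1.
Hypothesis Ss : forall k, k \in level_exponent L -> k != 0 -> S k = s k.
Hypothesis Sd : forall d, L = Level d -> forall k, shiftop d u S k = 0.
Local Notation atr := (affine_trace qqi z S).

(** The product in t comes from [H 1], so right linearity carries it down through the maps E_n. In
    [H 1] the recurrence for [S] kills it. *)
Lemma affine_trace_cycl n d (a : H n.+1) : L = Level d ->
  atr (a * \prod_(j < d) (ht n.+1 1 - (u j)%:A)) = 0.
Proof.
move=> Ld; elim: n a => [|n IHn] a.
  elim/(@tower_rect R q qi qqi (fun n => H n) up hg ht typeB upg upt rind): a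
    => [x y ex ey|b k|//].
    rewrite mulrDl [LHS]linearD -[RHS]addr0; congr (_ + _); [exact: ex | exact: ey].
  rewrite tconj0 -mulrA scalar_mull_shiftop; last exact: hecke_tpow_pow.
  transitivity (shiftop d u (fun k => S k * atr b) k).
    congr (shiftop _ _ _ _); apply/funext => l.
    rewrite -[ht 1 l](tconj0 qi (hg 1)).
    exact: (affine_trace_tconj qqi).
  by rewrite shiftop_mulr Sd // mul0r.
have -> : \prod_(j < d) (ht n.+2 1 - (u j)%:A) =
          hecke_up (\prod_(j < d) (ht n.+1 1 - (u j)%:A)) :> H n.+2.
  rewrite rmorph_prod; apply: eq_bigr => j _ /=.
  rewrite [RHS]linearB /= hecke_up_tpow //; congr (_ - _).
  by rewrite [RHS]linearZ /= rmorph1.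
rewrite -[LHS]/(atr (hecke_exp qi z S (a * hecke_up _))).
by rewrite hecke_exp_mulr // IHn.
Qed.

(** The free right factor [a] makes the property stable under right multiplication, and cyclicity
    then handles left multiplication. *)
Lemma affine_trace_ideal n (y : gralg R (artinB n.+1)) (a : H n.+1) :
  ideal_gen (@hecke_rel R q u L n.+1) y -> atr (hecke_pi q u Infinite y * a) = 0.
Proof.
have pi0 : hecke_pi q u Infinite (0 : gralg R (artinB n.+1)) = 0 by [].
move=> Iy; elim: Iy a => {y} [y [i x i0|d i x Ld i0]| |y y' _ ey _ ey'|b y _
  ey|b y _ ey] a.
- have -> : hecke_pi q u Infinite (x ^+ 2 - ((q - 1) *: x + q%:A)) = 0 :> H n.+1.
    rewrite -pi0; apply/qpiP; rewrite subr0.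
    exact/ideal_in/hecke_quad.
  by rewrite mul0r linear0.
- have i0' : i = 0%N :> nat := i0.
  rewrite affine_traceC // -(affine_trace_cycl a Ld); congr (atr (a * _)).
  rewrite [LHS]rmorph_prod; apply: eq_bigr => j _.
  rewrite [LHS]linearB hecke_tpow1 -i0' hecke_genE; congr (_ - _).
  by rewrite [LHS]linearZ.
- by rewrite pi0 mul0r linear0.
- by rewrite [hecke_pi _ _ _ _]linearD mulrDl [LHS]linearD [X in X + _]ey [X in
    _ + X]ey' addr0.
- by rewrite [hecke_pi _ _ _ _]rmorphM -mulrA affine_traceC // -mulrA ey.
- by rewrite [hecke_pi _ _ _ _]rmorphM -mulrA ey.
Qed.

(** The representative is lifted to the generic algebra; [affine_trace_ideal] makes the choice
    irrelevant. *)
Definition level_trace n (x : HL n.+1) : R := atr (hecke_pi q u Infinite (repr x)).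

Lemma level_traceE n (x : H n.+1) : level_trace (level x) = atr x.
Proof.
have xE : x = hecke_pi q u Infinite (repr x) by rewrite [RHS]qpiK.
set y := repr x in xE *; set y' := repr (hecke_pi q u L y).
have e : atr (hecke_pi q u Infinite y' - hecke_pi q u Infinite y) = 0.
  rewrite -[_ - _]mulr1 -linearB.
  exact/affine_trace_ideal/repr_qpi.
have {}e : atr (hecke_pi q u Infinite y') = atr (hecke_pi q u Infinite y).
  by apply/eqP; rewrite -subr_eq0 -linearB; apply/eqP; exact: e.
by rewrite xE hecke_level_pi; exact: e.
Qed.

Lemma level_traceE_up n (x : H n.+1) :
  level_trace (level (hecke_up x)) = level_trace (level x).
Proof. by rewrite !level_traceE affine_trace_up. Qed.

Lemma level_trace_incl m n (h : (m.+1 <= n.+1)%N) (x : HL m.+1) :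
  level_trace (hecke_incl h x) = level_trace x.
Proof.
have [k nE] : exists k, n = (m + k)%N by exists (n - m)%N; lia.
elim: k n h nE => [|k IHk] n h nE.
  by rewrite addn0 in nE; subst n; rewrite hecke_incl_id.
rewrite addnS in nE; subst n.
have h' : (m.+1 <= (m + k).+1)%N by lia.
apply: etrans (IHk _ h' erefl).
have [y yE] := hecke_level_surj (hecke_incl h' x).
rewrite yE -level_traceE_up; congr level_trace; rewrite hecke_level_up -yE.
exact/esym/hecke_incl_comp.
Qed.

Definition union_trace (x : heckeU q u L) : R := level_trace (tagged (repr x)).

Lemma union_traceE n (a : HL n.+1) : union_trace (hecke_in a) = level_trace a.
Proof.
have /dl_inP[p [hx [ha e]]] := dl_in_repr (hecke_in a).
rewrite /union_trace -(@level_trace_incl _ _ hx) -(@level_trace_incl _ _ ha).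
congr level_trace; exact: e.
Qed.

Lemma union_trace_linear : scalar union_trace.
Proof.
move=> c; apply: dl_ind2 => n x y.
rewrite -[dl_in x]/(hecke_in x) -[dl_in y]/(hecke_in y) -linearP !union_traceE.
have [x' ->] := hecke_level_surj x; have [y' ->] := hecke_level_surj y.
by rewrite -linearP !level_traceE linearP.
Qed.

Lemma union_trace_markov : markov_rules z s union_trace.
Proof.
split=> [n a b|n|n a|n a k kL k0]; rewrite !union_traceE.
- have [x ->] := hecke_level_surj a; have [y ->] := hecke_level_surj b.
  by rewrite -!hecke_levelM !level_traceE affine_traceC.
- by rewrite -hecke_level1 level_traceE affine_trace1.
- have [x ->] := hecke_level_surj a.
  rewrite -hecke_level_up -hecke_level_gen -hecke_levelM !level_traceE.
  exact: affine_trace_gen.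
- have [x ->] := hecke_level_surj a.
  rewrite -hecke_level_up -(hecke_level_tconj u L qqi) -hecke_levelM !level_traceE.
  by rewrite affine_trace_tconj Ss.
Qed.

End Exist.

Theorem markov_trace_exists_unique :
  exists! tr : heckeU q u L -> R, scalar tr /\ markov_rules z s tr.
Proof.
have [S [S0 Ss Sd]] := level_weights.
exists (union_trace S); split.
  by split; [apply: union_trace_linear | apply: union_trace_markov].
move=> tr [trl trP]; apply: markov_trace_unique => //.
- exact: union_trace_linear.
- exact: union_trace_markov.
Qed.

End MarkovTrace.

Lemma lvar_unit i : exists x : laurent, lvar i * x = 1.
Proof.
exists (gr_elt int ((<< i >> : laurent_monom)^-1)%g).
by rewrite -[LHS]gr_eltM mulgV.
Qed.

Unset Implicit Arguments.

Theorem theorem6 (L : level) (hL : level_proper L)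
    (z : laurent) (s : int -> laurent) :
  exists! tr : heckeU qq uu L -> laurent,
    scalar tr /\ markov_rules z s tr.
Proof.
have [qi qqi] := lvar_unit None.
have [v uv] := choice (fun j => lvar_unit (Some j)).
exact: markov_trace_exists_unique qqi uv hL z s.
Qed.
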